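(* Work over $\mathbb{Q}$, i.e. with scalars $\mathcal{R}_l\otimes\mathbb{Q}=\mathbb{Q}[\lambda_1,\ldots,\lambda_l]$. Let $\alpha,\beta\in T_\lambda$ with integer tails that are partitions, and let $X$ be an object of the Deligne category $\mathcal{C}_{|\lambda|}$ (acting on $\mathcal{C}_\lambda$). Then $$H_{\alpha,\beta}(X)={}^{\beta}HS\otimes_{\mathrm{End}(M^\beta)}\mathrm{Hom}_{\mathcal{C}_\lambda}(M^\alpha,X\otimes M^\beta)\otimes_{\mathrm{End}(M^\alpha)}HS^\alpha$$ is finite dimensional (finitely generated over $\mathbb{Q}[\lambda_1,\ldots,\lambda_l]$) and interpolates the spaces $\mathrm{Hom}_{S_d}(S^{\phi_\mu(\alpha)},F_d(X)\otimes S^{\phi_\mu(\beta)})$ functorially in $X$: for every composition $\mu=(\mu_1,\ldots,\mu_l)$ of $d$ such that $\phi_\mu(\alpha)$ and $\phi_\mu(\beta)$ are partitions, the specialisation functors induce a surjective map $$H_{\alpha,\beta}(X)\to\mathrm{Hom}_{S_d}\big(S^{\phi_\mu(\alpha)},F_d(X)\otimes S^{\phi_\mu(\beta)}\big)$$ natural in $X$.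
   Context: **The category $\mathcal{C}_\lambda$ over $\mathbb{Q}$.** Compositions are finite sequences of nonnegative integers up to trailing zeros. $\lambda=(\lambda_1,\ldots,\lambda_l)$ are variables; scalars are $\mathbb{Q}[\lambda_1,\ldots,\lambda_l]$. $T_\lambda$ is the set of sequences $\alpha=(\lambda_1+\sigma_1,\ldots,\lambda_l+\sigma_l,\tau_1,\tau_2,\ldots)$ with $\sigma\in\mathbb{Z}^l$, $\tau$ a composition (the integer tail), $\sum_i\sigma_i+|\tau|=0$. $T_\lambda(\alpha,\beta)$ is the set of matrices $q=(q_{ij})$ (rows indexed by positions of $\beta$, columns by positions of $\alpha$) with $q_{ii}\in\lambda_i+\mathbb{Z}$ for $i\le l$, other entries in $\mathbb{Z}_{\ge0}$, row sums $\beta$, column sums $\alpha$. $\mathcal{C}_\lambda$ is the Karoubian envelope (with finite direct sums) of the category with objects $M^\alpha$, $\alpha\in T_\lambda$, with $\mathrm{Hom}(M^\alpha,M^\beta)$ free on $\xi_q$, $q\in T_\lambda(\alpha,\beta)$, and $\xi_r\xi_s=\sum_q\big(\sum_A\prod_{i,k}\frac{(\sum_ja_{ijk})!}{\prod_ja_{ijk}!}\big)\xi_q$, over 3-tensors $A$ with $a_{iii}\in\lambda_i+\mathbb{Z}$ ($i\le l$), other entries in $\mathbb{Z}_{\ge0}$, $\sum_ka_{ijk}=r_{ij}$, $\sum_ja_{ijk}=q_{ik}$, $\sum_ia_{ijk}=s_{jk}$ (multinomials read as polynomials). **Deligne category and action.** $\mathcal{C}_{|\lambda|}$ is the same construction with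 $l=1$ and variable $t$, scalars extended along $t\mapsto|\lambda|=\lambda_1+\cdots+\lambda_l$; it realises Deligne's category $\underline{\mathrm{Rep}}(S_{|\lambda|})$. Action: for $\rho\in T_t$, $\beta\in T_\lambda$, $M^\rho\otimes M^\beta=\bigoplus_\gamma M^\gamma$ over matrices $\gamma$ with row sums $\rho$, column sums $\beta$, $\gamma_{1j}\in\lambda_j+\mathbb{Z}$ for $j\le l$, other entries in $\mathbb{Z}_{\ge0}$ ($M^\gamma$: vector of entries of $\gamma$, with $\gamma_{11},\ldots,\gamma_{1l}$ first). For $\xi_p:M^\rho\to M^{\rho'}$, $\xi_q:M^\beta\to M^{\beta'}$, the component $M^\gamma\to M^{\gamma'}$ of $\xi_p\otimes\xi_q$ is $\sum_T\xi_T$ over 4-tensors (rows $(i,j)$, columns $(k,m)$) with $T_{1j1j}\in\lambda_j+\mathbb{Z}$ for $j\le l$, other entries in $\mathbb{Z}_{\ge0}$, $\sum_{k,m}T_{ijkm}=\gamma'_{ij}$, $\sum_{i,j}T_{ijkm}=\gamma_{km}$, $\sum_{j,m}T_{ijkm}=p_{ik}$, $\sum_{i,k}T_{ijkm}=q_{jm}$. $\mathrm{End}(M^\beta)$ acts on $\mathrm{Hom}(M^\alpha,X\otimes M^\beta)$ by postcomposition with $\mathrm{id}_X\otimes(-)$. **The modules $HS$.** For $\alpha\in T_\lambda$ with tail a partition and $N$ entries (set $\alpha_{N+1}=0$), let $\Delta_r=\det(x_{ij})_{i,j=1}^r$ and expand $\prod_{r=1}^N\Delta_r^{\alpha_r-\alpha_{r+1}}$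 ''about the diagonal'': $\Delta_r^{c}=(x_{11}\cdots x_{rr})^{c}\sum_{m\ge0}\binom{c}{m}\big(\frac{\Delta_r}{x_{11}\cdots x_{rr}}-1\big)^m$. Let $c_q$ be the coefficient of $\prod_{ij}x_{ij}^{q_{ij}}$. $HS^\alpha$ is the left $\mathrm{End}(M^\alpha)$-module which is free of rank one over the scalars with $\xi_q$ acting by $c_q$; ${}^\alpha HS$ is the analogous right module (same scalars). **Specialisation.** $\phi_\mu$ is evaluation $\lambda\mapsto\mu$. For a composition $\nu$ of $d$, $M^\nu$ is the permutation module of $\mathbb{Q}S_d$ on words with $\nu_j$ letters $j$; for a nonnegative integer matrix $q$ with column sums $\nu$, row sums $\nu'$, $\xi_q(w)$ is the sum of words $w'$ with $\#\{m:w_m=j,w'_m=i\}=q_{ij}$. $F_\mu:\mathcal{C}_\lambda\to S_d$-mod sends $M^\alpha\mapsto M^{\phi_\mu(\alpha)}$ and $C\xi_q\mapsto\phi_\mu(C)\xi_{\phi_\mu(q)}$ (zero if a negative entry occurs); $F_d$ on $\mathcal{C}_{|\lambda|}$ is the case $l=1$, $t\mapsto d$. $S^\nu$ is the Specht module of the partition $\nu$ over $\mathbb{Q}$. The map in the claim is obtained by applying $F_\mu$ to the middle factor, sending the generators of $HS^\alpha$, ${}^\beta HS$ to generators of the one-dimensional spaces $\mathrm{Hom}(S^{\phi_\mu(\alpha)},M^{\phi_\mu(\alpha)})$, $\mathrm{Hom}(M^{\phi_\mu(\beta)},S^{\phi_\mu(\beta)})$, and composing. *)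

(* Defs.v *)
From HB Require Import structures.
From mathcomp Require Import all_boot all_order all_algebra perm finmap.
From mathcomp Require Import monalg mpoly.
From mathcomp Require Import boolp classical_sets functions cardinality fsbigop.

Set Implicit Arguments.
Unset Strict Implicit.
Unset Printing Implicit Defensive.

Import Order.TTheory GRing.Theory Num.Theory.
Local Open Scope ring_scope.

(* monalg also declares this notation, for a different type. *)
Notation "{ 'mpoly' T [ n ] }" := (mpoly n T) : type_scope.

(** Positions are numbered from 0, so the rows and columns carrying a formal
    variable [lambda_i] are those of index [i < l].  An element [x] of a coset
    [lambda_i + Z] is always stored as the integer [x - lambda_i].  Sequences are
    given by representatives: adding trailing zeros to a [Tseq] only adds zero
    rows and columns to the matrices below. *)

Record Tseq (l : nat) := MkTseq {
  tsz : nat;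
  tent :> tsz.-tuple int;
  tsz_ge : (l <= tsz)%N;
  tent_ge0 : forall i, (l <= i)%N -> 0 <= tent`_i;
  tent_sum : \sum_(i < tsz) tent`_i = 0
}.

Definition partition_tail l (al : Tseq l) : Prop :=
  forall i j, (l <= i <= j)%N -> al`_j <= al`_i.

Definition is_Tmat l (al be : Tseq l) (q : 'M[int]_(tsz be, tsz al)) : bool :=
  [&& [forall i : 'I_(tsz be), forall j : 'I_(tsz al),
        ((i == j :> nat) && (i < l)%N) || (0 <= q i j)],
      [forall i, \sum_j q i j == be`_i] &
      [forall j, \sum_i q i j == al`_j]].

Definition Tmat l (al be : Tseq l) : Type :=
  {q : 'M[int]_(tsz be, tsz al) | is_Tmat q}.

Definition fallp n (x : {mpoly rat[n]}) (m : nat) : {mpoly rat[n]} :=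
  \prod_(s < m) (x - s%:R).

Definition binp n (x : {mpoly rat[n]}) (m : nat) : {mpoly rat[n]} :=
  (m`!%:R^-1 : rat) *: fallp x m.

Definition tens3 l (al be ga : Tseq l) : Type :=
  {ffun 'I_(tsz ga) * 'I_(tsz be) * 'I_(tsz al) -> int}.

Definition is_tens3 l (al be ga : Tseq l)
    (r : Tmat be ga) (s : Tmat al be) (q : Tmat al ga) (A : tens3 al be ga) :
    bool :=
  [&& [forall i : 'I_(tsz ga), forall j : 'I_(tsz be), forall k : 'I_(tsz al),
        [&& i == j :> nat, j == k :> nat & (i < l)%N] || (0 <= A (i, j, k))],
      [forall i, forall j, \sum_k A (i, j, k) == val r i j],
      [forall i, forall k, \sum_j A (i, j, k) == val q i k] &
      [forall j, forall k, \sum_i A (i, j, k) == val s j k]].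

(** [(\sum_j a_ijk)! / \prod_j a_ijk!].  If [i = k < l] the numerator is [x!]
    with [x = v_i + (an integer)], one denominator is [(x - m)!] with [m] the sum
    of the other [a_ijk], and the quotient of the two is the polynomial
    [x (x - 1) ... (x - m + 1)]. *)
Definition multinom3 n l (v : l.-tuple {mpoly rat[n]}) (al be ga : Tseq l)
    (A : tens3 al be ga) (i : 'I_(tsz ga)) (k : 'I_(tsz al)) :
    {mpoly rat[n]} :=
  if (i == k :> nat) && (i < l)%N then
    ((\prod_(j < tsz be | j != i :> nat) (absz (A (i, j, k)))`!)%N%:R^-1 : rat)
      *: fallp (v`_i + (\sum_j A (i, j, k))%:~R)
               (\sum_(j < tsz be | j != i :> nat) absz (A (i, j, k)))%N
  else
    ((\sum_j absz (A (i, j, k)))`! %/ \prod_j (absz (A (i, j, k)))`!)%N%:R.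

(** Scalars are polynomials in [n] variables, and [v] gives the values of the
    [l] variables of the category: [n = l] and [v = ('X_0, ..., 'X_(l-1))] for
    [C_lambda], and [l = 1], [v = (\sum_i 'X_i)] for Deligne's category with
    scalars extended along [t |-> |lambda|]. *)
Definition lam_vars l : l.-tuple {mpoly rat[l]} := [tuple 'X_i | i < l].
Definition del_vars l : 1.-tuple {mpoly rat[l]} :=
  [tuple of [:: \sum_(i < l) 'X_i]].

Definition hom n l (al be : Tseq l) := {malg {mpoly rat[n]}[Tmat al be]}.

(** The sums over [\in] range over infinite sets, but have finite support. *)
Definition xi_mul n l (v : l.-tuple {mpoly rat[n]}) (al be ga : Tseq l)
    (r : Tmat be ga) (s : Tmat al be) : hom n al ga :=
  \sum_(q \in [set: Tmat al ga]%classic)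
    (\sum_(A \in [set A | is_tens3 r s q A]%classic)
       \prod_i \prod_k multinom3 v A i k) *: << q >>.

Section LinearExtension.
Variables (R : comNzRingType) (K K' : choiceType) (V : lmodType R).

Definition lext (F : K -> V) (f : {malg R[K]}) : V :=
  \sum_(k <- monalg.msupp f) monalg.mcoeff k f *: F k.

Lemma lextw F (f : {malg R[K]}) (d : {fset K}) :
  (monalg.msupp f `<=` d)%fset ->
  lext F f = \sum_(k <- d) monalg.mcoeff k f *: F k.
Proof.
move=> fd; rewrite /lext (big_fset_incl _ fd) //= => k _.
by rewrite -monalg.mcoeff_eq0 => /eqP ->; rewrite scale0r.
Qed.

Lemma lext_linear F : linear (lext F).
Proof.
move=> c f g; pose d := (monalg.msupp f `|` monalg.msupp g)%fset.
have fd : (monalg.msupp f `<=` d)%fset by exact: fsubsetUl.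
have gd : (monalg.msupp g `<=` d)%fset by exact: fsubsetUr.
have fgd : (monalg.msupp (c *: f + g) `<=` d)%fset.
  apply: fsubset_trans (monalg.msuppD_le _ _) _.
  by apply: fsetUSS => //; exact: monalg.msuppZ_le.
rewrite (lextw _ fd) (lextw _ gd) (lextw _ fgd) scaler_sumr -big_split /=.
apply: eq_bigr => k _.
by rewrite monalg.mcoeffD monalg.mcoeffZ scalerDl scalerA.
Qed.
End LinearExtension.

Section Bilinear.
Variables (R : comNzRingType) (K K' : choiceType) (V : lmodType R).

Definition bilin (F : K -> K' -> V) (f : {malg R[K]}) (g : {malg R[K']}) : V :=
  lext (fun k => lext (F k) g) f.

Lemma bilin_linearl F g : linear (bilin F ^~ g).
Proof. exact: lext_linear. Qed.

Lemma bilin_linearr F f : linear (bilin F f).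
Proof.
have E u : bilin F f u =
    \sum_(k <- monalg.msupp f) monalg.mcoeff k f *: lext (F k) u by [].
move=> c g h; rewrite !E scaler_sumr -big_split /=; apply: eq_bigr => k _.
by rewrite lext_linear scalerDr !scalerA mulrC.
Qed.
End Bilinear.

Lemma tmat_diagP l (al : Tseq l) :
  is_Tmat (al := al) (be := al) (\matrix_(i, j) (al`_i *+ (i == j))).
Proof.
apply/and3P; split.
- apply/forallP => i; apply/forallP => j; rewrite !mxE.
  case: (eqVneq i j) => [<-|ij]; last by rewrite mulr0n lexx orbT.
  by rewrite eqxx /=; case: ltnP => //= li; rewrite mulr1n tent_ge0.
- apply/forallP => i; rewrite (bigD1 i) //= mxE eqxx mulr1n.
  rewrite big1 ?addr0 // => j ji.
  by rewrite mxE eq_sym (negbTE ji).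
- apply/forallP => j; rewrite (bigD1 j) //= mxE eqxx mulr1n.
  rewrite big1 ?addr0 // => i ij.
  by rewrite mxE (negbTE ij).
Qed.

Definition hid n l (al : Tseq l) : hom n al al :=
  << exist (fun q => is_Tmat q) _ (tmat_diagP al) : Tmat al al >>.

Section DirectProduct.
Variables (R : nzRingType) (T : finType) (V : T -> lmodType R).

Definition dprod := {dffun forall t : T, V t}.
HB.instance Definition _ := Choice.on dprod.

Implicit Types f g h : dprod.
Definition dprod0 : dprod := [ffun t => 0].
Definition dprodN f : dprod := [ffun t => - f t].
Definition dprodD f g : dprod := [ffun t => f t + g t].
Definition dprodZ (c : R) f : dprod := [ffun t => c *: f t].

Fact dprodDA : associative dprodD.
Proof. by move=> f g h; apply/ffunP => t; rewrite !ffunE addrA. Qed.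
Fact dprodDC : commutative dprodD.
Proof. by move=> f g; apply/ffunP => t; rewrite !ffunE addrC. Qed.
Fact dprod0D : left_id dprod0 dprodD.
Proof. by move=> f; apply/ffunP => t; rewrite !ffunE add0r. Qed.
Fact dprodND : left_inverse dprod0 dprodN dprodD.
Proof. by move=> f; apply/ffunP => t; rewrite !ffunE addNr. Qed.
HB.instance Definition _ :=
  GRing.isZmodule.Build dprod dprodDA dprodDC dprod0D dprodND.

Fact dprodZA c d f : dprodZ c (dprodZ d f) = dprodZ (c * d) f.
Proof. by apply/ffunP => t; rewrite !ffunE scalerA. Qed.
Fact dprodZ1 : left_id 1 dprodZ.
Proof. by move=> f; apply/ffunP => t; rewrite !ffunE scale1r. Qed.
Fact dprodZDr : right_distributive dprodZ +%R.
Proof. by move=> c f g; apply/ffunP => t; rewrite !ffunE scalerDr. Qed.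
Fact dprodZDl f : {morph dprodZ^~ f : c d / c + d}.
Proof. by move=> c d; apply/ffunP => t; rewrite !ffunE scalerDl. Qed.
HB.instance Definition _ :=
  GRing.Zmodule_isLmodule.Build R dprod dprodZA dprodZ1 dprodZDr dprodZDl.
End DirectProduct.

(** The data of an [R]-linear category; associativity and the unit laws play no
    role in the definitions below. *)
Record lincat (R : nzRingType) := LinCat {
  ob :> Type;
  mor : ob -> ob -> lmodType R;
  idm : forall x, mor x x;
  compm : forall x y z, mor y z -> mor x y -> mor x z;
  compm_linearl : forall x y z (g : mor x y),
    linear ((compm (z := z))^~ g);
  compm_linearr : forall x y z (f : mor y z), linear (compm (x := x) f)
}.
Arguments mor {R l}.
Arguments idm {R l}.
Arguments compm {R l x y z}.

Definition Ccat n l (v : l.-tuple {mpoly rat[n]}) : lincat {mpoly rat[n]} :=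
  @LinCat _ (Tseq l) (fun al be => hom n al be : lmodType {mpoly rat[n]})
    (hid n (l := l))
    (fun al be ga => bilin (xi_mul v (al := al) (be := be) (ga := ga)))
    (fun al be ga => bilin_linearl (xi_mul v (al := al) (be := be) (ga := ga)))
    (fun al be ga => bilin_linearr (xi_mul v (al := al) (be := be) (ga := ga))).

Section Karoubi.
Variables (R : nzRingType) (C : lincat R).

Definition rawhom (I J : finType) (x : I -> C) (y : J -> C) :=
  dprod (fun p : J * I => mor (x p.2) (y p.1)).

Definition rcomp (I J K : finType) (x : I -> C) (y : J -> C) (z : K -> C)
    (g : rawhom y z) (f : rawhom x y) : rawhom x z :=
  [ffun p : K * I => \sum_(j : J)
     (compm (g (p.1, j)) (f (j, p.2)) : mor (x p.2) (z p.1))].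

Record kobj := KObj {
  kidx : finType;
  kob : kidx -> C;
  kidem : rawhom kob kob
}.
Arguments kob : clear implicits.

Definition is_idem (X : kobj) : Prop := rcomp (kidem X) (kidem X) = kidem X.

Record karoubi := Karoubi {
  kar_obj :> kobj;
  kar_idem : is_idem kar_obj
}.

Definition khom_pred (X Y : kobj) : {pred rawhom (kob X) (kob Y)} :=
  fun f => (rcomp (kidem Y) f == f) && (rcomp f (kidem X) == f).

Fact rcomp_linearl (I J K : finType) (x : I -> C) (y : J -> C) (z : K -> C)
  (f : rawhom x y) : linear (rcomp (z := z) ^~ f).
Proof.
move=> c g h; apply/ffunP => p; rewrite !ffunE /= scaler_sumr -big_split /=.
by apply: eq_bigr => j _; rewrite !ffunE compm_linearl.
Qed.

Fact rcomp_linearr (I J K : finType) (x : I -> C) (y : J -> C) (z : K -> C)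
  (g : rawhom y z) : linear (rcomp (x := x) g).
Proof.
move=> c f h; apply/ffunP => p; rewrite !ffunE /= scaler_sumr -big_split /=.
by apply: eq_bigr => j _; rewrite !ffunE compm_linearr.
Qed.

Fact linear_at0 (U V : lmodType R) (h : U -> V) : linear h -> h 0 = 0.
Proof.
by move=> hl; have := hl (-1) 0 0; rewrite scaler0 add0r scaleN1r addNr.
Qed.

Fact khom_closed X Y : submod_closed (@khom_pred X Y).
Proof.
split.
  apply/andP; split; apply/eqP; first exact: linear_at0 (rcomp_linearr _).
  exact: linear_at0 (rcomp_linearl _).
move=> c f g /andP[/eqP f1 /eqP f2] /andP[/eqP g1 /eqP g2].
apply/andP; split; apply/eqP.
  by rewrite rcomp_linearr f1 g1.
by rewrite rcomp_linearl f2 g2.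
Qed.
HB.instance Definition _ X Y :=
  GRing.isSubmodClosed.Build R (rawhom (kob X) (kob Y)) (@khom_pred X Y)
    (@khom_closed X Y).

Record khom (X Y : kobj) := KHom {
  kraw :> rawhom (kob X) (kob Y);
  krawP : kraw \in @khom_pred X Y
}.
HB.instance Definition _ X Y := [isSub for @kraw X Y].
HB.instance Definition _ X Y := [Choice of khom X Y by <:].
HB.instance Definition _ X Y := [SubChoice_isSubLmodule of khom X Y by <:].

(** [tokhom] is only applied to elements of [khom_pred]: composites of
    morphisms are morphisms by associativity. *)
Definition tokhom (X Y : kobj) (f : rawhom (kob X) (kob Y)) : khom X Y :=
  insubd 0 f.

Definition kid (X : kobj) : khom X X := tokhom (kidem X).

Definition kcomp (X Y Z : kobj) (g : khom Y Z) (f : khom X Y) : khom X Z :=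
  tokhom (rcomp (kraw g) (kraw f)).

Definition kincl (x : C) : kobj :=
  @KObj unit (fun=> x) [ffun p => idm x].
End Karoubi.
Arguments kob {R C}.
Arguments kidem {R C}.
Arguments kraw {R C X Y}.
Arguments kid {R C}.

Definition Clam l : lincat {mpoly rat[l]} := Ccat (lam_vars l).
Definition Cdel l : lincat {mpoly rat[l]} := Ccat (del_vars l).

(** Pairs of positions are numbered in row-major order, so that the entries
    [(0, j)] with [j < l] come first. *)
Section Cells.
Variables (m n : nat).

Fact cell_row_subproof (x : 'I_(m * n)) : (x %/ n < m)%N.
Proof. by rewrite ltn_divLR //; case: n x => [|//] []; rewrite muln0. Qed.
Fact cell_col_subproof (x : 'I_(m * n)) : (x %% n < n)%N.
Proof. by rewrite ltn_pmod //; case: n x => [|//] []; rewrite muln0. Qed.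
Fact cell_subproof (i : 'I_m) (j : 'I_n) : (i * n + j < m * n)%N.
Proof.
by apply: (@leq_trans (i * n + n)); rewrite ?ltn_add2l // -mulSnr leq_mul2r
  ltn_ord orbT.
Qed.

Definition cell_row (x : 'I_(m * n)) : 'I_m := Ordinal (cell_row_subproof x).
Definition cell_col (x : 'I_(m * n)) : 'I_n := Ordinal (cell_col_subproof x).
Definition cell (i : 'I_m) (j : 'I_n) : 'I_(m * n) :=
  Ordinal (cell_subproof i j).

Lemma cellK x : cell (cell_row x) (cell_col x) = x.
Proof. by apply: val_inj; rewrite /= -divn_eq. Qed.
Lemma cell_rowK i j : cell_row (cell i j) = i.
Proof.
have n0 : (0 < n)%N by apply: leq_ltn_trans (ltn_ord j).
by apply: val_inj; rewrite /= divnMDl // divn_small ?addn0.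
Qed.
Lemma cell_colK i j : cell_col (cell i j) = j.
Proof. by apply: val_inj; rewrite /= modnMDl modn_small. Qed.

Lemma sum_cell (F : 'I_m -> 'I_n -> int) :
  \sum_(x < m * n) F (cell_row x) (cell_col x) = \sum_i \sum_j F i j.
Proof.
rewrite pair_big /= [LHS](reindex (fun p : 'I_m * 'I_n => cell p.1 p.2)) /=.
  by apply: eq_bigr => -[i j] _; rewrite cell_rowK cell_colK.
exists (fun x => (cell_row x, cell_col x)) => [[i j]|x] _ /=.
  by rewrite cell_rowK cell_colK.
exact: cellK.
Qed.
End Cells.

Section Action.
Variable l : nat.

Definition is_Gam (rho : Tseq 1) (be : Tseq l) (g : 'M[int]_(tsz rho, tsz be)) :
    bool :=
  [&& [forall i : 'I_(tsz rho), forall j : 'I_(tsz be),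
        ((i == 0 :> nat) && (j < l)%N) || (0 <= g i j)],
      [forall i, \sum_j g i j == rho`_i] &
      [forall j, \sum_i g i j == be`_j]].

Definition Gam (rho : Tseq 1) (be : Tseq l) : Type :=
  {g : 'M[int]_(tsz rho, tsz be) | is_Gam g}.

Section Flatten.
Variables (rho : Tseq 1) (be : Tseq l) (g : Gam rho be).

Let N := (tsz rho * tsz be)%N.
Definition gent : N.-tuple int :=
  [tuple val g (cell_row x) (cell_col x) | x < N].

Fact gent_ge : (l <= N)%N.
Proof.
by apply: leq_trans (tsz_ge be) _; apply: leq_pmull; apply: tsz_ge.
Qed.

Fact gent_ge0 i : (l <= i)%N -> 0 <= gent`_i.
Proof.
move=> li; case: (ltnP i N) => iN; last first.
  by rewrite nth_default // size_tuple.
rewrite -[i]/(val (Ordinal iN)) -tnth_nth tnth_mktuple.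
case/and3P: (valP g) => /forallP/(_ (cell_row (Ordinal iN))).
move=> /forallP/(_ (cell_col (Ordinal iN)))/orP[/andP[/eqP /= i0 il] _ _|//].
by move: li; rewrite {1}(divn_eq i (tsz be)) i0 leqNgt il.
Qed.

Fact gent_sum : \sum_(i < N) gent`_i = 0.
Proof.
under eq_bigr => i _ do rewrite -tnth_nth tnth_mktuple.
rewrite (sum_cell (val g)); apply: etrans (tent_sum rho).
apply: eq_bigr => i _.
by case/and3P: (valP g) => _ /forallP/(_ i)/eqP.
Qed.

Definition gob : Tseq l := MkTseq gent_ge gent_ge0 gent_sum.
End Flatten.

Definition is_tens4 (rho rho' : Tseq 1) (be be' : Tseq l) (g : Gam rho be)
    (g' : Gam rho' be') (p : Tmat rho rho') (q : Tmat be be')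
    (T : Tmat (gob g) (gob g')) : bool :=
  [forall i, forall k,
     \sum_j \sum_m val T (cell i j) (cell k m) == val p i k] &&
  [forall j, forall m,
     \sum_i \sum_k val T (cell i j) (cell k m) == val q j m].

Definition xi_tens (rho rho' : Tseq 1) (be be' : Tseq l) (g : Gam rho be)
    (g' : Gam rho' be') (p : Tmat rho rho') (q : Tmat be be') :
    hom l (gob g) (gob g') :=
  \sum_(T \in [set T | is_tens4 p q T]%classic)
    (<< T >> : hom l (gob g) (gob g')).

(** The set of all [gamma] for given [rho] and [beta] is finite. *)
Definition Gams (rho : Tseq 1) (be : Tseq l) : finType :=
  fset_set [set: Gam rho be]%classic.

Definition tens_idx (I : finType) (x : I -> Tseq 1) (be : Tseq l) : finType :=
  {a : I & Gams (x a) be}.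

Definition tens_ob (I : finType) (x : I -> Tseq 1) (be : Tseq l)
    (t : tens_idx x be) : Clam l :=
  gob (val (tagged t)).

Definition rtens (I J : finType) (x : I -> Tseq 1) (y : J -> Tseq 1)
    (be be' : Tseq l) (f : rawhom (C := Cdel l) x y) (h : hom l be be') :
    rawhom (tens_ob (x := x) (be := be)) (tens_ob (x := y) (be := be')) :=
  [ffun p : tens_idx y be' * tens_idx x be =>
     bilin (xi_tens (val (tagged p.2)) (val (tagged p.1)))
       (f (tag p.1, tag p.2)) h].

(** [X \otimes M^be] *)
Definition act (X : kobj (Cdel l)) (be : Tseq l) : kobj (Clam l) :=
  @KObj _ (Clam l) (tens_idx (kob X) be) (tens_ob (be := be))
    (rtens (kidem X) (hid l be)).
End Action.

Section HS.
Variables (l : nat) (al : Tseq l).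
Local Notation R := {mpoly rat[l]}.
Local Notation N := (tsz al).

Definition alpha (i : nat) : R := (lam_vars l)`_i + (al`_i)%:~R.

(** [Delta_r / (x_11 ... x_rr)]; the variable of index [(i, j)] is [x_ij] for
    [i != j], and [x_ii^-1] for [i = j]. *)
Definition Delta_red (r : nat) (rN : (r <= N)%N) : {mpoly R[N * N]} :=
  \det (\matrix_(i < r, j < r)
    if i == j then 1
    else 'X_(cell (widen_ord rN i) (widen_ord rN j)) *
         'X_(cell (widen_ord rN i) (widen_ord rN i))).

(** [\prod_r Delta_r ^ (al_r - al_(r+1))] is [\prod_i x_ii ^ al_i] times
    [\prod_r \sum_m 'C(al_r - al_(r+1), m) (Delta_r / (x_11 ... x_rr) - 1) ^ m].
    All monomials of [Delta_r / (x_11 ... x_rr) - 1] have positive degree in the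
    [x_ij], [i != j], so that for the coefficient below it is enough to sum over
    [m <= hs_deg q]. *)
Definition hs_deg (q : Tmat al al) : nat :=
  (\sum_i \sum_(j | j != i) absz (val q i j))%N.

Definition hs_expansion (K : nat) : {mpoly R[N * N]} :=
  \prod_(r < N) \sum_(m < K.+1)
    binp (alpha r - alpha r.+1) m *: (Delta_red (ltn_ord r) - 1) ^+ m.

Definition hs_monom (q : Tmat al al) : 'X_{1.. N * N} :=
  [multinom (let i := cell_row x in let j := cell_col x in
             if i == j then absz (al`_i - val q i i)%R else absz (val q i j))
   | x < N * N].

Definition hs_coef (q : Tmat al al) : R :=
  mcoeff (hs_monom q) (hs_expansion (hs_deg q)).

Definition hs_char (h : hom l al al) : R := lext (hs_coef : _ -> R^o) h.

Definition HSl (h : hom l al al) (x : R^o) : R^o := hs_char h *: x.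
Definition HSr (x : R^o) (h : hom l al al) : R^o := hs_char h *: x.
End HS.

(** [A (x)_S M (x)_T B], for algebras [S] and [T] over [R]. *)
Section Tensor3.
Local Open Scope quotient_scope.
Variables (R : comNzRingType) (A M B : lmodType R) (S T : Type).
Variables (ra : A -> S -> A) (lm : S -> M -> M).
Variables (rm : M -> T -> M) (lb : T -> B -> B).

Definition tfree := {malg R[(A * M * B)%type]}.
HB.instance Definition _ := GRing.Lmodule.on tfree.

Local Notation "[< a , m , b >]" := (<< (a, m, b) >> : tfree).

Inductive trel : tfree -> Prop :=
| trel_linl k a a' m b :
    trel ([< k *: a + a', m, b >] - (k *: [< a, m, b >] + [< a', m, b >]))
| trel_linm k a m m' b :
    trel ([< a, k *: m + m', b >] - (k *: [< a, m, b >] + [< a, m', b >]))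
| trel_linr k a m b b' :
    trel ([< a, m, k *: b + b' >] - (k *: [< a, m, b >] + [< a, m, b' >]))
| trel_ball a s m b : trel ([< ra a s, m, b >] - [< a, lm s m, b >])
| trel_balr a m t b : trel ([< a, rm m t, b >] - [< a, m, lb t b >]).

Inductive tspan : tfree -> Prop :=
| tspan0 : tspan 0
| tspanD k u w : trel u -> tspan w -> tspan (k *: u + w).

Definition tspanb : {pred tfree} := fun u => `[< tspan u >].

Fact tspan_submod : submod_closed tspanb.
Proof.
split; first by apply/asboolP; exact: tspan0.
move=> c u w /asboolP us /asboolP ws; apply/asboolP.
elim: us => [|k v z vr _ IH]; first by rewrite scaler0 add0r.
by rewrite scalerDr scalerA -addrA; apply: tspanD.
Qed.
HB.instance Definition _ :=
  GRing.isSubmodClosed.Build R tfree tspanb tspan_submod.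

Definition tensor3 := Quotient.quot tspanb.
HB.instance Definition _ := GRing.Zmodule.on tensor3.
HB.instance Definition _ := EqQuotient.on tensor3.

Local Notation "[ 'pi' u ]" := (\pi_(Quotient.quot tspanb) u : tensor3).

Definition tscale (k : R) (x : tensor3) : tensor3 := [pi k *: repr x].

Fact tscaleE k u : tscale k [pi u] = [pi k *: u].
Proof.
apply/eqP; rewrite -Quotient.idealrBE -scalerBr rpredZ //.
by rewrite Quotient.idealrBE reprK.
Qed.
Fact tpi_ind (P : tensor3 -> Prop) : (forall u, P [pi u]) -> forall x, P x.
Proof. by move=> Pu x; rewrite -[x]reprK. Qed.
Fact tpiD u w : [pi u] + [pi w] = [pi u + w].
Proof. by rewrite -raddfD. Qed.

Fact tscaleA k k' x : tscale k (tscale k' x) = tscale (k * k') x.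
Proof. by elim/tpi_ind: x => u; rewrite !tscaleE scalerA. Qed.
Fact tscale1 : left_id 1 tscale.
Proof. by elim/tpi_ind => u; rewrite tscaleE scale1r. Qed.
Fact tscaleDr : right_distributive tscale +%R.
Proof.
move=> k; elim/tpi_ind => u; elim/tpi_ind => w.
by rewrite tpiD !tscaleE tpiD scalerDr.
Qed.
Fact tscaleDl x : {morph tscale^~ x : k k' / k + k'}.
Proof.
by move=> k k'; elim/tpi_ind: x => u; rewrite !tscaleE tpiD scalerDl.
Qed.
HB.instance Definition _ :=
  GRing.Zmodule_isLmodule.Build R tensor3 tscaleA tscale1 tscaleDr tscaleDl.

Definition pure (a : A) (m : M) (b : B) : tensor3 := [pi [< a, m, b >]].
End Tensor3.

Definition finitely_generated (R : nzRingType) (V : lmodType R) : Prop :=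
  exists (n : nat) (h : 'I_n -> V),
    forall x, exists c : 'I_n -> R, x = \sum_(i < n) c i *: h i.

Section Hspace.
Variables (l : nat) (al be : Tseq l) (X : kobj (Cdel l)).

(** [Hom (M^al, X \otimes M^be)] *)
Definition midhom := khom (kincl (al : Clam l)) (act X be).

(** [psi] acts by [id_X \otimes psi], and the identity of [X] is its
    idempotent. *)
Definition mid_l (psi : hom l be be) (f : midhom) : midhom :=
  tokhom (X := kincl (al : Clam l)) (Y := act X be)
    (rcomp (rtens (kidem X) psi) (kraw f)).

Definition mid_r (f : midhom) (psi : hom l al al) : midhom :=
  tokhom (X := kincl (al : Clam l)) (Y := act X be)
    (rcomp (kraw f) [ffun p => psi]).

Definition Hsp :=
  tensor3 (@HSr l be) mid_l mid_r (@HSl l al).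
HB.instance Definition _ := GRing.Lmodule.on Hsp.

Definition Hpure (y : {mpoly rat[l]}^o) (f : midhom) (x : {mpoly rat[l]}^o) :
    Hsp := pure (@HSr l be) mid_l mid_r (@HSl l al) y f x.
End Hspace.

(** The morphism [(g \otimes id) \circ f] *)
Definition mid_map l (al be : Tseq l) (X Y : kobj (Cdel l)) (g : khom X Y)
    (f : midhom al be X) : midhom al be Y :=
  tokhom (X := kincl (al : Clam l)) (Y := act Y be)
    (rcomp (rtens (kraw g) (hid l be)) (kraw f)).

(** The [S_d]-modules in use are subspaces of permutation modules: a function
    [u] on an [S_d]-set [A] stands for [\sum_a u(a) a]. *)
Record sset (d : nat) := SSet {
  scar :> finType;
  sact : 'S_d -> scar -> scar
}.
Arguments sact {d s}.

Notation Qfun A := {ffun A -> rat^o}.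

Definition pact d (A : sset d) (s : 'S_d) (u : Qfun A) : Qfun A :=
  [ffun a => u (sact s^-1%g a)].

Record smod (d : nat) := SMod {
  sbase :> sset d;
  sspace : {vspace Qfun sbase}
}.
Arguments sspace {d}.

Definition perm_mod d (A : sset d) : smod d := @SMod d A fullv.

Notation slin U V := ('Hom(subvs_of (sspace U), subvs_of (sspace V))).

Definition equivariant d (U V : smod d) (f : slin U V) : Prop :=
  forall (s : 'S_d) (x y : subvs_of (sspace U)),
    vsval y = pact s (vsval x) -> vsval (f y) = pact s (vsval (f x)).

Definition prod_sset d (A B : sset d) : sset d :=
  @SSet d (A * B)%type (fun s p => (sact s p.1, sact s p.2)).

Definition fun_tens (A B : finType) (u : Qfun A) (w : Qfun B) :
    Qfun (A * B)%type :=
  [ffun p => (u p.1 : rat) * w p.2].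

Definition smod_tens d (U V : smod d) : smod d :=
  @SMod d (prod_sset U V)
    <<[seq fun_tens u w | u <- vbasis (sspace U), w <- vbasis (sspace V)]>>%VS.

Section Kernel.
Variables (A B : finType) (K : B -> A -> rat).

Definition kap (u : Qfun A) : Qfun B := [ffun b => \sum_a K b a * u a].

Fact kap_linear : linear kap.
Proof.
move=> c u w; apply/ffunP => b; rewrite !ffunE scaler_sumr -big_split /=.
by apply: eq_bigr => a _; rewrite !ffunE mulrDr /GRing.scale /= mulrCA.
Qed.
HB.instance Definition _ :=
  GRing.isLinear.Build rat (Qfun A) (Qfun B) _ kap kap_linear.
End Kernel.

Definition kapl (A B C : finType) (K : B -> A -> rat)
    (u : Qfun (A * C)%type) : Qfun (B * C)%type :=
  [ffun p => \sum_a K p.1 a * u (a, p.2)].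

Definition idtens (A C : finType) (U : {vspace Qfun C})
    (f : 'Hom(subvs_of (fullv : {vspace Qfun C}), subvs_of U))
    (u : Qfun (A * C)%type) : Qfun (A * C)%type :=
  [ffun p => vsval (f (vsproj fullv [ffun c => u (p.1, c)])) p.2].

Section Specialisation.
Variables (n : nat) (mu : n.-tuple nat) (l : nat) (m : l.-tuple nat) (d : nat).

(** The scalars are evaluated at [mu], and the variables of the sequences and
    matrices at [m]. *)
Definition eval_mu (p : {mpoly rat[n]}) : rat := p.@[fun i => (tnth mu i)%:R].

Definition phi (al : Tseq l) (i : nat) : int := (nth 0%N m i)%:Z + al`_i.

Definition phi_mx (al be : Tseq l) (q : Tmat al be) : 'M[int]_(tsz be, tsz al) :=
  \matrix_(i, j) (val q i j + (nth 0%N m i)%:Z *+ (i == j :> nat)).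

Definition is_partition (nu : nat -> int) : Prop :=
  (forall i, 0 <= nu i) /\ (forall i j, (i <= j)%N -> nu j <= nu i).

Definition is_word (al : Tseq l) (w : {ffun 'I_d -> 'I_(tsz al)}) : bool :=
  [forall j, (#|[pred k | w k == j]|)%:Z == phi al j].

Definition word (al : Tseq l) : finType :=
  {w : {ffun 'I_d -> 'I_(tsz al)} | is_word w}.

Definition word_perm (al : Tseq l) (s : 'S_d) (w : {ffun 'I_d -> 'I_(tsz al)}) :
  {ffun 'I_d -> 'I_(tsz al)} := [ffun k => w (s^-1%g k)].

Fact word_permP (al : Tseq l) s (w : word al) : is_word (word_perm s (val w)).
Proof.
apply/forallP => j; have /forallP/(_ j)/eqP <- := valP w.
rewrite -[in X in X == _]sum1_card -[in X in _ == X]sum1_card.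
rewrite (reindex_inj (@perm_inj _ s)) /=; apply/eqP; congr Posz.
by apply: eq_bigl => k; rewrite !inE ffunE permK.
Qed.

Definition words (al : Tseq l) : sset d :=
  @SSet d (word al) (fun s w => Sub (word_perm s (val w)) (word_permP s w)).

(** [M^(phi al)]; it is zero if [phi al] has a negative entry. *)
Definition Mmod (al : Tseq l) : smod d := perm_mod (words al).

(** The matrix of [xi_(phi q)]; it is zero if [phi q] has a negative entry. *)
Definition F_xi (al be : Tseq l) (q : Tmat al be) (w' : word be) (w : word al) :
    rat :=
  [forall i, forall j,
     #|[pred k | (val w k == j) && (val w' k == i)]|%:Z == phi_mx q i j]%:R.

Definition F_hom (al be : Tseq l) (h : hom n al be) (w' : word be)
    (w : word al) : rat :=
  \sum_(q <- monalg.msupp h) eval_mu (monalg.mcoeff q h) * F_xi q w' w.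

(** Polytabloids: a tableau of shape [phi al] has the number [k] in row [w k]
    and column [c k]. *)
Definition is_tableau (al : Tseq l) (t : word al * {ffun 'I_d -> 'I_d}) : bool :=
  injectiveb (fun k => (val t.1 k, t.2 k)) &&
  [forall k, (t.2 k)%:Z < phi al (val t.1 k)].

Definition polytabloid (al : Tseq l) (t : word al * {ffun 'I_d -> 'I_d}) :
    Qfun (words al) :=
  [ffun w => \sum_(s : 'S_d | [forall k, t.2 (s k) == t.2 k])
     (-1) ^+ s * (w == sact s (t.1 : words al))%:R].

(** [S^(phi al)], for a partition [phi al] *)
Definition specht (al : Tseq l) : smod d :=
  @SMod d (words al) <<[seq polytabloid t | t <- enum (@is_tableau al)]>>%VS.

End Specialisation.

Section SpecialisationFunctors.
Variables (l : nat) (mu : l.-tuple nat) (d : nat).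

(** [F_d] is the case of one variable, specialised to [d]. *)
Definition one_var : 1.-tuple nat := [tuple d].

Definition Fd_sset (X : kobj (Cdel l)) : sset d :=
  @SSet d {a : kidx X & words one_var d (kob X a)}
    (fun s t =>
       Tagged (fun a => words one_var d (kob X a)) (sact s (tagged t))).

Definition Fd_mor (X Y : kobj (Cdel l)) (f : rawhom (kob X) (kob Y))
    (t' : Fd_sset Y) (t : Fd_sset X) : rat :=
  F_hom mu (f (tag t', tag t)) (tagged t') (tagged t).

Definition Fd (X : kobj (Cdel l)) : smod d :=
  @SMod d (Fd_sset X) (limg (linfun (kap (Fd_mor (kidem X))))).

Variables (al be : Tseq l).

(** The words over the letters of [M^gamma] are the pairs of a word over the
    letters of [M^rho] and one over those of [M^be]; this gives the
    identification of [F_mu (X \otimes M^be)] with a subspace of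
    [F_d X \otimes M^(phi be)]. *)
Definition Fmu_tens (X : kobj (Cdel l)) : finType :=
  {t : kidx (act X be) & word mu d (kob (act X be) t)}.

Definition split_words (X : kobj (Cdel l)) (u : Qfun (Fmu_tens X)) :
    Qfun (Fd_sset X * words mu d be)%type :=
  [ffun p : Fd_sset X * words mu d be =>
     \sum_(g : Gams (kob X (tag p.1)) be)
       \sum_(w : word mu d (gob (val g)) |
             [forall k, (cell_row (val w k) == val (tagged p.1) k) &&
                        (cell_col (val w k) == val p.2 k)])
         u (@Tagged _ (Tagged (fun a => Gams (kob X a) be) g)
              (fun t : kidx (act X be) => word mu d (kob (act X be) t)) w)].

Definition Fmu_mid (X : kobj (Cdel l)) (f : midhom al be X)
    (t : Fmu_tens X) (w : words mu d al) : rat :=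
  F_hom mu (kraw f (tag t, tt)) (tagged t) w.

(** [(id \otimes pi) \circ F_mu f \circ iota] *)
Definition spec_comp (iota : slin (specht mu d al) (Mmod mu d al))
    (pi : slin (Mmod mu d be) (specht mu d be))
    (X : kobj (Cdel l)) (f : midhom al be X)
    (u : subvs_of (sspace (specht mu d al))) :
    Qfun (Fd_sset X * words mu d be)%type :=
  idtens pi (split_words (kap (Fmu_mid f) (vsval (iota u)))).

End SpecialisationFunctors.

(* Main.v *)
From HB Require Import structures.
From mathcomp Require Import all_boot all_order fingroup perm all_algebra finmap.
From mathcomp Require Import monalg mpoly.
From mathcomp Require Import boolp classical_sets functions cardinality fsbigop.
From mathcomp Require Import zify ring.
Require Import Defs.

(** All statements about the categories are reduced to statements about words.
    Two words of length [d], over the letters of [M^al] and of [M^be], have a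
    matrix [joint_mx] that counts the pairs of letters, and [xi_q] specialises to
    the kernel that is 1 on the pairs of words with matrix [q]. The product of
    multinomial coefficients in the composition law counts the middle words that
    realise a 3-tensor ([count_functions], [eval_prod_multinom3]); so the
    specialisation is a functor ([F_hom_comp]), and it carries the action of the
    Deligne category to the tensor product of kernels ([F_hom_tens]), a word over
    the letters of [M^gamma] being a pair of words. A polynomial is determined by
    its values at large integers, so the specialisations are jointly faithful
    ([hom_faithful]). Hence associativity ([ccat_assoc]) and the interchange law
    ([rtens_comp]) hold, and [H] is a functor of [X] ([hmap_comp]).

    Finite generation. Off the diagonal block of the formal variables there are
    finitely many possibilities for a matrix [q], and in the block, by Dickson's
    lemma, every [q] dominates one of finitely many [q0]. If [q0] is dominated by
    [q] then, for a suitable endomorphism [xi_p] of [M^al], the product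
    [xi_q0 xi_p] is a positive multiple of [xi_q] plus terms nearer to the
    diagonal ([struct_const_lead], [struct_const_lower]). Since endomorphisms of
    [M^al] become scalars in [H], the finitely many [xi_q0] generate
    ([hom_generators], [Hsp_fg]).

    Specialisation. Let [mu] be such that [phi mu al] is a partition. The column
    antisymmetriser of a tableau [t] has rank one, with image spanned by the
    polytabloid [e_t] ([colsum_polytabloid]), so that an equivariant map from a
    Specht module to its permutation module is a scalar multiple of the inclusion
    ([specht_equivariant_scalar]). In particular the endomorphisms of the
    permutation module act on the Specht module by a character, and its value at
    [xi_q] is a signed sum over the column group of [t]. This sum is a coefficient
    of a product of leading minors, one for each column of the diagram
    ([column_sum_minors]), which is the product of the [Delta_r ^ (phi_r - phi_(r+1))];
    so it is the value of [c_q] at [mu] ([hs_coef_eval]). Therefore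
    [(id \otimes pi) F_mu(f) iota] is compatible with the relations of the tensor
    product, and defines the map on [H] ([hspec_pure]).

    Surjectivity. An equivariant map between permutation modules is constant on
    the orbits of pairs of words, and the orbits are classified by the matrices
    [joint_mx], so it lifts to a morphism ([lift_kernel]). An equivariant map
    from the Specht module extends to the permutation module, because the Specht
    module is a direct summand ([specht_projection]); its lift, composed with the
    idempotent of [X], specialises to a nonzero multiple of it
    ([lift_mid_kernel], [hspec_surj]). *)

Set Implicit Arguments.
Unset Strict Implicit.
Unset Printing Implicit Defensive.

Import Order.TTheory GRing.Theory Num.Theory.
Local Open Scope ring_scope.


(** * Finite sets and functions with prescribed fibres *)

Section FiniteSets.
Local Open Scope classical_set_scope.

Lemma finite_set_inj (T U : choiceType) (A : set T) (B : set U) (f : T -> U) :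
  injective f -> (forall x, A x -> B (f x)) -> finite_set B -> finite_set A.
Proof.
move=> fI fAB fB; case/finite_fsetP: fB => X XE.
apply: (@sub_finite_set _ _ (f @^-1` [set` X])).
  by move=> x /fAB; rewrite XE.
by apply: finite_preimage; [move=> x y _ _; apply: fI | exact: finite_fset].
Qed.

Lemma finite_bounded_ffun (T : finType) (B : nat) :
  finite_set [set f : {ffun T -> int} | forall x, (absz (f x) <= B)%N].
Proof.
pose dec (g : {ffun T -> 'I_(B + B).+1}) : {ffun T -> int} :=
  [ffun x => (g x)%:Z - B%:Z].
apply: (@sub_finite_set _ _ (dec @` setT)); last first.
  by apply: finite_image; exact: finite_finset.
move=> f fB; exists [ffun x => inord (absz (f x + B%:Z))] => //.
apply/ffunP => x; rewrite !ffunE inordK; have := fB x; lia.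
Qed.
End FiniteSets.

Section Fibres.

(** Two words with the same number of occurrences of every letter differ by a
    permutation of the positions. This is used for words in one alphabet, for
    pairs of words, and for tableaux. *)
Lemma perm_of_fibres (T : eqType) d (f g : 'I_d -> T) :
  (forall x, #|[pred k | f k == x]| = #|[pred k | g k == x]|) ->
  exists s : 'S_d, forall k, f k = g (s k).
Proof.
move=> fg; have: perm_eq [tuple f k | k < d] [tuple g k | k < d].
  apply/allP => x _ /=; apply/eqP.
  have E (h : 'I_d -> T) : count_mem x [tuple h k | k < d] = #|[pred k | h k == x]|.
    rewrite /= count_map cardE size_filter -enumT /=.
    by apply: eq_count => k.
  by rewrite !E fg.
case/tuple_permP => s sE; exists s => k.
have : tnth [tuple f k | k < d] k = tnth [tuple tnth [tuple g k | k < d] (s i) | i < d] k.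
  by congr tnth; apply: val_inj.
by rewrite !tnth_mktuple.
Qed.

Lemma exists_fibres (T : finType) d (n : T -> nat) :
  (\sum_x n x)%N = d ->
  exists f : {ffun 'I_d -> T}, forall x, #|[pred k | f k == x]| = n x.
Proof.
move=> nd; pose s := flatten [seq nseq (n x) x | x <- enum T].
have sz : size s == d.
  rewrite size_flatten /shape -map_comp sumnE big_map -nd big_enum /=.
  by apply/eqP/eq_bigr => x _; rewrite size_nseq.
pose t := Tuple sz; exists [ffun k => tnth t k] => x.
rewrite -[RHS](_ : count_mem x t = _); last first.
  rewrite /= count_flatten -map_comp sumnE big_map big_enum /= (bigD1 x) //=.
  rewrite count_nseq /= eqxx mul1n big1 ?addn0 // => y /negbTE yx.
  by rewrite count_nseq /= yx.
rewrite -[in RHS](map_tnth_enum t) count_map cardE size_filter -enumT /=.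
by apply: eq_count => k; rewrite -[LHS]/([ffun k => tnth t k] k == x) ffunE.
Qed.
End Fibres.

Section CountFunctions.
Variables (X J : finType).

(** The arithmetic behind the composition law: the number of ways to refine a
    word [h] by a second word, when the number of positions with a given pair of
    letters is prescribed, is a product of multinomial coefficients. The proof is
    by induction on the length: fixing the letter [j0] at the last position lowers
    one of the prescribed numbers by one, and the multinomial coefficient of [x0]
    changes by the factor [a x0 j0 / \sum_j a x0 j]; these factors add up to 1. *)
Lemma count_functions d (h : 'I_d -> X) (a : X -> J -> nat) :
  (forall x, \sum_j a x j = #|[pred k | h k == x]|)%N ->
  (#|[pred f : {ffun 'I_d -> J} |
      [forall x, forall j, #|[pred k | (h k == x) && (f k == j)]| == a x j]]|)%:R
  = \prod_x ((\sum_j a x j)`!%:R / \prod_j (a x j)`!%:R) :> rat.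
Proof.
elim: d h a => [|d IH] h a Ha.
  have a0 x j : a x j = 0%N.
    have := Ha x; rewrite eq_card0 => [/eqP|]; last by case.
    by rewrite sum_nat_eq0 => /forallP/(_ j)/eqP.
  rewrite big1 => [|x _]; last first.
    by rewrite !big1 ?divr1 // => j _; rewrite a0.
  rewrite (eq_card (B := predT)) ?cardT -?cardE ?card_ffun ?card_ord //.
  move=> f; rewrite !inE; apply/forallP => x; apply/forallP => j.
  by rewrite a0 eq_card0 //; case.
(* [a'] is what remains to be counted once the last position has the pair of
   letters [(x0, j0)]; [ext] appends a letter to a word. *)
pose x0 := h ord_max; pose h' k := h (widen_ord (leqnSn d) k).
pose a' j0 x j := if (x == x0) && (j == j0) then (a x j).-1 else a x j.
pose ext (p : {ffun 'I_d -> J} * J) : {ffun 'I_d.+1 -> J} :=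
  [ffun k => if unlift ord_max k is Some k' then p.1 k' else p.2].
have liftE k : lift ord_max k = widen_ord (leqnSn d) k :> 'I_d.+1.
  by apply: val_inj; rewrite /= /bump leqNgt ltn_ord.
have extM p : ext p ord_max = p.2 by rewrite ffunE unlift_none.
have extW p k : ext p (widen_ord (leqnSn d) k) = p.1 k.
  by rewrite ffunE -liftE liftK.
have ext_bij : bijective ext.
  exists (fun f : {ffun 'I_d.+1 -> J} => ([ffun k => f (widen_ord (leqnSn d) k)], f ord_max)).
    by case=> f j; rewrite extM; congr pair; apply/ffunP => k; rewrite ffunE extW.
  move=> f; apply/ffunP => k; case: (unliftP ord_max k) => [k'|] -> /=.
    by rewrite liftE extW ffunE.
  by rewrite extM.
have cntS (P : pred 'I_d.+1) :
    #|P| = (#|[pred k | P (widen_ord (leqnSn d) k)]| + P ord_max)%N.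
  rewrite -!sum1_card !big_mkcond big_ord_recr /=; rewrite -big_mkcond /=.
  by congr (_ + _)%N; apply: eq_bigl.
(* Split the count according to the letter [j0] at the last position. *)
rewrite -sum1_card (reindex _ (onW_bij _ ext_bij)) /=.
rewrite big_mkcond /= -(pair_bigA _ (fun f j0 => if ext (f, j0) \in _ then 1 else 0)%N).
rewrite exchange_big natr_sum /=.
have H0 x : #|[pred k | h k == x]| = (#|[pred k | h' k == x]| + (x0 == x))%N.
  by rewrite cntS.
have pn0 x : \prod_j (a x j)`!%:R != 0 :> rat.
  by apply/prodf_neq0 => j _; rewrite pnatr_eq0 -lt0n fact_gt0.
have nx0 : (0 < \sum_j a x0 j)%N by rewrite Ha H0 eqxx addn1.
pose P := \prod_x ((\sum_j a x j)`!%:R / \prod_j (a x j)`!%:R) : rat.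
have step j0 : (\sum_(f : {ffun 'I_d -> J}) (if ext (f, j0) \in
      [pred f : {ffun 'I_d.+1 -> J} |
        [forall x, forall j, #|[pred k | (h k == x) && (f k == j)]| == a x j]]
      then 1%N else 0%N))%:R = P * (a x0 j0)%:R / (\sum_j a x0 j)%:R :> rat.
  rewrite -big_mkcond sum1_card.
  have memE f : (ext (f, j0) \in
      [pred f : {ffun 'I_d.+1 -> J} |
        [forall x, forall j, #|[pred k | (h k == x) && (f k == j)]| == a x j]])
     = (0 < a x0 j0)%N && [forall x, forall j, #|[pred k | (h' k == x) && (f k == j)]| == a' j0 x j].
    rewrite inE; apply/forallP/andP => [H|[apos /forallP H] x].
      split.
        have /forallP/(_ j0)/eqP <- := H x0.
        by rewrite cntS /= extM !eqxx addn1.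
      apply/forallP => x; apply/forallP => j; have /forallP/(_ j)/eqP := H x.
      rewrite cntS /= extM /= -/x0 (eq_sym x0) (eq_sym j0) /a' => <-.
      apply/eqP; have -> : #|[pred k | (h (widen_ord (leqnSn d) k) == x) &&
          (ext (f, j0) (widen_ord (leqnSn d) k) == j)]| =
          #|[pred k | (h' k == x) && (f k == j)]|.
        by apply: eq_card => k; rewrite -!topredE /= extW.
      by case: (_ && _); rewrite /= ?addn1 ?addn0.
    apply/forallP => j; have /forallP/(_ j)/eqP := H x.
    rewrite cntS /= extM /= -/x0 (eq_sym x0) (eq_sym j0) /a' => E.
    have -> : #|[pred k | (h (widen_ord (leqnSn d) k) == x) &&
          (ext (f, j0) (widen_ord (leqnSn d) k) == j)]| =
          #|[pred k | (h' k == x) && (f k == j)]|.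
      by apply: eq_card => k; rewrite -!topredE /= extW.
    rewrite E; case: ifP => [/andP[/eqP-> /eqP->]|_]; last by rewrite addn0.
    by rewrite addn1 prednK.
  have [apos|] := posnP (a x0 j0).
    rewrite apos mulr0 mul0r (eq_card (B := pred0)) ?card0 // => f.
    by rewrite [LHS]memE apos.
  move=> apos.
  rewrite (eq_card (B := [pred f : {ffun 'I_d -> J} | [forall x, forall j,
     #|[pred k | (h' k == x) && (f k == j)]| == a' j0 x j]])); last first.
    by move=> f; rewrite [LHS]memE apos.
  have sa' x : (\sum_j a' j0 x j)%N = (if x == x0 then (\sum_j a x j).-1 else \sum_j a x j)%N.
    case: eqVneq => [->|/negbTE xx]; last by apply: eq_bigr => j _; rewrite /a' xx.
    rewrite (bigD1 j0) //= [in RHS](bigD1 j0) //= /a' !eqxx /= -!subn1.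
    rewrite (eq_bigr (fun i => a x0 i)) => [|i /negbTE ->]; last by [].
    by rewrite addnBAC.
  rewrite IH => [|x]; last first.
    by rewrite sa' Ha H0; case: eqVneq => _; rewrite /= ?addn1 ?addn0.
  rewrite /P (bigD1 x0) //= [in RHS](bigD1 x0) //=.
  rewrite (eq_bigr (fun x => (\sum_j a x j)`!%:R / \prod_j (a x j)`!%:R)); last first.
    move=> x xx; rewrite sa' (negbTE xx); congr (_ / _).
    by apply: eq_bigr => j _; rewrite /a' (negbTE xx).
  rewrite [_ * (a x0 j0)%:R]mulrAC -[RHS]mulrA [X in _ = _ * X]mulrC mulrA.
  congr (_ * _); rewrite sa' eqxx.
  rewrite [\prod_j (a' j0 x0 j)`!%:R](bigD1 j0) //=.
  rewrite [\prod_j (a x0 j)`!%:R](bigD1 j0) //=.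
   have -> : \prod_(j | j != j0) (a' j0 x0 j)`!%:R =
            \prod_(j | j != j0) (a x0 j)`!%:R :> rat.
    by apply: eq_bigr => j /negbTE jj; rewrite /a' jj andbF.
  rewrite {1}/a' !eqxx /=.
  case: (\sum_j a x0 j)%N nx0 => // n _; case: (a x0 j0) apos => // m _ /=.
  rewrite !factS !natrM.
  have := pn0 x0; rewrite (bigD1 j0) //= mulf_eq0 negb_or => /andP[_ q0].
  have fm : (m`!%:R : rat) != 0 by rewrite pnatr_eq0 -lt0n fact_gt0.
  have n1 : (n.+1%:R : rat) != 0 by rewrite pnatr_eq0.
  have m1 : (m.+1%:R : rat) != 0 by rewrite pnatr_eq0.
  move: (n.+1%:R : rat) n1 (m.+1%:R : rat) m1 (m`!%:R : rat) fm (n`!%:R : rat).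
  move: (\prod_(j | _) _ : rat) q0 => q q0 n1 n10 m1 m10 fm fm0 fn.
  by field; rewrite q0 n10 m10 fm0.
rewrite (eq_bigr _ (fun j0 _ => step j0)) -mulr_suml -mulr_sumr -natr_sum.
by rewrite mulfK // pnatr_eq0 -lt0n.
Qed.
End CountFunctions.

(** * Polynomials are determined by their values at large integers *)

Section PolynomialIdentity.

Lemma base_digits_inj D n (f g : 'I_n -> nat) :
  (forall i, f i < D)%N -> (forall i, g i < D)%N ->
  (\sum_i f i * D ^ i = \sum_i g i * D ^ i)%N -> f =1 g.
Proof.
elim: n f g => [|n IH] f g fD gD; first by move=> _ [].
rewrite !big_ord_recl !expn0 !muln1.
have S (h : 'I_n.+1 -> nat) : (\sum_(i < n) h (lift ord0 i) * D ^ lift ord0 i =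
    (\sum_(i < n) h (lift ord0 i) * D ^ i) * D)%N.
  by rewrite big_distrl; apply: eq_bigr => i _ /=; rewrite expnSr mulnA.
rewrite !S => E.
have E0 : f ord0 = g ord0.
  by have := congr1 (modn^~ D) E; rewrite ![(_ + _ * D)%N]addnC !modnMDl !modn_small.
move: E; rewrite E0 => /addnI/eqP.
rewrite eqn_pmul2r ?(leq_ltn_trans _ (fD ord0)) // => /eqP/IH H i.
by case: (unliftP ord0 i) => [j|] -> //; apply: H.
Qed.

Lemma poly_nat_eq0 (q : {poly rat}) B :
  (forall t : nat, (B <= t)%N -> q.[t%:R] = 0) -> q = 0.
Proof.
move=> qB; apply/eqP; apply: contraT => q0; rewrite -(ltnn (size q)).
have := max_poly_roots (rs := [seq (t%:R : rat) | t <- iota B (size q)]) q0.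
rewrite size_map size_iota => M; apply: M.
  apply/allP => _ /mapP[t tB ->].
  by move: tB; rewrite mem_iota /root => /andP[/qB->].
by rewrite map_inj_uniq ?iota_uniq // => a b /eqP; rewrite eqr_nat => /eqP.
Qed.

(** The substitution [X_i -> t ^ (D ^ i)] reduces this to polynomials in one
    variable: when [D] exceeds all exponents, distinct monomials become distinct
    powers of [t], by uniqueness of expansions in base [D]. *)
Lemma mpoly_nat_eq0 n (p : {mpoly rat[n]}) (B : nat) :
  (forall mu : n.-tuple nat, (forall i, (B <= tnth mu i)%N) -> eval_mu mu p = 0) ->
  p = 0.
Proof.
move=> H; pose D := (msize p).+1.
pose e (m : 'X_{1..n}) := (\sum_i m i * D ^ i)%N.
have lt_D m : m \in msupp p -> forall i, (m i < D)%N.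
  move=> mp i; rewrite ltnS; apply: leq_trans (ltnW (msize_mdeg_lt mp)).
  by rewrite mdegE (bigD1 i) //= leq_addr.
pose q : {poly rat} := \sum_(m <- msupp p) p@_m *: 'X^(e m).
have q0 : q = 0.
  apply: (@poly_nat_eq0 _ B.+1) => t Bt.
  rewrite horner_sum -[RHS](H [tuple (t ^ (D ^ i))%N | i < n]).
    rewrite /eval_mu mevalE; apply: eq_bigr => m _.
    rewrite hornerZ hornerXn; congr (_ * _).
    rewrite -prodrXr; apply: eq_bigr => i _.
    by rewrite tnth_mktuple natrX -exprM mulnC.
  move=> i; rewrite tnth_mktuple; apply: leq_trans (ltnW Bt) _.
  by apply: leq_pexp2l (leq_ltn_trans _ Bt) (expn_gt0 D i).
apply/mpolyP => m; rewrite mcoeff0.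
case: (boolP (m \in msupp p)) => [mp|]; last by rewrite -mcoeff_eq0 => /eqP.
have := congr1 (fun r : {poly rat} => r`_(e m)) q0.
rewrite coef_sum coef0 (bigD1_seq m) ?msupp_uniq //= coefZ coefXn eqxx mulr1.
rewrite big_seq_cond big1 ?addr0 // => m' /andP[m'p mm'].
rewrite coefZ coefXn; case: eqVneq => [E|]; last by rewrite mulr0.
case/eqP: mm'; apply/mnmP => i; apply: (base_digits_inj _ _ (esym E)) => j;
  exact: lt_D.
Qed.
End PolynomialIdentity.

(** * Structure constants of the composition *)

Section Sums.

Lemma sum_Posz (I : Type) (s : seq I) (P : pred I) (f : I -> nat) :
  \sum_(i <- s | P i) (f i)%:Z = (\sum_(i <- s | P i) f i)%N%:Z.
Proof. by rewrite (big_morph Posz PoszD (erefl 0%:Z)). Qed.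

Lemma card_fibre_sum (I J : finType) (f : I -> J) (P : pred I) :
  (\sum_j #|[pred k | (f k == j) && P k]|)%N = #|[pred k | P k]|.
Proof.
rewrite -[RHS]sum1_card (partition_big f predT) //=; apply: eq_bigr => j _.
by rewrite -sum1_card; apply: eq_bigl => k; rewrite unfold_in /= andbC.
Qed.

Lemma absz_le_sum (I : finType) (f : I -> int) (P : pred I) x :
  (forall y, P y -> 0 <= f y) -> P x -> (absz (f x) <= absz (\sum_(y | P y) f y)%R)%N.
Proof.
move=> f0 Px; rewrite (bigD1 x) //=.
have : 0 <= f x by apply: f0.
have : 0 <= \sum_(i | P i && (i != x)) f i.
  by apply: sumr_ge0 => y /andP[Py _]; apply: f0.
by move: (\sum_(_ | _) _) => z; lia.
Qed.

Lemma absz_sum_le (I : finType) (f : I -> int) (P : pred I) :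
  (absz (\sum_(y | P y) f y)%R <= \sum_(y | P y) absz (f y))%N.
Proof.
elim/big_rec2: _ => // y a b _; lia.
Qed.

Lemma prod_fact_dvd (I : Type) (s : seq I) (P : pred I) (a : I -> nat) :
  (\prod_(j <- s | P j) (a j)`! %| (\sum_(j <- s | P j) a j)`!)%N.
Proof.
elim/big_rec2: _ => // j y x _ IH.
by rewrite -(bin_fact (leq_addr y (a j))) addKn dvdn_mull // dvdn_mul.
Qed.

Lemma ffact_ratE (x m : nat) : \prod_(s < m) (x%:R - s%:R) = (x ^_ m)%:R :> rat.
Proof.
case: (leqP m x) => [mx|xm]; last first.
  rewrite ffact_small // (bigD1 (Ordinal xm)) //= subrr mul0r //.
rewrite ffact_prod natr_prod; apply: eq_bigr => s _.
by rewrite natrB // ltnW // (leq_trans (ltn_ord s) mx).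
Qed.

Lemma sum_delta N (i c : nat) : ((N <= i)%N -> c = 0%N) ->
  \sum_(j < N) c%:Z *+ (i == j :> nat) = c%:Z.
Proof.
move=> cN; have [iN|/cN->] := ltnP i N; last by rewrite big1 // => j _; rewrite mul0rn.
rewrite (bigD1 (Ordinal iN)) //= eqxx big1 ?addr0 // => j ji.
by rewrite [i == _]eq_sym -(inj_eq val_inj) /= in ji *; rewrite (negbTE ji).
Qed.
End Sums.

Section TmatBasics.
Variables (l : nat) (al be : Tseq l).
Implicit Type q : Tmat al be.

Lemma tmat_ge0 q (i : 'I_(tsz be)) (j : 'I_(tsz al)) :
  ~~ ((i == j :> nat) && (i < l)%N) -> 0 <= val q i j.
Proof.
by case/and3P: (valP q) => /forallP/(_ i)/forallP/(_ j)/orP[->|].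
Qed.

Lemma tmat_row q i : \sum_j val q i j = be`_i.
Proof. by case/and3P: (valP q) => _ /forallP/(_ i)/eqP. Qed.

Lemma tmat_col q j : \sum_i val q i j = al`_j.
Proof. by case/and3P: (valP q) => _ _ /forallP/(_ j)/eqP. Qed.

(** Elements of [Tmat al be] may have arbitrarily negative entries on the
    diagonal, so there are infinitely many; this is the criterion by which the
    sums over them turn out to be finite. *)
Lemma finite_tmat (P : Tmat al be -> Prop) (B : nat) :
  (forall q, P q -> forall i j, (absz (val q i j) <= B)%N) ->
  finite_set [set q | P q]%classic.
Proof.
move=> PB; pose f q : {ffun 'I_(tsz be) * 'I_(tsz al) -> int} :=
  [ffun p => val q p.1 p.2].
apply: (@finite_set_inj _ _ _ _ f _ _ (finite_bounded_ffun _ B)).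
  move=> q q' /ffunP E; apply: val_inj; apply/matrixP => i j.
  by have := E (i, j); rewrite !ffunE.
by move=> q /PB qB [i j]; rewrite ffunE.
Qed.
End TmatBasics.

Section StructureConstants.
Variables (l : nat) (al be ga : Tseq l).
Implicit Types (r : Tmat be ga) (s : Tmat al be) (q : Tmat al ga).

(** The entries of a 3-tensor with two prescribed margins are bounded: only
    [a_iii] with [i < l] may be negative, and it is determined by the others. *)
Lemma tens3_bounded r s : exists B : nat,
  forall q A, is_tens3 r s q A -> forall x, (absz (A x) <= B)%N.
Proof.
exists (\sum_i \sum_j absz (val r i j) + \sum_j \sum_k absz (val s j k))%N.
move=> q A /and4P[/forallP A0 /forallP Ar _ /forallP As] [[i j] k].
have {}A0 (a : 'I_(tsz ga)) (b : 'I_(tsz be)) (c : 'I_(tsz al)) : ~~ [&& a == b :> nat, b == c :> nat & (a < l)%N] -> 0 <= A (a, b, c).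
  by move=> /negbTE abc; have /forallP/(_ b)/forallP/(_ c) := A0 a; rewrite abc.
have {}Ar a b : \sum_c A (a, b, c) = val r a b by have /forallP/(_ b)/eqP := Ar a.
have {}As b c : \sum_a A (a, b, c) = val s b c by have /forallP/(_ c)/eqP := As b.
have rB a b : (absz (val r a b) <= \sum_i \sum_j absz (val r i j))%N.
  by rewrite (bigD1 a) //= (bigD1 b) //= -addnA leq_addr.
have sB b c : (absz (val s b c) <= \sum_j \sum_k absz (val s j k))%N.
  by rewrite (bigD1 b) //= (bigD1 c) //= -addnA leq_addr.
have [/andP[/eqP ij il]|nij] := boolP ((i == j :> nat) && (i < l)%N); last first.
  apply: leq_trans (leq_addr _ _); apply: leq_trans (rB i j).
  rewrite -Ar; apply: (@absz_le_sum _ (fun c => A (i, j, c))) => // c _.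
  apply: A0; apply: contra nij; by case/and3P=> -> _ ->.
have sk (c : 'I_(tsz al)) : (c != j :> nat) -> (absz (A (i, j, c)) <= absz (val s j c))%N.
  move=> cj; rewrite -As; apply: (@absz_le_sum _ (fun a => A (a, j, c))) => // a _.
  by apply: A0; apply: contra cj => /and3P[_ /eqP-> _].
have [kj|kj] := eqVneq (k : nat) j; last first.
  by apply: leq_trans (leq_addl _ _); apply: leq_trans (sk _ kj) (sB _ _).
have -> : A (i, j, k) = val r i j - \sum_(c | c != k) A (i, j, c).
  by rewrite -Ar (bigD1 k) //= addrK.
apply: (@leq_trans (absz (val r i j) + \sum_(c | c != k) absz (A (i, j, c)))%N).
  by have := @absz_sum_le _ (fun c => A (i, j, c)) (fun c => c != k); lia.
apply: leq_add; first exact: rB.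
apply: (@leq_trans (\sum_c absz (val s j c))%N); last first.
  by rewrite [leqRHS](bigD1 j) //= leq_addr.
rewrite [leqRHS](bigD1 k) //= -[leqLHS]add0n leq_add // leq_sum // => c ck.
by apply: sk; rewrite -kj.
Qed.

Lemma finite_tens3 r s q : finite_set [set A | is_tens3 r s q A]%classic.
Proof.
have [B AB] := tens3_bounded r s.
apply: (sub_finite_set _ (finite_bounded_ffun _ B)) => A /AB; exact.
Qed.

Variables (n : nat) (v : l.-tuple {mpoly rat[n]}).

(** The coefficient of [xi_q] in [xi_r xi_s], as a sum over a finite set. *)
Definition struct_const r s q : {mpoly rat[n]} :=
  \sum_(A <- fset_set [set A | is_tens3 r s q A]%classic)
    \prod_i \prod_k multinom3 v A i k.

Lemma finite_struct_const_support r s :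
  finite_set [set q | exists A, is_tens3 r s q A]%classic.
Proof.
have [B AB] := tens3_bounded r s.
apply: (@finite_tmat _ _ _ _ (tsz be * B)) => q [A qA] i k.
have := AB _ _ qA; case/and4P: qA => _ _ /forallP/(_ i)/forallP/(_ k)/eqP <- _ {}AB.
apply: leq_trans (absz_sum_le _ _) _.
rewrite -[X in (_ <= X * _)%N]card_ord -sum_nat_const; apply: leq_sum => j _.
exact: AB.
Qed.

Lemma mcoeff_xi_mul r s q : monalg.mcoeff q (xi_mul v r s) = struct_const r s q.
Proof.
have struct_constE q' : \sum_(A \in [set A | is_tens3 r s q' A]%classic)
    \prod_i \prod_k multinom3 v A i k = struct_const r s q'.
  by rewrite fsbig_finite //; exact: finite_tens3.
have [X XE] := finite_fsetP.1 (finite_struct_const_support r s).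
rewrite /xi_mul (fsbigTE X) => [|q' q'X]; last first.
  rewrite fsbig1 ?scale0r // => A qA; case/negP: q'X.
  by have : [set` X]%classic q' by rewrite -XE; exists A.
rewrite raddf_sum /=.
under eq_bigr do rewrite struct_constE monalg.mcoeffZ monalg.mcoeffU.
have [qX|qX] := boolP (q \in X).
  rewrite (bigD1_seq q) ?fset_uniq //= eqxx mulr1 big1 ?addr0 // => q' /negbTE ->.
  by rewrite mulr0.
rewrite big_seq_cond big1 => [|q' /andP[q'X _]]; last first.
  by case: eqVneq q'X qX => [->->//|]; rewrite mulr0.
rewrite /struct_const big_seq_cond big1 // => A; rewrite andbT in_fset_set; last exact: finite_tens3.
rewrite inE /= => qA; case/negP: qX.
by have : [set` X]%classic q by rewrite -XE; exists A.
Qed.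
End StructureConstants.

(** * Specialisation of single morphisms *)

Section EvalMorphism.
Variables (n : nat) (mu : n.-tuple nat).
Local Notation ev := (eval_mu mu).

Fact eval_mu_zmod : zmod_morphism ev.
Proof. by move=> p q; rewrite /eval_mu mevalB. Qed.
Fact eval_mu_monoid : monoid_morphism ev.
Proof. by split=> [|p q]; rewrite /eval_mu ?meval1 ?mevalM. Qed.
HB.instance Definition _ := GRing.isZmodMorphism.Build _ _ ev eval_mu_zmod.
HB.instance Definition _ := GRing.isMonoidMorphism.Build _ _ ev eval_mu_monoid.

Lemma eval_muZ c p : ev (c *: p) = c * ev p.
Proof. by rewrite /eval_mu mevalZ. Qed.

Lemma eval_fallp x m : ev (fallp x m) = \prod_(s < m) (ev x - s%:R).
Proof.
by rewrite /fallp rmorph_prod; apply: eq_bigr => s _; rewrite rmorphB rmorph_nat.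
Qed.

Lemma eval_fallp_nat x m (t : nat) :
  ev x = t%:R -> ev (fallp x m) = (t ^_ m)%:R.
Proof. by move=> xt; rewrite eval_fallp -ffact_ratE xt. Qed.
End EvalMorphism.

Section Words.
Variables (l : nat) (m : l.-tuple nat) (d : nat).
Local Notation shift i := (nth 0%N m i).

Lemma shift_ge i : (l <= i)%N -> shift i = 0%N.
Proof. by move=> li; rewrite nth_default // size_tuple. Qed.

Lemma word_card (al : Tseq l) (w : word m d al) (j : 'I_(tsz al)) :
  #|[pred k | val w k == j]|%:Z = phi m al j.
Proof. by have /forallP/(_ j)/eqP := valP w. Qed.

Section JointMatrix.
Variables al be : Tseq l.

Definition joint_matrix (w' : {ffun 'I_d -> 'I_(tsz be)}) (w : {ffun 'I_d -> 'I_(tsz al)}) :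
    'M[int]_(tsz be, tsz al) :=
  \matrix_(i, j) (#|[pred k | (w k == j) && (w' k == i)]|%:Z
                  - (shift i)%:Z *+ (i == j :> nat)).

Fact joint_matrixP (w' : word m d be) (w : word m d al) : is_Tmat (joint_matrix (val w') (val w)).
Proof.
apply/and3P; split.
- apply/forallP => i; apply/forallP => j; rewrite !mxE.
  case: eqP => [ij|_] /=; last by rewrite subr0.
  by case: ltnP => //= li; rewrite shift_ge // subr0.
- apply/forallP => i; apply/eqP; under eq_bigr do rewrite mxE.
  rewrite sumrB sum_delta => [|le]; last by rewrite shift_ge // (leq_trans (tsz_ge al)).
  rewrite sum_Posz (card_fibre_sum (val w) (fun k => val w' k == i)).
  rewrite (word_card w' i).
  by rewrite /phi addrC addKr.
- apply/forallP => j; apply/eqP; under eq_bigr do rewrite mxE.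
  have D (i : 'I_(tsz be)) : (shift i)%:Z *+ (i == j :> nat) = (shift j)%:Z *+ (j == i :> nat).
    by rewrite [in RHS]eq_sym; case: eqP => [->|].
  rewrite sumrB (eq_bigr _ (fun i _ => D i)) sum_delta; last first.
    by move=> le; rewrite shift_ge // (leq_trans (tsz_ge be)).
  rewrite (eq_bigr (fun i => #|[pred k | (val w' k == i) && (val w k == j)]|%:Z)); last first.
    by move=> i _; congr Posz; apply: eq_card => k; rewrite !unfold_in /= andbC.
  rewrite sum_Posz (card_fibre_sum (val w') (fun k => val w k == j)) (word_card w j).
  by rewrite /phi addrC addKr.
Qed.

(** The matrix whose specialisation counts the positions where [w] and [w']
    carry given letters: the only [q] such that [xi_q] relates [w] to [w']. All
    computations with specialised morphisms go through it. *)
Definition joint_mx (w' : word m d be) (w : word m d al) : Tmat al be :=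
  exist (fun q => is_Tmat q) _ (joint_matrixP w' w).

Lemma joint_mxE w' w i j : val (joint_mx w' w) i j =
  #|[pred k | (val w k == j) && (val w' k == i)]|%:Z - (shift i)%:Z *+ (i == j :> nat).
Proof. by rewrite mxE. Qed.

Lemma F_xiE q w' w : F_xi q w' w = (q == joint_mx w' w)%:R.
Proof.
congr (_%:R); congr nat_of_bool; apply/forallP/eqP => [H|-> i].
  apply: val_inj; apply/matrixP => i j; rewrite joint_mxE.
  by have /forallP/(_ j)/eqP -> := H i; rewrite mxE addrK.
by apply/forallP => j; rewrite mxE joint_mxE subrK.
Qed.

Variables (n : nat) (mu : n.-tuple nat).

Lemma F_homE (h : hom n al be) w' w :
  F_hom mu h w' w = eval_mu mu (monalg.mcoeff (joint_mx w' w) h).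
Proof.
rewrite /F_hom; have [qh|qh] := boolP (joint_mx w' w \in monalg.msupp h).
  rewrite (bigD1_seq (joint_mx w' w)) ?fset_uniq //= F_xiE eqxx mulr1.
  by rewrite big1 ?addr0 // => q /negbTE qw; rewrite F_xiE qw mulr0.
rewrite monalg.mcoeff_outdom // raddf0 big_seq_cond big1 // => q /andP[qs _].
by rewrite F_xiE; case: eqP qs qh => [->->|] //; rewrite mulr0.
Qed.

End JointMatrix.
End Words.

(** * The specialisation is a functor *)

Section MultinomialEvaluation.
Variables (l : nat) (m : l.-tuple nat) (d : nat) (n : nat) (mu : n.-tuple nat).
Variable v : l.-tuple {mpoly rat[n]}.
Hypothesis vm : forall i, (i < l)%N -> eval_mu mu v`_i = (nth 0%N m i)%:R.
Local Notation shift i := (nth 0%N m i).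
Local Notation ev := (eval_mu mu).

Variables al be ga : Tseq l.

(** The specialised entries: a stored entry is the difference from [lambda_i]
    when all three indices are equal to [i]. *)
Definition tens_spec (A : tens3 al be ga) (i : 'I_(tsz ga)) (j : 'I_(tsz be))
    (k : 'I_(tsz al)) : int :=
  A (i, j, k) + (shift i)%:Z *+ ((i == j :> nat) && (j == k :> nat)).

(** The factor of [(i, k)] specialises to a multinomial coefficient of the
    specialised entries [a_ijk]; when [a_iii] specialises to a negative
    integer, the falling factorial passes through zero. *)
Lemma eval_multinom3 (A : tens3 al be ga) (i : 'I_(tsz ga)) (k : 'I_(tsz al)) :
  (forall j : 'I_(tsz be),
     ~~ [&& i == j :> nat, j == k :> nat & (i < l)%N] -> 0 <= A (i, j, k)) ->
  0 <= \sum_j tens_spec A i j k ->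
  ev (multinom3 v A i k) =
    if [forall j, 0 <= tens_spec A i j k] then
      (\sum_j absz (tens_spec A i j k))`!%:R / \prod_j (absz (tens_spec A i j k))`!%:R
    else 0.
Proof.
move=> A0 Q0; rewrite /multinom3; case: ifPn => [/andP[/eqP ik il]|nik]; last first.
  have tA j : tens_spec A i j k = A (i, j, k).
    rewrite /tens_spec; case: andP => [[/eqP ij /eqP jk]|_]; last by rewrite addr0.
    have/negP il : ~~ (i < l)%N by move: nik; rewrite ij jk eqxx.
    by rewrite shift_ge ?addr0 // leqNgt; apply/negP.
  have A0' j : 0 <= A (i, j, k).
    by apply: A0; apply: contra nik => /and3P[/eqP-> /eqP-> ->]; rewrite eqxx.
  case: forallP => [_|[]]; last by move=> j; rewrite tA.
  rewrite rmorph_nat natf_div; last exact: prod_fact_dvd.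
  rewrite natr_prod; congr (_`!%:R / _); first by apply: eq_bigr => j _; rewrite tA.
  by apply: eq_bigr => j _; rewrite tA.
have ib : (i < tsz be)%N by apply: leq_trans il (tsz_ge be).
pose j0 : 'I_(tsz be) := Ordinal ib.
have jE (j : 'I_(tsz be)) : (j != i :> nat) = (j != j0) by rewrite -(inj_eq val_inj).
have tA j : j != j0 -> tens_spec A i j k = A (i, j, k).
  by rewrite -jE /tens_spec eq_sym => /negbTE ->; rewrite addr0.
have t0 : tens_spec A i j0 k = A (i, j0, k) + (shift i)%:Z by rewrite /tens_spec /= ik !eqxx.
have A0' j : j != j0 -> 0 <= A (i, j, k).
  by rewrite -jE => ji; apply: A0; rewrite eq_sym (negbTE ji).
set p := (\prod_(j < tsz be | j != i :> nat) _)%N.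
set s := (\sum_(j < tsz be | j != i :> nat) _)%N.
have sE : s%:Z = \sum_(j | j != j0) A (i, j, k).
  rewrite /s -sum_Posz (eq_bigl _ _ jE); apply: eq_bigr => j jj; rewrite gez0_abs //; exact: A0'.
have QE : \sum_j tens_spec A i j k = tens_spec A i j0 k + s%:Z.
  rewrite sE (bigD1 j0) //=; congr (_ + _).
  by apply: eq_bigr => j jj; rewrite tA.
pose Q := absz (\sum_j tens_spec A i j k).
(* [x] specialises to the column sum [Q], so the falling factorial becomes
   [Q (Q - 1) ... (Q - s + 1)]: it is [Q! / (Q - s)!], or zero if [Q < s]. *)
have xE : ev (v`_i + (\sum_j A (i, j, k))%:~R) = Q%:R.
  rewrite raddfD /= vm // rmorph_int [(shift i)%:R]pmulrn [Q%:R]pmulrn gez0_abs // -intrD.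
  congr (_%:~R); rewrite QE t0 sE (bigD1 j0) //= addrA [RHS]addrAC [in RHS]addrC.
  by rewrite addrA.
rewrite eval_muZ (eval_fallp_nat _ xE).
have pE : \prod_j (absz (tens_spec A i j k))`!%:R =
    (absz (tens_spec A i j0 k))`!%:R * p%:R :> rat.
  rewrite (bigD1 j0) //= /p natr_prod (eq_bigl _ _ jE); congr (_ * _).
  by apply: eq_bigr => j jj; rewrite tA.
have Qs : (Q%:Z = tens_spec A i j0 k + s%:Z) by rewrite gez0_abs // QE.
case: forallP => [t_ge0|tn].
  have sQ : (s <= Q)%N by have := t_ge0 j0; lia.
  have -> : (\sum_j absz (tens_spec A i j k) = Q)%N.
    apply/eqP; rewrite -eqz_nat -sum_Posz Qs -QE; apply/eqP/eq_bigr => j _.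
    by rewrite gez0_abs.
  rewrite pE -(ffact_fact sQ).
  have -> : (Q - s)%N = absz (tens_spec A i j0 k) by have := t_ge0 j0; lia.
  by rewrite natrM invfM mulrA mulfK ?pnatr_eq0 -?lt0n ?fact_gt0 // mulrC.
rewrite ffact_small ?mulr0 //.
have: ~~ (0 <= tens_spec A i j0 k).
  apply/negP => t0_ge0; apply: tn => j; have [->//|jj] := eqVneq j j0.
  by rewrite tA // A0'.
lia.
Qed.
End MultinomialEvaluation.

Lemma sum_val_bool (T : finType) (P Q : pred T) : (forall x, Q x -> P x) ->
  \sum_(x : {x | P x}) (Q (val x))%:R = #|[pred x | Q x]|%:R :> rat.
Proof.
move=> QP; rewrite -natr_sum; congr (_%:R).
transitivity #|[pred x : {x | P x} | Q (val x)]|.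
  by rewrite -sum1_card [RHS]big_mkcond /=; apply: eq_bigr => x _.
rewrite -(card_imset _ val_inj) /=; apply: eq_card => x; apply/imsetP/idP => [[y yQ ->]|Qx].
  by move: yQ; rewrite !unfold_in.
by exists (exist _ x (QP _ Qx)).
Qed.

Section Functoriality.
Variables (l : nat) (m : l.-tuple nat) (d : nat) (n : nat) (mu : n.-tuple nat).
Variable v : l.-tuple {mpoly rat[n]}.
Hypothesis vm : forall i, (i < l)%N -> eval_mu mu v`_i = (nth 0%N m i)%:R.
Local Notation shift i := (nth 0%N m i).
Local Notation ev := (eval_mu mu).

Section Triple.
Variables al be ga : Tseq l.
Variables (w'' : {ffun 'I_d -> 'I_(tsz ga)}) (w' : {ffun 'I_d -> 'I_(tsz be)})
  (w : {ffun 'I_d -> 'I_(tsz al)}).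

(** Three words determine a 3-tensor, which counts the positions where they
    carry given letters. Its margins are the matrices of the pairs of words, so
    that summing over the middle word is summing over tensors. *)
Definition joint_tens3 : tens3 al be ga :=
  [ffun x => #|[pred p | [&& w p == x.2, w' p == x.1.2 & w'' p == x.1.1]]|%:Z
             - (shift x.1.1)%:Z *+ ((x.1.1 == x.1.2 :> nat) && (x.1.2 == x.2 :> nat))].

Lemma joint_tens3_shift i j k :
  tens_spec m joint_tens3 i j k = #|[pred p | [&& w p == k, w' p == j & w'' p == i]]|%:Z.
Proof. by rewrite /tens_spec ffunE subrK. Qed.

Lemma sum_joint_tens3_3 i j : \sum_k joint_tens3 (i, j, k) = joint_matrix m w'' w' i j.
Proof.
rewrite mxE; under eq_bigr do rewrite ffunE /=.
rewrite sumrB sum_Posz (card_fibre_sum w (fun p => (w' p == j) && (w'' p == i))).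
congr (_ - _); case: eqP => [ij|_] /=; last by rewrite big1.
rewrite ij sum_delta // => jal; rewrite shift_ge //; exact: leq_trans (tsz_ge al) jal.
Qed.

Lemma sum_joint_tens3_2 i k : \sum_j joint_tens3 (i, j, k) = joint_matrix m w'' w i k.
Proof.
rewrite mxE; under eq_bigr do rewrite ffunE /=.
rewrite sumrB sum_Posz.
rewrite (eq_bigr (fun j => #|[pred p | (w' p == j) && ((w p == k) && (w'' p == i))]|)); last first.
  by move=> j _; apply: eq_card => p; rewrite !unfold_in /= andbCA.
rewrite (card_fibre_sum w' (fun p => (w p == k) && (w'' p == i))).
congr (_ - _); rewrite (eq_bigr (fun j : 'I_(tsz be) =>
    (if i == k :> nat then shift i else 0)%N%:Z *+ (i == j :> nat))); last first.
  move=> j _; case: (eqVneq (i : nat) j) => [->|_]; last by rewrite !mulr0n.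
  by case: eqP.
rewrite sum_delta; first by case: eqP.
by move=> ibe; rewrite shift_ge ?if_same //; apply: leq_trans (tsz_ge be) ibe.
Qed.

Lemma sum_joint_tens3_1 j k : \sum_i joint_tens3 (i, j, k) = joint_matrix m w' w j k.
Proof.
rewrite mxE; under eq_bigr do rewrite ffunE /=.
rewrite sumrB sum_Posz.
rewrite (eq_bigr (fun i => #|[pred p | (w'' p == i) && ((w p == k) && (w' p == j))]|)); last first.
  by move=> i _; apply: eq_card => p; rewrite !unfold_in /= [RHS]andbC andbA.
rewrite (card_fibre_sum w'' (fun p => (w p == k) && (w' p == j))).
congr (_ - _); rewrite (eq_bigr (fun i : 'I_(tsz ga) =>
    (if j == k :> nat then shift j else 0)%N%:Z *+ (j == i :> nat))); last first.
  move=> i _; rewrite [(i : nat) == j]eq_sym; case: (eqVneq (j : nat) i) => [->|_]; last by rewrite !mulr0n.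
  by case: eqP.
rewrite sum_delta; first by case: eqP.
by move=> jga; rewrite shift_ge ?if_same //; apply: leq_trans (tsz_ge ga) jga.
Qed.

Lemma sum_joint_matrix1 j : \sum_i joint_matrix m w'' w' i j = #|[pred p | w' p == j]|%:Z - (shift j)%:Z.
Proof.
under eq_bigr do rewrite mxE.
rewrite sumrB sum_Posz.
rewrite (eq_bigr (fun i => #|[pred p | (w'' p == i) && (w' p == j)]|)); last first.
  by move=> i _; apply: eq_card => p; rewrite !unfold_in /= andbC.
rewrite (card_fibre_sum w'' (fun p => w' p == j)); congr (_ - _).
rewrite (eq_bigr (fun i : 'I_(tsz ga) => (shift j)%:Z *+ (j == i :> nat))); last first.
  by move=> i _; rewrite [(i : nat) == j]eq_sym; case: eqP => [->|].
rewrite sum_delta // => jga; rewrite shift_ge //; exact: leq_trans (tsz_ge ga) jga.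
Qed.

Lemma joint_tens3_ge0 (i : 'I_(tsz ga)) (j : 'I_(tsz be)) (k : 'I_(tsz al)) :
  [&& i == j :> nat, j == k :> nat & (i < l)%N] || (0 <= joint_tens3 (i, j, k)).
Proof.
rewrite ffunE /=; have [ij|] := eqVneq (i : nat) j; last by rewrite subr0.
have [jk|] := eqVneq (j : nat) k; last by rewrite subr0.
by case: ltnP => //= li; rewrite shift_ge // subr0.
Qed.
End Triple.

Section Composition.
Variables al be ga : Tseq l.
Variables (w'' : word m d ga) (w : word m d al).
Implicit Types (r : Tmat be ga) (s : Tmat al be).

Lemma is_tens3_joint r s (w' : word m d be) :
  is_tens3 r s (joint_mx w'' w) (joint_tens3 (val w'') (val w') (val w)) =
  (r == joint_mx w'' w') && (s == joint_mx w' w).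
Proof.
apply/and4P/andP => [[_ /forallP Hr _ /forallP Hs]|[/eqP-> /eqP->]].
  split; apply/eqP/val_inj/matrixP => i j.
    by have /forallP/(_ j)/eqP := Hr i; rewrite sum_joint_tens3_3.
  by have /forallP/(_ j)/eqP := Hs i; rewrite sum_joint_tens3_1.
split; apply/forallP => i; apply/forallP => j.
- by apply/forallP => k; exact: joint_tens3_ge0.
- by rewrite sum_joint_tens3_3.
- by rewrite sum_joint_tens3_2.
- by rewrite sum_joint_tens3_1.
Qed.

Lemma joint_tens3_word r s q (f : {ffun 'I_d -> 'I_(tsz be)}) :
  is_tens3 r s q (joint_tens3 (val w'') f (val w)) -> is_word m f.
Proof.
case/and4P => _ /forallP Hr _ _; apply/forallP => j; apply/eqP.
rewrite /phi -(tmat_col r) addrC; apply: (canRL (subrK _)).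
rewrite -(sum_joint_matrix1 (val w'') f); apply: eq_bigr => i _.
by rewrite -(sum_joint_tens3_3 _ _ (val w)); have /forallP/(_ j)/eqP := Hr i.
Qed.

(** A tensor contributes to the structure constant the number of middle words
    that realise it: both sides are zero if a specialised entry is negative, and
    otherwise the words are counted by multinomial coefficients. *)
Lemma eval_prod_multinom3 r s A : is_tens3 r s (joint_mx w'' w) A ->
  ev (\prod_i \prod_k multinom3 v A i k) =
  #|[pred f : {ffun 'I_d -> 'I_(tsz be)} | joint_tens3 (val w'') f (val w) == A]|%:R.
Proof.
case/and4P => /forallP A0 _ /forallP Aq _.
have {}Aq i k : \sum_j A (i, j, k) = val (joint_mx w'' w) i k.
  by have /forallP/(_ k)/eqP := Aq i.
have tQ i k : \sum_j tens_spec m A i j k =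
    #|[pred p | (val w p == k) && (val w'' p == i)]|%:Z.
  rewrite /tens_spec big_split /= Aq joint_mxE.
  rewrite (eq_bigr (fun j : 'I_(tsz be) =>
    (if i == k :> nat then shift i else 0)%N%:Z *+ (i == j :> nat))); last first.
    move=> j _; case: (eqVneq (i : nat) j) => [->|_]; last by rewrite !mulr0n.
    by case: eqP.
  rewrite sum_delta; last first.
    by move=> ibe; rewrite shift_ge ?if_same //; apply: leq_trans (tsz_ge be) ibe.
  by case: eqP; rewrite ?subrK // subr0 addr0.
have fE i k := @eval_multinom3 _ _ _ _ _ vm _ _ _ A i k.
transitivity (\prod_i \prod_k
    (if [forall j, 0 <= tens_spec m A i j k] then
      (\sum_j absz (tens_spec m A i j k))`!%:R / \prod_j (absz (tens_spec m A i j k))`!%:R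
     else 0) : rat).
  rewrite rmorph_prod; apply: eq_bigr => i _; rewrite rmorph_prod.
  apply: eq_bigr => k _; rewrite [LHS]fE ?tQ // => j /negbTE ijk.
  by have /forallP/(_ j)/forallP/(_ k) := A0 i; rewrite ijk.
rewrite pair_bigA /=.
have [t_ge0|] := pselect (forall i j k, 0 <= tens_spec m A i j k); last first.
  move=> tn; rewrite [RHS](_ : _ = 0).
    have [[[i j] k] /= neg] : { x : 'I_(tsz ga) * 'I_(tsz be) * 'I_(tsz al) |
        ~~ (0 <= tens_spec m A x.1.1 x.1.2 x.2) }.
      apply/cid; apply: contra_notP tn => /forallNP tn i j k.
      by have /negP := tn (i, j, k); rewrite negbK.
    rewrite (bigD1 (i, k)) //=; case: forallP => [/(_ j)|_]; last by rewrite mul0r.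
    by rewrite (negbTE neg).
  rewrite eq_card0 // => f; rewrite !unfold_in /=; apply/eqP => fA.
  by apply: tn => i j k; rewrite -fA joint_tens3_shift.
pose a (x : 'I_(tsz ga) * 'I_(tsz al)) (j : 'I_(tsz be)) := absz (tens_spec m A x.1 j x.2).
have aE x j : (a x j)%:Z = tens_spec m A x.1 j x.2 by rewrite gez0_abs.
rewrite (eq_bigr (fun x => (\sum_j a x j)`!%:R / \prod_j (a x j)`!%:R)); last first.
  by move=> x _; case: forallP => // -[].
have := @count_functions _ _ _ (fun p => (val w'' p, val w p)) a => <-; last first.
  case=> i k; apply/eqP; rewrite -eqz_nat -sum_Posz (eq_bigr _ (fun j _ => aE _ j)) tQ.
  by apply/eqP; congr Posz; apply: eq_card => p; rewrite !unfold_in /= xpair_eqE andbC.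
congr (_%:R); apply: eq_card => f; rewrite !unfold_in /=.
have cE i j k : #|[pred p | ((val w'' p, val w p) == (i, k)) && (f p == j)]| =
    #|[pred p | [&& val w p == k, f p == j & val w'' p == i]]|.
  by apply: eq_card => p; rewrite !unfold_in /= xpair_eqE -andbA [LHS]andbC -andbA.
apply/forallP/eqP => [H|fA [i k]].
  apply/ffunP => -[[i j] k]; have /forallP/(_ j)/eqP := H (i, k); rewrite cE => E.
  by rewrite ffunE /= E aE /tens_spec addrK.
by apply/forallP => j; rewrite cE -eqz_nat aE -fA joint_tens3_shift.
Qed.

(** At nonnegative integers the structure constants count middle words, as the
    composition of maps between permutation modules does. *)
Lemma eval_struct_const r s :
  ev (struct_const v r s (joint_mx w'' w)) =
  \sum_(w' : word m d be) ((r == joint_mx w'' w') && (s == joint_mx w' w))%:R.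
Proof.
rewrite /struct_const raddf_sum /= big_seq_cond.
under eq_bigr => A.
  rewrite andbT in_fset_set; last exact: finite_tens3.
  rewrite inE /= => rsA; rewrite (eval_prod_multinom3 rsA).
  over.
rewrite -big_seq_cond /=.
transitivity (\sum_(A <- fset_set [set A | is_tens3 r s (joint_mx w'' w) A]%classic)
    \sum_(w' : word m d be) (joint_tens3 (val w'') (val w') (val w) == A)%:R : rat).
  rewrite big_seq_cond [RHS]big_seq_cond; apply: eq_bigr => A.
  rewrite andbT in_fset_set; last exact: finite_tens3.
  rewrite inE /= => rsA; apply/esym.
  have H := (@sum_val_bool _ (@is_word l m d be) (fun f => joint_tens3 (val w'') f (val w) == A)).
  apply: H.
  by move=> f /eqP fA; apply: (@joint_tens3_word r s (joint_mx w'' w)); rewrite fA.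
rewrite exchange_big /=; apply: eq_bigr => w' _; rewrite -is_tens3_joint.
have [rsA|] := boolP (is_tens3 _ _ _ _); last first.
  move=> nrsA; rewrite big_seq_cond big1 // => A; rewrite andbT in_fset_set; last exact: finite_tens3.
  by rewrite inE /=; case: eqP nrsA => [->/negbTE->|].
rewrite (bigD1_seq (joint_tens3 (val w'') (val w') (val w))) ?fset_uniq //=; last first.
  by rewrite in_fset_set ?inE //; exact: finite_tens3.
by rewrite eqxx big1 ?addr0 // => A /negbTE; rewrite eq_sym => ->.
Qed.

Theorem F_hom_comp (g : hom n be ga) (f : hom n al be) :
  F_hom mu (compm (l := Ccat v) g f : hom n al ga) w'' w =
  \sum_(w' : word m d be) F_hom mu g w'' w' * F_hom mu f w' w.
Proof.
rewrite F_homE /= /bilin /lext raddf_sum /= raddf_sum /=.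
under [RHS]eq_bigr => w' _ do rewrite [F_hom mu g _ _]/F_hom big_distrl /=.
rewrite exchange_big /=; apply: eq_bigr => r _.
rewrite monalg.mcoeffZ rmorphM /=.
under [RHS]eq_bigr => w' _ do rewrite -mulrA.
rewrite -mulr_sumr; congr (_ * _).
rewrite raddf_sum /= raddf_sum /=.
under [RHS]eq_bigr => w' _ do rewrite /F_hom big_distrr /=.
rewrite exchange_big /=; apply: eq_bigr => s _.
rewrite monalg.mcoeffZ rmorphM /= mcoeff_xi_mul eval_struct_const mulr_sumr.
by apply: eq_bigr => w' _; rewrite !F_xiE mulrCA -natrM mulnb.
Qed.
End Composition.
End Functoriality.

(** * The specialisations are jointly faithful *)

Section MalgLinear.
Variables (R : comNzRingType) (K : choiceType) (V : lmodType R).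

Lemma malg_sum (f : {malg R[K]}) :
  f = \sum_(k <- monalg.msupp f) monalg.mcoeff k f *: (<< k >> : {malg R[K]}).
Proof.
rewrite {1}[f](monalgEw (fsubset_refl _)); apply: eq_bigr => k _.
by apply/malgP => k'; rewrite monalg.mcoeffZ !monalg.mcoeffU mulr_natr.
Qed.

Lemma linear_lincomb (L : {malg R[K]} -> V) I (s : seq I) c u : linear L ->
  L (\sum_(i <- s) c i *: u i) = \sum_(i <- s) c i *: L (u i).
Proof.
move=> Ll; elim: s => [|i s IH]; first by rewrite !big_nil (linear_at0 Ll).
by rewrite !big_cons Ll IH.
Qed.

Lemma malg_linear_ext (L L' : {malg R[K]} -> V) :
  linear L -> linear L' -> (forall k, L << k >> = L' << k >>) -> L =1 L'.
Proof.
move=> Ll Ll' LL f; rewrite (malg_sum f) !linear_lincomb //.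
by apply: eq_bigr => k _; rewrite LL.
Qed.

Lemma lext_basis (F : K -> V) k : lext F << k >> = F k.
Proof.
rewrite /lext msuppU oner_eq0 big_seq_fset1 monalg.mcoeffUU scale1r //.
Qed.
End MalgLinear.

Section BaseChange.
Variables (l n : nat) (v : l.-tuple {mpoly rat[n]}).

(** Extension of scalars along [lambda_i |-> v_i], which carries the generic
    category to the one with parameters [v]. *)
Definition base_change (al be : Tseq l) (f : hom l al be) : hom n al be :=
  \sum_(q <- monalg.msupp f) (monalg.mcoeff q f \mPo v) *: << q >>.

Lemma base_changeE al be (f : hom l al be) q :
  monalg.mcoeff q (base_change f) = monalg.mcoeff q f \mPo v.
Proof.
rewrite /base_change raddf_sum /=.
under eq_bigr do rewrite monalg.mcoeffZ monalg.mcoeffU.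
have [qf|qf] := boolP (q \in monalg.msupp f).
  rewrite (bigD1_seq q) ?fset_uniq //= eqxx mulr1 big1 ?addr0 // => q' /negbTE ->.
  by rewrite mulr0.
rewrite monalg.mcoeff_outdom // comp_mpoly0 big_seq_cond big1 // => q' /andP[q'f _].
by case: eqVneq q'f qf => [->->//|]; rewrite mulr0.
Qed.

Lemma multinom3_base_change (al be ga : Tseq l) (A : tens3 al be ga) i k :
  multinom3 (lam_vars l) A i k \mPo v = multinom3 v A i k.
Proof.
rewrite /multinom3; case: andP => [[_ il]|_]; last by rewrite rmorph_nat.
rewrite comp_mpolyZ; congr (_ *: _); rewrite /fallp rmorph_prod.
apply: eq_bigr => s _; rewrite rmorphB rmorphD /= rmorph_int rmorph_nat.
have -> : (lam_vars l)`_i = 'X_(Ordinal il).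
  by rewrite -[i : nat]/(val (Ordinal il)) -tnth_nth tnth_mktuple.
by rewrite comp_mpolyXU.
Qed.

Lemma struct_const_base_change (al be ga : Tseq l) (r : Tmat be ga) (s : Tmat al be) q :
  struct_const (lam_vars l) r s q \mPo v = struct_const v r s q.
Proof.
rewrite /struct_const rmorph_sum; apply: eq_bigr => A _; rewrite rmorph_prod.
apply: eq_bigr => i _; rewrite rmorph_prod; apply: eq_bigr => k _.
exact: multinom3_base_change.
Qed.

Lemma base_change_comp (al be ga : Tseq l) (g : hom l be ga) (f : hom l al be) :
  base_change (compm (l := Clam l) g f : hom l al ga) =
  (compm (l := Ccat v) (base_change g : hom n be ga) (base_change f : hom n al be)).
Proof.
have supp be' ga' (h : hom l be' ga') : (monalg.msupp (base_change h) `<=` monalg.msupp h)%fset.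
  apply/fsubsetP => q; rewrite -!monalg.mcoeff_neq0 base_changeE.
  by apply: contra_neq => ->; rewrite comp_mpoly0.
apply/malgP => q; rewrite base_changeE /= /bilin.
rewrite (lextw _ (supp _ _ g)) (lextw _ (fsubset_refl (monalg.msupp g))).
rewrite !raddf_sum /=; apply: eq_bigr => r _.
rewrite base_changeE !monalg.mcoeffZ rmorphM /=; congr (_ * _).
rewrite (lextw _ (supp _ _ f)) (lextw _ (fsubset_refl (monalg.msupp f))).
rewrite !raddf_sum /=; apply: eq_bigr => s _.
by rewrite base_changeE !monalg.mcoeffZ rmorphM /= !mcoeff_xi_mul struct_const_base_change.
Qed.

Lemma base_change_basis al be (q : Tmat al be) : base_change << q >> = << q >>.
Proof.
apply/malgP => q'; rewrite base_changeE !monalg.mcoeffU.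
by case: eqP => _; rewrite ?comp_mpoly1 ?comp_mpoly0.
Qed.
End BaseChange.

Section Faithful.
Variable l : nat.

Lemma eval_lam_vars (mu : l.-tuple nat) i : (i < l)%N ->
  eval_mu mu (lam_vars l)`_i = (nth 0%N mu i)%:R.
Proof.
move=> il; rewrite -[i]/(val (Ordinal il)) -!tnth_nth tnth_mktuple /eval_mu mevalXU.
by rewrite (tnth_nth 0%N).
Qed.

Lemma sum_phi (l' : nat) (mu : l'.-tuple nat) (al : Tseq l') :
  \sum_(i < tsz al) phi mu al i = (\sum_(i < l') tnth mu i)%N%:Z.
Proof.
rewrite /phi big_split /= tent_sum addr0 sum_Posz; congr Posz.
under [RHS]eq_bigr do rewrite (tnth_nth 0%N).
rewrite (big_ord_widen_cond _ xpredT (fun i => nth 0%N mu i) (tsz_ge al)) /=.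
rewrite (bigID (fun i : 'I_(tsz al) => (i < l')%N)) /= [X in (_ + X)%N]big1 ?addn0 // => i.
by rewrite -leqNgt => ?; rewrite shift_ge.
Qed.

(** Distribute the positions over the cells of the specialised matrix: there are
    as many of them as its entries add up to, because the stored entries of a
    sequence have sum 0. *)
Lemma exists_joint_mx (l' : nat) (mu : l'.-tuple nat) (al be : Tseq l') (q : Tmat al be) :
  (forall i j, 0 <= phi_mx mu q i j) ->
  exists (w' : word mu (\sum_(i < l') tnth mu i)%N be)
         (w : word mu (\sum_(i < l') tnth mu i)%N al), joint_mx w' w = q.
Proof.
set d := (\sum_(i < _) _)%N => q0.
have rowE i : \sum_j phi_mx mu q i j = phi mu be i.
  under eq_bigr do rewrite mxE; rewrite big_split /= tmat_row sum_delta //.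
    by rewrite addrC.
  by move=> ?; rewrite shift_ge // (leq_trans (tsz_ge al)).
have colE j : \sum_i phi_mx mu q i j = phi mu al j.
  under eq_bigr do rewrite mxE; rewrite big_split /= tmat_col.
  rewrite (eq_bigr (fun i : 'I_(tsz be) => (nth 0%N mu j)%:Z *+ (j == i :> nat))); last first.
    by move=> i _; rewrite [(i : nat) == j]eq_sym; case: eqP => [->|].
  rewrite sum_delta; first by rewrite addrC.
  by move=> ?; rewrite shift_ge // (leq_trans (tsz_ge be)).
pose nn (p : 'I_(tsz be) * 'I_(tsz al)) := absz (phi_mx mu q p.1 p.2).
have nnE p : (nn p)%:Z = phi_mx mu q p.1 p.2 by rewrite gez0_abs.
have [f fE] : exists f : {ffun 'I_d -> 'I_(tsz be) * 'I_(tsz al)},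
    forall p, #|[pred k | f k == p]| = nn p.
  apply: exists_fibres; apply/eqP; rewrite -eqz_nat -sum_Posz; apply/eqP.
  rewrite (eq_bigr (fun p => phi_mx mu q p.1 p.2)) => [|p _]; last exact: nnE.
  rewrite -(pair_bigA _ (fun i j => phi_mx mu q i j)) /= (eq_bigr _ (fun i _ => rowE i)).
  exact: sum_phi.
have fcount (P : pred ('I_(tsz be) * 'I_(tsz al))) :
    #|[pred k | P (f k)]|%:Z = \sum_(p | P p) phi_mx mu q p.1 p.2.
  rewrite -(eq_bigr _ (fun p _ => nnE p)) sum_Posz; congr Posz.
  rewrite -sum1_card (partition_big f P) //=; apply: eq_bigr => p Pp.
  rewrite -fE -sum1_card; apply: eq_bigl => k.
  rewrite -[LHS]/(P (f k) && (f k == p)) -[RHS]/(f k == p).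
  by case: eqP => [->|]; rewrite ?andbF ?Pp.
have w'P : is_word mu [ffun k => (f k).1].
  apply/forallP => i; apply/eqP; rewrite -rowE.
  transitivity (#|[pred k | (f k).1 == i]|%:Z); first by congr Posz; apply: eq_card => k; rewrite !unfold_in /= ffunE.
  rewrite (fcount (fun p => p.1 == i)).
  rewrite (eq_bigl (fun p => pred1 i p.1 && xpredT p.2)) => [|p]; last by rewrite /= andbT.
  by rewrite -(pair_big (pred1 i) xpredT (fun i j => phi_mx mu q i j)) /= big_pred1_eq.
have wP : is_word mu [ffun k => (f k).2].
  apply/forallP => j; apply/eqP; rewrite -colE.
  transitivity (#|[pred k | (f k).2 == j]|%:Z); first by congr Posz; apply: eq_card => k; rewrite !unfold_in /= ffunE.
  rewrite (fcount (fun p => p.2 == j)).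
  rewrite -(pair_big xpredT (pred1 j) (fun i j => phi_mx mu q i j)) /=.
  by apply: eq_bigr => i _; rewrite big_pred1_eq.
exists (exist (fun w => is_word mu w) _ w'P).
exists (exist (fun w => is_word mu w) _ wP); apply: val_inj; apply/matrixP => i j.
rewrite joint_mxE /=.
have -> : #|[pred k | ([ffun k => (f k).2] k == j) && ([ffun k => (f k).1] k == i)]| = nn (i, j).
  rewrite -fE; apply: eq_card => k; rewrite !unfold_in /= !ffunE.
  by case: (f k) => a b; rewrite xpair_eqE /= andbC.
by rewrite nnE /= mxE addrK.
Qed.

(** Polynomials are determined by their values at large integers, where every
    matrix of a given finite set specialises to a nonnegative one. *)
Theorem hom_faithful (al be : Tseq l) (h h' : hom l al be) :
  (forall (mu : l.-tuple nat)
      (w' : word mu (\sum_(i < l) tnth mu i)%N be)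
      (w : word mu (\sum_(i < l) tnth mu i)%N al),
    F_hom mu h w' w = F_hom mu h' w' w) -> h = h'.
Proof.
move=> H; apply/malgP => q; apply/eqP; rewrite -subr_eq0; apply/eqP.
apply: (@mpoly_nat_eq0 _ _ (\sum_i \sum_j absz (val q i j))%N) => mu muB.
have [|w' [w qE]] := @exists_joint_mx _ mu _ _ q.
  move=> i j; rewrite mxE.
  have qB : (absz (val q i j) <= \sum_i \sum_j absz (val q i j))%N.
    by rewrite (bigD1 i) //= (bigD1 j) //= -addnA leq_addr.
  have [/andP[/eqP ij il]|/tmat_ge0 q0] := boolP ((i == j :> nat) && (i < l)%N); last first.
    by rewrite addr_ge0 // mulrn_wge0.
  rewrite ij eqxx mulr1n -ij; have := leq_trans qB (muB (Ordinal il)).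
  by rewrite (tnth_nth 0%N) /=; move: (val q i j) (nth _ _ _) => x y; lia.
by rewrite raddfB /= -qE -!F_homE H subrr.
Qed.

Lemma joint_mx_diag (mu : l.-tuple nat) d (al : Tseq l) (w' w : word mu d al) :
  (exist (fun q => is_Tmat q) _ (tmat_diagP al) == joint_mx w' w) = (w' == w).
Proof.
apply/eqP/eqP => [/(congr1 val)/matrixP E|->].
  apply: val_inj; apply/ffunP => k; apply/eqP; apply: contraT => ww.
  have := E (val w' k) (val w k); rewrite mxE joint_mxE -!(inj_eq val_inj) /= in ww *.
  rewrite (negbTE ww) !mulr0n subr0 => /esym/eqP; rewrite eqz_nat => /eqP/card0_eq/(_ k).
  by rewrite !unfold_in /= !eqxx.
apply: val_inj; apply/matrixP => i j; rewrite joint_mxE mxE.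
have [<-|ij] := eqVneq i j.
  rewrite eqxx !mulr1n; have -> : #|[pred k | (val w k == i) && (val w k == i)]| =
      #|[pred k | val w k == i]| by apply: eq_card => k; rewrite !unfold_in /= andbb.
  by rewrite (word_card w i) /phi addrAC subrr add0r.
rewrite -(inj_eq val_inj) /= in ij; rewrite (negbTE ij) !mulr0n subr0.
rewrite eq_card0 // => k; rewrite !unfold_in /=.
by apply: contraNF ij => /andP[/eqP-> /eqP->].
Qed.

Lemma F_hom_id (n : nat) (nu : n.-tuple nat) (mu : l.-tuple nat) d (al : Tseq l) (w' w : word mu d al) :
  F_hom nu (hid n al) w' w = (w' == w)%:R.
Proof. by rewrite F_homE /hid monalg.mcoeffU joint_mx_diag rmorph_nat. Qed.
End Faithful.

(** The laws of the category hold after every specialisation, where they are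
    laws of matrix multiplication; by faithfulness they hold generically. *)
Section CategoryLaws.
Variable l : nat.

Lemma clam_idl (al be : Tseq l) (f : hom l al be) :
  compm (l := Clam l) (hid l be : hom l be be) f = f.
Proof.
apply: hom_faithful => mu; move: (\sum_(i < l) _)%N => d w' w.
rewrite (F_hom_comp (@eval_lam_vars l mu)) (bigD1 w') //= F_hom_id eqxx mul1r.
by rewrite big1 ?addr0 // => u uw; rewrite F_hom_id eq_sym (negbTE uw) mul0r.
Qed.

Lemma clam_idr (al be : Tseq l) (f : hom l al be) :
  compm (l := Clam l) f (hid l al : hom l al al) = f.
Proof.
apply: hom_faithful => mu; move: (\sum_(i < l) _)%N => d w' w.
rewrite (F_hom_comp (@eval_lam_vars l mu)) (bigD1 w) //= F_hom_id eqxx mulr1.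
by rewrite big1 ?addr0 // => u uw; rewrite F_hom_id (negbTE uw) mulr0.
Qed.

Lemma clam_assoc (al be ga de : Tseq l) (h : hom l ga de) (g : hom l be ga)
    (f : hom l al be) :
  compm (l := Clam l) h (compm (l := Clam l) g f) =
  compm (l := Clam l) (compm (l := Clam l) h g) f.
Proof.
apply: hom_faithful => mu; move: (\sum_(i < l) _)%N => d w' w; rewrite !(F_hom_comp (@eval_lam_vars l mu)).
under eq_bigr do rewrite (F_hom_comp (@eval_lam_vars l mu)) mulr_sumr.
rewrite exchange_big /=; apply: eq_bigr => u _.
rewrite (F_hom_comp (@eval_lam_vars l mu)) mulr_suml.
by apply: eq_bigr => u' _; rewrite mulrA.
Qed.

(** Associativity is an identity between the structure constants, which are the
    values of universal polynomials; so it passes to any choice of scalars. *)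
Theorem ccat_assoc n (v : l.-tuple {mpoly rat[n]}) (al be ga de : Tseq l)
    (h : hom n ga de) (g : hom n be ga) (f : hom n al be) :
  compm (l := Ccat v) h (compm (l := Ccat v) g f) =
  compm (l := Ccat v) (compm (l := Ccat v) h g) f.
Proof.
pose C := Ccat v.
have lr x y z (u : mor (l := C) y z) : linear (compm (l := C) (x := x) u) := compm_linearr u.
have ll x y z (u : mor (l := C) x y) : linear (fun t => compm (l := C) (z := z) t u) := compm_linearl u.
pose c3 (h : hom n ga de) (g : hom n be ga) (f : hom n al be) : hom n al de :=
  compm (l := C) h (compm (l := C) g f : hom n al ga).
pose c3' (h : hom n ga de) (g : hom n be ga) (f : hom n al be) : hom n al de :=
  compm (l := C) (compm (l := C) h g : hom n be de) f.
suff {h g f} E r s t : c3 << r >> << s >> << t >> = c3' << r >> << s >> << t >>.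
  have E1 r s : c3 << r >> << s >> =1 c3' << r >> << s >>.
    apply: malg_linear_ext; last exact: E.
      by move=> k a b; rewrite /c3 !lr.
    by move=> k a b; rewrite /c3' !lr.
  have E2 r : (c3 << r >>)^~ f =1 (c3' << r >>)^~ f.
    apply: malg_linear_ext; last by move=> s; apply: E1.
      by move=> k a b; rewrite /c3 ll lr.
    by move=> k a b; rewrite /c3' lr ll.
  apply: (@malg_linear_ext _ _ _ (fun h => c3 h g f) (fun h => c3' h g f)).
  - by move=> k a b; rewrite /c3 ll.
  - by move=> k a b; rewrite /c3' !ll.
  - by move=> r; apply: E2.
rewrite /c3 /c3'.
by rewrite -!(base_change_basis v) -!base_change_comp clam_assoc.
Qed.
End CategoryLaws.

(** * Words over pairs of letters *)

Lemma cell_eqE m n (i i' : 'I_m) (j j' : 'I_n) :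
  (cell i j == cell i' j') = (i == i') && (j == j').
Proof.
apply/eqP/andP => [E|[/eqP-> /eqP->]//].
by split; apply/eqP; [rewrite -(cell_rowK i j) E cell_rowK|rewrite -(cell_colK i j) E cell_colK].
Qed.

Section ActionCells.
Variables (l : nat) (rho : Tseq 1) (be : Tseq l).
Implicit Type g : Gam rho be.

Lemma gam_ge0 g (i : 'I_(tsz rho)) (j : 'I_(tsz be)) :
  ~~ ((i == 0 :> nat) && (j < l)%N) -> 0 <= val g i j.
Proof.
by case/and3P: (valP g) => /forallP/(_ i)/forallP/(_ j)/orP[->|].
Qed.

Lemma gam_row g i : \sum_j val g i j = rho`_i.
Proof. by case/and3P: (valP g) => _ /forallP/(_ i)/eqP. Qed.

Lemma gam_col g j : \sum_i val g i j = be`_j.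
Proof. by case/and3P: (valP g) => _ _ /forallP/(_ j)/eqP. Qed.

Lemma gent_nth g x : (gent g)`_(x : 'I_(tsz rho * tsz be)) = val g (cell_row x) (cell_col x).
Proof. by rewrite -tnth_nth tnth_mktuple. Qed.

Lemma cell_lt_l (i : 'I_(tsz rho)) (j : 'I_(tsz be)) :
  (cell i j < l)%N = (i == 0 :> nat) && (j < l)%N.
Proof.
rewrite /=; case: eqP => [->|/eqP i0] /=; first by rewrite mul0n.
apply/negbTE; rewrite -leqNgt; apply: leq_trans (tsz_ge be) _.
by apply: leq_trans (leq_addr _ _); rewrite leq_pmull // lt0n.
Qed.

(** The variable [lambda_j] sits in the entry [(0, j)] of a [gamma]; the other
    entries are stored as they are. *)
Lemma shift_cell (m : l.-tuple nat) (i : 'I_(tsz rho)) (j : 'I_(tsz be)) :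
  nth 0%N m (cell i j) = if i == 0 :> nat then nth 0%N m j else 0%N.
Proof.
case: (boolP (cell i j < l)%N) => [|/negbTE] lt.
  by move: lt; rewrite cell_lt_l => /andP[i0 _]; rewrite i0 /= (eqP i0) mul0n.
rewrite shift_ge; last by rewrite leqNgt lt.
move: lt; rewrite cell_lt_l; case: eqP => //= _ lt.
by rewrite shift_ge // leqNgt lt.
Qed.

Lemma finite_gam : finite_set [set: Gam rho be]%classic.
Proof.
pose f g : {ffun 'I_(tsz rho) * 'I_(tsz be) -> int} := [ffun p => val g p.1 p.2].
pose B := (\sum_i absz (rho`_(i : 'I_(tsz rho)))%R + \sum_j absz (be`_(j : 'I_(tsz be)))%R)%N.
apply: (@finite_set_inj _ _ _ _ f _ _ (finite_bounded_ffun _ B)).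
  move=> q q' /ffunP E; apply: val_inj; apply/matrixP => i j.
  by have := E (i, j); rewrite !ffunE.
move=> g _ [i j]; rewrite ffunE /=.
have rB a : (absz (rho`_(a : 'I_(tsz rho)))%R <= \sum_i absz (rho`_(i : 'I_(tsz rho)))%R)%N.
  by rewrite [leqRHS](bigD1 a) //= leq_addr.
have bB a : (absz (be`_(a : 'I_(tsz be)))%R <= \sum_i absz (be`_(i : 'I_(tsz be)))%R)%N.
  by rewrite [leqRHS](bigD1 a) //= leq_addr.
have ne0 (i' : 'I_(tsz rho)) : i' != 0 :> nat -> (absz (val g i' j) <= absz (rho`_i')%R)%N.
  move=> i0; rewrite -(gam_row g); apply: (@absz_le_sum _ (fun j => val g i' j)) => // a _.
  by apply: gam_ge0; rewrite (negbTE i0).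
have [i0|i0] := eqVneq (i : nat) 0%N; last first.
  by apply: leq_trans (leq_addr _ _); apply: leq_trans (ne0 _ i0) (rB i).
have -> : val g i j = be`_j - \sum_(a | a != i) val g a j.
  by rewrite -(gam_col g) (bigD1 i) //= addrK.
apply: (@leq_trans (absz (be`_j)%R + \sum_(a | a != i) absz (val g a j))%N).
  by have := @absz_sum_le _ (fun a => val g a j) (fun a => a != i); lia.
rewrite /B addnC; apply: leq_add => //.
rewrite [leqRHS](bigD1 i) //= -[leqLHS]add0n leq_add // leq_sum // => a ai.
by apply: ne0; apply: contra ai => /eqP a0; apply/eqP/val_inj; rewrite /= a0 i0.
Qed.

Fact mem_gams g : g \in fset_set [set: Gam rho be]%classic.
Proof. by rewrite in_fset_set ?inE //; exact: finite_gam. Qed.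

Definition gams g : Gams rho be := FSetSub (mem_gams g).
End ActionCells.

Section JoinWords.
Variables (l : nat) (mu : l.-tuple nat) (d : nat).
Hypothesis mud : (\sum_(i < l) tnth mu i)%N = d.
Local Notation dm := (one_var d).

Lemma sum_shift N : (l <= N)%N -> (\sum_(j < N) nth 0%N mu j)%N = d.
Proof.
move=> lN; rewrite -mud; under [RHS]eq_bigr do rewrite (tnth_nth 0%N).
rewrite (big_ord_widen_cond _ xpredT (fun i => nth 0%N mu i) lN) /=.
rewrite (bigID (fun i : 'I_N => (i < l)%N)) /= [X in (_ + X)%N]big1 ?addn0 // => i.
by rewrite -leqNgt => ?; rewrite shift_ge.
Qed.

Lemma shift1E i : nth 0%N dm i = if i == 0%N then d else 0%N.
Proof. by case: i => [|[|i]]. Qed.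

Section Join.
Variables (rho : Tseq 1) (be : Tseq l).

(** The [gamma] to which a pair of words belongs; a pair of words is then the
    same as a word over the cells of its [gamma], and this is the bijection
    between the bases of [F_d X \otimes M^be] and of [F_mu (X \otimes M^be)]. *)
Definition join_gmx (wr : {ffun 'I_d -> 'I_(tsz rho)}) (wb : {ffun 'I_d -> 'I_(tsz be)}) :
    'M[int]_(tsz rho, tsz be) :=
  \matrix_(i, j) (#|[pred k | (wb k == j) && (wr k == i)]|%:Z
                  - (nth 0%N mu j)%:Z *+ (i == 0%N :> nat)).

Fact join_gamP (wr : word dm d rho) (wb : word mu d be) :
  is_Gam (join_gmx (val wr) (val wb)).
Proof.
apply/and3P; split.
- apply/forallP => i; apply/forallP => j; rewrite !mxE.
  case: eqP => [i0|_] /=; last by rewrite subr0.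
  by case: ltnP => //= li; rewrite shift_ge // subr0.
- apply/forallP => i; apply/eqP; under eq_bigr do rewrite mxE.
  rewrite sumrB sum_Posz (card_fibre_sum (val wb) (fun k => val wr k == i)).
  rewrite (word_card wr i) /phi shift1E.
  case: eqP => _; last by rewrite big1 ?subr0 // add0r.
  under eq_bigr do rewrite mulr1n.
  by rewrite sum_Posz sum_shift ?tsz_ge // addrAC subrr add0r.
- apply/forallP => j; apply/eqP; under eq_bigr do rewrite mxE.
  rewrite sumrB sum_Posz.
  rewrite (eq_bigr (fun i => #|[pred k | (val wr k == i) && (val wb k == j)]|)); last first.
    by move=> i _; apply: eq_card => k; rewrite !unfold_in /= andbC.
  rewrite (card_fibre_sum (val wr) (fun k => val wb k == j)) (word_card wb j) /phi.
  rewrite (eq_bigr (fun i : 'I_(tsz rho) => (nth 0%N mu j)%:Z *+ (0%N == i :> nat))); last first.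
    by move=> i _; rewrite eq_sym.
  rewrite sum_delta; last by have := tsz_ge rho; case: (tsz rho).
  by rewrite addrAC subrr add0r.
Qed.

Definition join_gam wr wb : Gam rho be := exist (fun g => is_Gam g) _ (join_gamP wr wb).

Lemma gob_phi (g : Gam rho be) (i : 'I_(tsz rho)) (j : 'I_(tsz be)) :
  phi mu (gob g) (cell i j) = val g i j + (nth 0%N mu j)%:Z *+ (i == 0%N :> nat).
Proof.
rewrite /phi [X in _ + X](gent_nth g (cell i j)) cell_rowK cell_colK addrC; congr (_ + _).
by rewrite shift_cell; case: eqP.
Qed.

Definition join_letters (wr : {ffun 'I_d -> 'I_(tsz rho)}) (wb : {ffun 'I_d -> 'I_(tsz be)}) :
  {ffun 'I_d -> 'I_(tsz rho * tsz be)} := [ffun k => cell (wr k) (wb k)].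

Fact join_wordP (wr : word dm d rho) (wb : word mu d be) :
  is_word (al := gob (join_gam wr wb)) mu (join_letters (val wr) (val wb)).
Proof.
apply/forallP => x; rewrite -(cellK x); set i := cell_row x; set j := cell_col x.
rewrite gob_phi mxE subrK; apply/eqP; congr Posz; apply: eq_card => k.
by rewrite !unfold_in /= ffunE cell_eqE andbC.
Qed.

Definition join_word wr wb : word mu d (gob (join_gam wr wb)) :=
  exist (fun w => is_word mu w) _ (join_wordP wr wb).

Section SplitWord.
Variables (g : Gam rho be) (W : word mu d (gob g)).

Definition row_letters : {ffun 'I_d -> 'I_(tsz rho)} := [ffun k => cell_row (val W k)].
Definition col_letters : {ffun 'I_d -> 'I_(tsz be)} := [ffun k => cell_col (val W k)].

Lemma split_card (i : 'I_(tsz rho)) (j : 'I_(tsz be)) :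
  #|[pred k | (col_letters k == j) && (row_letters k == i)]|%:Z =
  val g i j + (nth 0%N mu j)%:Z *+ (i == 0%N :> nat).
Proof.
rewrite -gob_phi -(word_card W (cell i j)); congr Posz; apply: eq_card => k.
by rewrite !unfold_in /= !ffunE -[sval W k in RHS](cellK (m := tsz rho) (n := tsz be)) cell_eqE andbC.
Qed.

Fact row_wordP : is_word dm row_letters.
Proof.
apply/forallP => i; apply/eqP.
rewrite -(card_fibre_sum col_letters (fun k => row_letters k == i)) -sum_Posz.
rewrite (eq_bigr _ (fun j _ => split_card i j)) big_split /= gam_row /phi addrC.
congr (_ + _); rewrite shift1E; case: eqP => _; last by rewrite big1.
by under eq_bigr do rewrite mulr1n; rewrite sum_Posz sum_shift ?tsz_ge.
Qed.

Fact col_wordP : is_word mu col_letters.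
Proof.
apply/forallP => j; apply/eqP.
rewrite -(card_fibre_sum row_letters (fun k => col_letters k == j)) -sum_Posz.
have E (i : 'I_(tsz rho)) : #|[pred k | (row_letters k == i) && (col_letters k == j)]|%:Z =
    val g i j + (nth 0%N mu j)%:Z *+ (0%N == i :> nat).
  rewrite [0%N == _]eq_sym -split_card; congr Posz.
  by apply: eq_card => k; rewrite !unfold_in /= andbC.
rewrite (eq_bigr _ (fun i _ => E i)) big_split /= gam_col /phi addrC; congr (_ + _).
by rewrite sum_delta //; have := tsz_ge rho; case: (tsz rho).
Qed.

Definition row_word : word dm d rho := exist (fun w => is_word dm w) _ row_wordP.
Definition col_word : word mu d be := exist (fun w => is_word mu w) _ col_wordP.

Lemma join_gam_split : join_gam row_word col_word = g.
Proof. by apply: val_inj; apply/matrixP => i j; rewrite mxE split_card addrK. Qed.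

Lemma join_letters_split : join_letters row_letters col_letters = val W.
Proof. by apply/ffunP => k; rewrite !ffunE cellK. Qed.
End SplitWord.

Lemma row_word_join wr wb : row_word (join_word wr wb) = wr.
Proof. by apply: val_inj; apply/ffunP => k; rewrite !ffunE cell_rowK. Qed.

Lemma col_word_join wr wb : col_word (join_word wr wb) = wb.
Proof. by apply: val_inj; apply/ffunP => k; rewrite !ffunE cell_colK. Qed.
End Join.
End JoinWords.

(** * Tensor products of morphisms *)

Section TensorProduct.
Variable l : nat.
Variables (rho rho' : Tseq 1) (be be' : Tseq l).
Variables (g : Gam rho be) (g' : Gam rho' be').

Lemma cell_eq_lt (i : 'I_(tsz rho')) (j : 'I_(tsz be')) (k : 'I_(tsz rho)) (m : 'I_(tsz be)) :
  (cell i j == cell k m :> nat) && (cell i j < l)%N =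
  [&& i == 0 :> nat, k == 0 :> nat, j == m :> nat & (j < l)%N].
Proof.
have [E|nE] /= := eqVneq (cell i j : nat) (cell k m).
  move: (cell_lt_l i j) (cell_lt_l k m); rewrite -E; case: ltnP => _ /esym; last first.
    by move=> H _; case: (_ == _) H => //= ->; rewrite !andbF.
  move=> /andP[/eqP i0 jl] /esym/andP[/eqP k0 _].
  by move: E; rewrite /= i0 k0 !mul0n !add0n jl => ->; rewrite !eqxx.
apply/esym/negbTE; apply: contra nE => /and4P[/eqP i0 /eqP k0 /eqP jm _].
by rewrite /= i0 k0 jm !mul0n.
Qed.

Lemma tens4_bounded (p : Tmat rho rho') (q : Tmat be be') :
  exists B : nat, forall T : Tmat (gob g) (gob g'), is_tens4 p q T ->
    forall x y, (absz (val T x y) <= B)%N.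
Proof.
exists (\sum_i \sum_k absz (val p i k) + \sum_j \sum_m absz (val q j m))%N.
move=> T /andP[/forallP Tp /forallP Tq] x y.
rewrite -(cellK (m := tsz rho') (n := tsz be') x) -(cellK (m := tsz rho) (n := tsz be) y).
move: (cell_row x) (cell_col x) (cell_row y) (cell_col y) => i j k m {x y}.
have {}Tp a b : \sum_c \sum_d val T (cell a c) (cell b d) = val p a b.
  by have /forallP/(_ b)/eqP := Tp a.
have {}Tq a b : \sum_c \sum_d val T (cell c a) (cell d b) = val q a b.
  by have /forallP/(_ b)/eqP := Tq a.
have pB a b : (absz (val p a b) <= \sum_i \sum_k absz (val p i k))%N.
  by rewrite (bigD1 a) //= (bigD1 b) //= -addnA leq_addr.
have qB a b : (absz (val q a b) <= \sum_i \sum_k absz (val q i k))%N.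
  by rewrite (bigD1 a) //= (bigD1 b) //= -addnA leq_addr.
have T0 (a : 'I_(tsz rho')) (b : 'I_(tsz be')) (c : 'I_(tsz rho)) (e : 'I_(tsz be)) : ~~ [&& a == 0 :> nat, c == 0 :> nat, b == e :> nat & (b < l)%N] ->
    0 <= val T (cell a b : 'I_(tsz rho' * tsz be')) (cell c e : 'I_(tsz rho * tsz be)).
  by rewrite -cell_eq_lt; exact: (@tmat_ge0 _ _ _ T (cell a b) (cell c e)).
have sum2_le (I J : finType) (f : I -> J -> int) a b : (forall x y, 0 <= f x y) ->
    (absz (f a b) <= absz (\sum_x \sum_y f x y)%R)%N.
  move=> f0; apply: (@leq_trans (absz (\sum_y f a y)%R)).
    exact: (@absz_le_sum _ (f a)).
  by apply: (@absz_le_sum _ (fun x => \sum_y f x y)) => // z _; apply: sumr_ge0.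
have pT (a : 'I_(tsz rho')) (b : 'I_(tsz rho)) : (a != i) || (b != k) -> (i == 0 :> nat) -> (k == 0 :> nat) ->
    forall c e, (absz (val T (cell a c) (cell b e)) <= absz (val p a b))%N.
  move=> ab i0 k0 c e; rewrite -(Tp a b).
  apply: (sum2_le _ _ (fun c e => val T (cell a c) (cell b e))) => c' e'.
  apply: T0; apply: contraL ab => /and4P[/eqP a0 /eqP b0 _ _].
  by rewrite -!(inj_eq val_inj) /= a0 b0 (eqP i0) (eqP k0).
have [/and4P[i0 k0 /eqP jm jl]|nd] := boolP [&& i == 0 :> nat, k == 0 :> nat, j == m :> nat & (j < l)%N]; last first.
  have [/andP[i0 k0]|ik] := boolP ((i == 0 :> nat) && (k == 0 :> nat)).
    apply: leq_trans (leq_addl _ _); apply: leq_trans (qB j m); rewrite -(Tq j m).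
    apply: (sum2_le _ _ (fun c e => val T (cell c j) (cell e m))) => a b.
    apply: T0; apply: contra nd => /and4P[_ _ -> ->]; by rewrite i0 k0.
  apply: leq_trans (leq_addr _ _); apply: leq_trans (pB i k); rewrite -(Tp i k).
  apply: (sum2_le _ _ (fun c e => val T (cell i c) (cell k e))) => a b.
  by apply: T0; apply: contra ik => /and4P[-> ->].
have E : val q j m = val T (cell i j) (cell k m) +
    \sum_(ab | ab != (i, k)) val T (cell ab.1 j) (cell ab.2 m).
  by rewrite -(Tq j m) pair_bigA (bigD1 (i, k)).
have -> : val T (cell i j) (cell k m) =
    val q j m - \sum_(ab | ab != (i, k)) val T (cell ab.1 j) (cell ab.2 m).
  by rewrite E addrK.
apply: (@leq_trans (absz (val q j m) +
    \sum_(ab | ab != (i, k)) absz (val T (cell ab.1 j) (cell ab.2 m)))%N).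
  have := @absz_sum_le _ (fun ab => val T (cell ab.1 j) (cell ab.2 m)) (fun ab => ab != (i, k)).
  by move: (\sum_(_ | _) val T _ _) => z; lia.
rewrite addnC; apply: leq_add; last exact: qB.
rewrite pair_bigA [leqRHS](bigD1 (i, k)) //= -[leqLHS]add0n leq_add // leq_sum // => -[a b] ab.
by apply: pT => //; move: ab; rewrite xpair_eqE negb_and.
Qed.

Lemma mcoeff_xi_tens (p : Tmat rho rho') (q : Tmat be be') (T : Tmat (gob g) (gob g')) :
  monalg.mcoeff T (xi_tens g g' p q) = (is_tens4 p q T)%:R.
Proof.
have [B TB] := tens4_bounded p q.
have finT : finite_set [set T : Tmat (gob g) (gob g') | is_tens4 p q T]%classic.
  by apply: (@finite_tmat _ _ _ _ B) => T' /TB.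
rewrite /xi_tens fsbig_finite // raddf_sum /=.
under eq_bigr do rewrite monalg.mcoeffU.
have [pqT|pqT] := boolP (is_tens4 p q T).
  rewrite (bigD1_seq T) ?fset_uniq //= ?in_fset_set ?inE // eqxx big1 ?addr0 //.
  by move=> T' /negbTE ->.
rewrite big_seq_cond big1 // => T'; rewrite andbT in_fset_set // inE /=.
by case: eqP pqT => // -> /negbTE->.
Qed.

Variables (mu : l.-tuple nat) (d : nat).
Hypothesis mud : (\sum_(i < l) tnth mu i)%N = d.
Variables (W' : word mu d (gob g')) (W : word mu d (gob g)).

Lemma joint_mx_cell i j k m :
  val (joint_mx W' W) (cell i j) (cell k m) =
  #|[pred x | [&& row_letters W x == k, col_letters W x == m,
                  row_letters W' x == i & col_letters W' x == j]]|%:Z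
  - (nth 0%N mu j)%:Z *+ [&& i == 0 :> nat, k == 0 :> nat & j == m :> nat].
Proof.
rewrite joint_mxE; congr (Posz _ - _).
  apply: eq_card => x; rewrite !unfold_in /= !ffunE.
  rewrite -[sval W x in LHS](cellK (m := tsz rho) (n := tsz be)).
  rewrite -[sval W' x in LHS](cellK (m := tsz rho') (n := tsz be')).
  by rewrite !cell_eqE -andbA.
have [cl|cl] := boolP (cell i j < l)%N.
  have := cell_eq_lt i j k m; rewrite cl andbT => ->.
  move: cl; rewrite cell_lt_l => /andP[i0 jl].
  by rewrite jl andbT i0 shift_cell i0.
rewrite shift_ge ?mul0rn; last by rewrite leqNgt.
move: cl; rewrite cell_lt_l; case: eqP => [_ /= jl|_ _]; last by rewrite mulr0n.
by rewrite shift_ge ?mul0rn // leqNgt.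
Qed.

(** The 4-tensor of a pair of words over cells has as its margins the matrices
    of the row words and of the column words. In the computation of the first
    margin the formal parts add up to [d], the value of the parameter [t]. *)
Lemma is_tens4_joint_mx (p : Tmat rho rho') (q : Tmat be be') :
  is_tens4 p q (joint_mx W' W) =
  (p == joint_mx (row_word mud W') (row_word mud W)) &&
  (q == joint_mx (col_word W') (col_word W)).
Proof.
have rowE i k : \sum_j \sum_m val (joint_mx W' W) (cell i j) (cell k m) =
    val (joint_mx (row_word mud W') (row_word mud W)) i k.
  under eq_bigr do under eq_bigr do rewrite joint_mx_cell.
  under eq_bigr do rewrite sumrB sum_Posz.
  rewrite sumrB sum_Posz joint_mxE; congr (Posz _ - _).
    rewrite exchange_big /=; apply/esym.
    rewrite -(card_fibre_sum (col_letters W)); apply: eq_bigr => m _.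
    rewrite -(card_fibre_sum (col_letters W')); apply: eq_bigr => j _.
    apply: eq_card => x; rewrite !unfold_in /=.
    by do !case: (_ == _) => //.
  rewrite shift1E; case: eqP => [i0|_] /=; last first.
    by rewrite mul0rn; apply: big1 => j _; apply: big1.
  rewrite i0 [0%N == _]eq_sym; case: eqP => [k0|_] /=; last first.
    by apply: big1 => j _; apply: big1.
  rewrite mulr1n -(sum_shift mud (tsz_ge be')) -sum_Posz; apply: eq_bigr => j _.
  rewrite (sum_delta (N := tsz be)) // => ?; rewrite shift_ge //.
  exact: leq_trans (tsz_ge be) _.
have colE j m : \sum_i \sum_k val (joint_mx W' W) (cell i j) (cell k m) =
    val (joint_mx (col_word W') (col_word W)) j m.
  under eq_bigr do under eq_bigr do rewrite joint_mx_cell.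
  under eq_bigr do rewrite sumrB sum_Posz.
  rewrite sumrB sum_Posz joint_mxE; congr (Posz _ - _).
    rewrite exchange_big /=; apply/esym.
    rewrite -(card_fibre_sum (row_letters W)); apply: eq_bigr => k _.
    rewrite -(card_fibre_sum (row_letters W')); apply: eq_bigr => i _.
    apply: eq_card => x; rewrite !unfold_in /=.
    by do !case: (_ == _) => //.
  case: (tsz rho') (tsz_ge rho') => // N' _; case: (tsz rho) (tsz_ge rho) => // N _.
  rewrite big_ord_recl [X in _ + X]big1 ?addr0 => [|i _]; last by apply: big1.
  by rewrite big_ord_recl big1 ?addr0.
apply/andP/andP => [[/forallP Hp /forallP Hq]|[/eqP-> /eqP->]].
  split; apply/eqP/val_inj/matrixP => i k.
    by have /forallP/(_ k)/eqP := Hp i; rewrite rowE.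
  by have /forallP/(_ k)/eqP := Hq i; rewrite colE.
by split; apply/forallP => i; apply/forallP => k; apply/eqP.
Qed.

(** Under the identification of words over the letters of [M^gamma] with pairs
    of words, the tensor product of morphisms specialises to the Kronecker
    product of their matrices. *)
Theorem F_hom_tens (f : hom l rho rho') (h : hom l be be') :
  F_hom mu (bilin (xi_tens g g') f h) W' W =
  F_hom mu f (row_word mud W') (row_word mud W) *
  F_hom mu h (col_word W') (col_word W).
Proof.
rewrite F_homE /= /bilin /lext raddf_sum /= raddf_sum /= [F_hom mu f _ _]/F_hom big_distrl /=.
apply: eq_bigr => p _; rewrite monalg.mcoeffZ rmorphM /= -mulrA; congr (_ * _).
rewrite raddf_sum /= raddf_sum /= /F_hom big_distrr /=.
apply: eq_bigr => q _; rewrite monalg.mcoeffZ rmorphM /= mcoeff_xi_tens is_tens4_joint_mx.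
by rewrite rmorph_nat !F_xiE mulrCA -natrM mulnb.
Qed.
End TensorProduct.

(** * The Karoubi envelope and its specialisations *)

Lemma dprod_linE (R : nzRingType) (T : finType) (V : T -> lmodType R) c (f g : dprod V) t :
  (c *: f + g) t = c *: f t + g t.
Proof. by rewrite ffunE [X in X + _]ffunE. Qed.

Section RawHoms.
Variables (R : nzRingType) (C : lincat R).

Lemma linear_sum0 (U V : lmodType R) (L : U -> V) I (s : seq I) (P : pred I) u :
  linear L -> L (\sum_(i <- s | P i) u i) = \sum_(i <- s | P i) L (u i).
Proof.
move=> Ll; elim/big_rec2: _ => [|i y x _ <-]; first exact: linear_at0.
by rewrite -[u i]scale1r Ll !scale1r.
Qed.

Hypothesis CA : forall (x y z t : C) (h : mor z t) (g : mor y z) (f : mor x y),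
  compm h (compm g f) = compm (compm h g) f.

Lemma rcomp_assoc (I J K L : finType) (x : I -> C) (y : J -> C) (z : K -> C)
    (t : L -> C) (h : rawhom z t) (g : rawhom y z) (f : rawhom x y) :
  rcomp h (rcomp g f) = rcomp (rcomp h g) f.
Proof.
apply/ffunP => p; rewrite !ffunE /=.
under eq_bigr => k _.
  rewrite ffunE (@linear_sum0 _ _ (fun u => compm (h (p.1, k)) u)); last exact: compm_linearr.
  over.
rewrite exchange_big /=; apply: eq_bigr => j _.
rewrite ffunE (@linear_sum0 _ _ (fun u => compm u (f (j, p.2)))); last exact: compm_linearl.
by apply: eq_bigr => k _; rewrite CA.
Qed.

Lemma tokhomK (X Y : kobj C) (f : rawhom (kob X) (kob Y)) :
  f \in @khom_pred R C X Y -> kraw (tokhom f) = f.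
Proof. by move=> fP; rewrite /tokhom insubdK. Qed.

Lemma krawD (X Y : kobj C) c (f g : khom X Y) : kraw (c *: f + g) = c *: kraw f + kraw g.
Proof. exact: (linearP (val : khom X Y -> rawhom (kob X) (kob Y))). Qed.

Lemma khom_predP (X Y : kobj C) (f : rawhom (kob X) (kob Y)) :
  reflect (rcomp (kidem Y) f = f /\ rcomp f (kidem X) = f) (f \in @khom_pred R C X Y).
Proof. by apply: (iffP andP) => -[/eqP-> /eqP->]. Qed.

Lemma kraw_idl (X Y : kobj C) (f : khom X Y) : rcomp (kidem Y) (kraw f) = kraw f.
Proof. by have /khom_predP[] := krawP f. Qed.

Lemma kraw_idr (X Y : kobj C) (f : khom X Y) : rcomp (kraw f) (kidem X) = kraw f.
Proof. by have /khom_predP[] := krawP f. Qed.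

Lemma kraw_kcomp (X Y Z : kobj C) (g : khom Y Z) (f : khom X Y) :
  kraw (kcomp g f) = rcomp (kraw g) (kraw f).
Proof.
by apply: tokhomK; apply/khom_predP; rewrite rcomp_assoc kraw_idl -rcomp_assoc kraw_idr.
Qed.

Lemma kraw_kid (X : kobj C) : is_idem X -> kraw (kid X) = kidem X.
Proof. by move=> XX; apply: tokhomK; apply/khom_predP; rewrite !XX. Qed.
End RawHoms.

Lemma ccat_assoc' l n (v : l.-tuple {mpoly rat[n]}) (x y z t : Ccat v)
  (h : mor z t) (g : mor y z) (f : mor x y) : compm h (compm g f) = compm (compm h g) f.
Proof. exact: ccat_assoc. Qed.

Section RawSpecialisation.
Variables (l : nat) (m : l.-tuple nat) (d n : nat) (mu : n.-tuple nat).
Variable v : l.-tuple {mpoly rat[n]}.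
Local Notation C := (Ccat v).

(** The basis of the specialisation of a direct sum of objects [M^al]. *)
Definition tagged_words (I : finType) (x : I -> Tseq l) : finType := {a : I & word m d (x a)}.

(** [F] on matrices of morphisms. In the case [l = 1] and [m] equal to the one
    number [d], this is the matrix of [F_d f]. *)
Definition F_raw (I J : finType) (x : I -> Tseq l) (y : J -> Tseq l)
    (f : rawhom (C := C) x y) (t' : tagged_words y) (t : tagged_words x) : rat :=
  F_hom mu (f (tag t', tag t)) (tagged t') (tagged t).

Lemma F_hom_linear (al be : Tseq l) c (f g : hom n al be) w' w :
  F_hom (m := m) (d := d) mu (c *: f + g) w' w =
  eval_mu mu c * F_hom mu f w' w + F_hom mu g w' w.
Proof. by rewrite !F_homE monalg.mcoeffD monalg.mcoeffZ rmorphD rmorphM. Qed.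

Lemma F_hom_sum (al be : Tseq l) (I : finType) (f : I -> hom n al be) w' w :
  F_hom (m := m) (d := d) mu (\sum_i f i) w' w = \sum_i F_hom mu (f i) w' w.
Proof.
by rewrite F_homE !raddf_sum /=; apply: eq_bigr => i _; rewrite F_homE.
Qed.

Hypothesis vm : forall i, (i < l)%N -> eval_mu mu v`_i = (nth 0%N m i)%:R.

Lemma F_raw_comp (I J K : finType) (x : I -> Tseq l) (y : J -> Tseq l) (z : K -> Tseq l)
    (g : rawhom (C := C) y z) (f : rawhom (C := C) x y) t'' t :
  F_raw (rcomp g f) t'' t = \sum_t' F_raw g t'' t' * F_raw f t' t.
Proof.
rewrite /F_raw ffunE F_hom_sum.
under eq_bigr => j _ do rewrite (F_hom_comp vm).
by rewrite sig_big_dep.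
Qed.
End RawSpecialisation.

Lemma eval_del_vars l (mu : l.-tuple nat) d i : (\sum_(i < l) tnth mu i)%N = d ->
  (i < 1)%N -> eval_mu mu (del_vars l)`_i = (nth 0%N (one_var d) i)%:R.
Proof.
move=> mud; case: i => // _ /=; rewrite raddf_sum /= -mud natr_sum.
by apply: eq_bigr => i _; rewrite /eval_mu mevalXU.
Qed.

Lemma F_raw_faithful l (I J : finType) (x : I -> Tseq l) (y : J -> Tseq l)
    (f f' : rawhom (C := Clam l) x y) :
  (forall (mu : l.-tuple nat) d, (\sum_(i < l) tnth mu i)%N = d ->
     forall t' t, F_raw (m := mu) (d := d) mu f t' t = F_raw mu f' t' t) -> f = f'.
Proof.
move=> H; apply/ffunP => -[j i]; apply: hom_faithful => mu w' w.
have := H mu _ erefl (@Tagged _ j (fun b => word mu _ (y b)) w')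
  (@Tagged _ i (fun b => word mu _ (x b)) w).
exact.
Qed.

(** The same bijection between words over cells and pairs of words, for direct
    sums; [join_pair] and [split_pair] are inverse to each other. *)
Section JoinTagged.
Variables (l : nat) (mu : l.-tuple nat) (d : nat).
Hypothesis mud : (\sum_(i < l) tnth mu i)%N = d.
Variables (I : finType) (x : I -> Tseq 1) (be : Tseq l).
Local Notation dm := (one_var d).
Local Notation kx := (tagged_words dm d x).
Local Notation kt := (tagged_words mu d (tens_ob (x := x) (be := be))).

Definition join_idx (a : I) (g : Gams (x a) be) : tens_idx x be :=
  Tagged (fun a => Gams (x a) be) g.

Definition tag_word (a : I) (g : Gams (x a) be) (W : word mu d (gob (val g))) : kt :=
  @Tagged _ (join_idx g) (fun t => word mu d (tens_ob (be := be) t)) W.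

Definition join_pair (p : kx * word mu d be) : kt :=
  @tag_word (tag p.1) (gams (join_gam mud (tagged p.1) p.2)) (join_word mud (tagged p.1) p.2).

Definition split_pair (t : kt) : kx * word mu d be :=
  (Tagged (fun a => word dm d (x a)) (row_word mud (tagged t)), col_word (tagged t)).

Lemma join_pairK : cancel join_pair split_pair.
Proof.
case=> [[a wr] wb]; rewrite /split_pair /join_pair /=; congr pair; last exact: col_word_join.
by congr (Tagged _); exact: row_word_join.
Qed.

Lemma tag_word_eq a (g g' : Gams (x a) be) (W : word mu d (gob (val g)))
    (W' : word mu d (gob (val g'))) :
  g = g' -> (val W : {ffun 'I_d -> 'I_(tsz (x a) * tsz be)}) = val W' ->
  tag_word W = tag_word W'.
Proof. by move=> gg; case: _ / gg W' => W' /val_inj->. Qed.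

Lemma split_pairK : cancel split_pair join_pair.
Proof.
case=> [[a g] W]; apply: (@tag_word_eq a _ g _ W) => /=.
  by apply: val_inj; exact: join_gam_split.
exact: join_letters_split.
Qed.

Lemma join_pair_bij : bijective join_pair. Proof. by exists split_pair; [exact: join_pairK|exact: split_pairK]. Qed.
End JoinTagged.

Section TensorRaw.
Variable l : nat.

Lemma F_raw_rtens (mu : l.-tuple nat) d (mud : (\sum_(i < l) tnth mu i)%N = d)
    (I J : finType) (x : I -> Tseq 1) (y : J -> Tseq 1) (be be' : Tseq l)
    (f : rawhom (C := Cdel l) x y) (h : hom l be be') p' p :
  F_raw (m := mu) (d := d) (v := lam_vars l) mu (rtens f h) (join_pair mud p') (join_pair mud p) =
  F_raw (m := one_var d) (d := d) mu f p'.1 p.1 * F_hom mu h p'.2 p.2.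
Proof.
rewrite {1}/F_raw ffunE (F_hom_tens mud) /=.
by rewrite !row_word_join !col_word_join.
Qed.

(** The interchange law, by faithfulness: specialised tensor products are
    Kronecker products, for which it is the Fubini rule for finite sums. *)
Lemma rtens_comp (I J K : finType) (x : I -> Tseq 1) (y : J -> Tseq 1) (z : K -> Tseq 1)
    (be be' be'' : Tseq l) (f' : rawhom (C := Cdel l) y z) (f : rawhom (C := Cdel l) x y)
    (h' : hom l be' be'') (h : hom l be be') :
  rcomp (C := Clam l) (rtens f' h') (rtens f h) =
  rtens (rcomp f' f) (compm (l := Clam l) h' h : hom l be be'').
Proof.
apply: F_raw_faithful => mu d mud t'' t.
have [[p'' ->] [p ->]] : (exists p'', t'' = join_pair mud p'') /\ (exists p, t = join_pair mud p).
  by split; [exists (split_pair mud t'')|exists (split_pair mud t)]; rewrite split_pairK.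
rewrite (F_raw_comp (@eval_lam_vars l mu)).
rewrite [RHS]F_raw_rtens.
rewrite (reindex _ (onW_bij _ (join_pair_bij mud y be'))) /=.
rewrite (F_raw_comp (fun i => @eval_del_vars l mu d i mud)) (F_hom_comp (@eval_lam_vars l mu)).
rewrite mulr_suml; under [RHS]eq_bigr do rewrite mulr_sumr.
rewrite pair_bigA /=; apply: eq_bigr => -[u w] _.
by rewrite !F_raw_rtens mulrACA.
Qed.



Definition clam_rassoc := @rcomp_assoc _ (Clam l) (@ccat_assoc' l l (lam_vars l)).

Lemma act_idem (X : karoubi (Cdel l)) (be : Tseq l) : is_idem (act X be).
Proof. by rewrite /is_idem /= rtens_comp clam_idl (kar_idem X). Qed.
End TensorRaw.

(** * The universal property of the tensor product *)

Section TensorUniversal.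
Local Open Scope quotient_scope.
Variables (R : comNzRingType) (A M B : lmodType R) (S T : Type).
Variables (ra : A -> S -> A) (lm : S -> M -> M).
Variables (rm : M -> T -> M) (lb : T -> B -> B).
Local Notation tens := (tensor3 ra lm rm lb).
Local Notation tpure := (pure ra lm rm lb).

Lemma tens_piD c (u w : tfree A M B) :
  (\pi_(Quotient.quot (tspanb ra lm rm lb)) (c *: u + w) : tens) =
  c *: (\pi_(Quotient.quot (tspanb ra lm rm lb)) u : tens) +
  (\pi_(Quotient.quot (tspanb ra lm rm lb)) w : tens).
Proof. by rewrite -[c *: (_ : tens)]/(tscale c _) tscaleE tpiD. Qed.

Lemma tens_pi0 : (\pi_(Quotient.quot (tspanb ra lm rm lb)) 0 : tens) = 0.
Proof. by have := tens_piD (-1) 0 0; rewrite scaler0 add0r scaleN1r addNr. Qed.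

Lemma tensor3_ind (P : tens -> Prop) :
  P 0 -> (forall c a m b x, P x -> P (c *: tpure a m b + x)) -> forall x, P x.
Proof.
move=> P0 PS; elim/tpi_ind => u; rewrite (malg_sum u).
elim: (enum_fset (monalg.msupp u)) => [|[[a m] b] s IH]; first by rewrite big_nil tens_pi0.
by rewrite big_cons tens_piD; apply: PS.
Qed.

Lemma trel_eq u w : trel ra lm rm lb (u - w) ->
  (\pi_(Quotient.quot (tspanb ra lm rm lb)) u : tens) =
  \pi_(Quotient.quot (tspanb ra lm rm lb)) w.
Proof.
move=> uw; apply/eqP; rewrite -Quotient.idealrBE; apply/asboolP.
by rewrite -[_ - _]scale1r -[1 *: _]addr0; apply: tspanD => //; exact: tspan0.
Qed.

Lemma pure_lin1 k a a' m b :
  tpure (k *: a + a') m b = k *: tpure a m b + tpure a' m b.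
Proof. by rewrite /pure -tens_piD; apply: trel_eq; exact: trel_linl. Qed.

Lemma pure_lin2 k a m m' b :
  tpure a (k *: m + m') b = k *: tpure a m b + tpure a m' b.
Proof. by rewrite /pure -tens_piD; apply: trel_eq; exact: trel_linm. Qed.

Lemma pure_lin3 k a m b b' :
  tpure a m (k *: b + b') = k *: tpure a m b + tpure a m b'.
Proof. by rewrite /pure -tens_piD; apply: trel_eq; exact: trel_linr. Qed.

Lemma pure_ball a s m b : tpure (ra a s) m b = tpure a (lm s m) b.
Proof. by apply: trel_eq; exact: trel_ball. Qed.

Lemma pure_balr a m t b : tpure a (rm m t) b = tpure a m (lb t b).
Proof. by apply: trel_eq; exact: trel_balr. Qed.

Lemma pure_scale1 k a m b : tpure (k *: a) m b = k *: tpure a m b.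
Proof.
have L : linear (fun a => tpure a m b) by move=> c u w; rewrite pure_lin1.
by have := L k a 0; rewrite addr0 (linear_at0 L) addr0.
Qed.

Lemma pure_scale3 k a m b : tpure a m (k *: b) = k *: tpure a m b.
Proof.
have L : linear (fun b => tpure a m b) by move=> c u w; rewrite pure_lin3.
by have := L k b 0; rewrite addr0 (linear_at0 L) addr0.
Qed.

Lemma pure_scale_sum k k' a b (I : finType) (f : I -> M) :
  tpure (k *: a) (\sum_i f i) (k' *: b) = (k * k') *: \sum_i tpure a (f i) b.
Proof.
rewrite pure_scale1 pure_scale3 scalerA.
pose L m := tpure a m b; have Ll : linear L by move=> c u w; rewrite /L pure_lin2.
by rewrite -[tpure a _ b]/(L _) (linear_sum0 _ _ _ Ll).
Qed.

(** Maps out of the tensor product are allowed to be semilinear along [si]: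
    this is the identity for the functoriality of [H], and the evaluation of
    scalars for its specialisation. *)
Variables (R' : comNzRingType) (si : {rmorphism R -> R'}) (V : lmodType R').

Lemma tensor3_ext (L L' : tens -> V) :
  (forall c x y, L (c *: x + y) = si c *: L x + L y) ->
  (forall c x y, L' (c *: x + y) = si c *: L' x + L' y) ->
  (forall a m b, L (tpure a m b) = L' (tpure a m b)) -> L =1 L'.
Proof.
have L0 (K : tens -> V) : (forall c x y, K (c *: x + y) = si c *: K x + K y) -> K 0 = 0.
  move=> Kl; have := Kl (-1) 0 0; rewrite scaler0 addr0 rmorphN rmorph1.
  by rewrite scaleN1r addNr.
move=> Ll Ll' LL x; elim/tensor3_ind: x => [|c a m b x IH]; first by rewrite !L0.
by rewrite Ll Ll' LL IH.
Qed.

Variable Phi : A -> M -> B -> V.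
Hypothesis Phi1 : forall k a a' m b, Phi (k *: a + a') m b = si k *: Phi a m b + Phi a' m b.
Hypothesis Phi2 : forall k a m m' b, Phi a (k *: m + m') b = si k *: Phi a m b + Phi a m' b.
Hypothesis Phi3 : forall k a m b b', Phi a m (k *: b + b') = si k *: Phi a m b + Phi a m b'.
Hypothesis Phil : forall a s m b, Phi (ra a s) m b = Phi a (lm s m) b.
Hypothesis Phir : forall a m t b, Phi a (rm m t) b = Phi a m (lb t b).

Definition slext (u : tfree A M B) : V :=
  \sum_(k <- monalg.msupp u) si (monalg.mcoeff k u) *: Phi k.1.1 k.1.2 k.2.

Lemma slextw u (d : {fset A * M * B}) : (monalg.msupp u `<=` d)%fset ->
  slext u = \sum_(k <- d) si (monalg.mcoeff k u) *: Phi k.1.1 k.1.2 k.2.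
Proof.
move=> ud; rewrite /slext (big_fset_incl _ ud) //= => k _.
by rewrite -monalg.mcoeff_eq0 => /eqP->; rewrite rmorph0 scale0r.
Qed.

Lemma slext_lin c u w : slext (c *: u + w) = si c *: slext u + slext w.
Proof.
pose d := (monalg.msupp u `|` monalg.msupp w)%fset.
have ud : (monalg.msupp u `<=` d)%fset by exact: fsubsetUl.
have wd : (monalg.msupp w `<=` d)%fset by exact: fsubsetUr.
have uwd : (monalg.msupp (c *: u + w) `<=` d)%fset.
  apply: fsubset_trans (monalg.msuppD_le _ _) _.
  by apply: fsetUSS => //; exact: monalg.msuppZ_le.
rewrite (slextw ud) (slextw wd) (slextw uwd) scaler_sumr -big_split /=.
apply: eq_bigr => k _.
by rewrite monalg.mcoeffD monalg.mcoeffZ rmorphD rmorphM scalerDl scalerA.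
Qed.

Lemma slext_pure a m b : slext << (a, m, b) >> = Phi a m b.
Proof. by rewrite /slext msuppU oner_eq0 big_seq_fset1 monalg.mcoeffUU rmorph1 scale1r. Qed.

Lemma slext0 : slext 0 = 0.
Proof. by rewrite /slext monalg.msupp0 big_seq_fset0. Qed.

Lemma slextB u w : slext (u - w) = slext u - slext w.
Proof.
have := slext_lin (-1) w u; rewrite scaleN1r addrC => ->.
by rewrite rmorphN rmorph1 scaleN1r addrC.
Qed.

Lemma slext_rel k u u1 u2 :
  slext u = si k *: slext u1 + slext u2 -> slext (u - (k *: u1 + u2)) = 0.
Proof. by move=> E; rewrite slextB slext_lin E subrr. Qed.

Lemma slext_rel2 u w : slext u = slext w -> slext (u - w) = 0.
Proof. by move=> E; rewrite slextB E subrr. Qed.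

Lemma slext_tspan u : u \in tspanb ra lm rm lb -> slext u = 0.
Proof.
move/asboolP; elim=> [|k {}u w uR _ IH]; first exact: slext0.
rewrite slext_lin IH addr0; suff -> : slext u = 0 by rewrite scaler0.
case: uR => [k' a a' m b|k' a m m' b|k' a m b b'|a s m b|a m t b].
- apply: slext_rel; exact: etrans (slext_pure _ _ _) (etrans (Phi1 _ _ _ _ _)
    (esym (congr2 (fun x y => si k' *: x + y) (slext_pure _ _ _) (slext_pure _ _ _)))).
- apply: slext_rel; exact: etrans (slext_pure _ _ _) (etrans (Phi2 _ _ _ _ _)
    (esym (congr2 (fun x y => si k' *: x + y) (slext_pure _ _ _) (slext_pure _ _ _)))).
- apply: slext_rel; exact: etrans (slext_pure _ _ _) (etrans (Phi3 _ _ _ _ _)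
    (esym (congr2 (fun x y => si k' *: x + y) (slext_pure _ _ _) (slext_pure _ _ _)))).
- apply: slext_rel2; exact: etrans (slext_pure _ _ _) (etrans (Phil _ _ _ _) (esym (slext_pure _ _ _))).
- apply: slext_rel2; exact: etrans (slext_pure _ _ _) (etrans (Phir _ _ _ _) (esym (slext_pure _ _ _))).
Qed.

Definition tlift (x : tens) : V := slext (generic_quotient.repr x).

Lemma tlift_pi u : tlift (\pi_(Quotient.quot (tspanb ra lm rm lb)) u : tens) = slext u.
Proof.
apply/eqP; rewrite -subr_eq0 -slextB; apply/eqP/slext_tspan.
by rewrite Quotient.idealrBE reprK.
Qed.

Lemma tlift_pure a m b : tlift (tpure a m b) = Phi a m b.
Proof. by rewrite tlift_pi slext_pure. Qed.

Lemma tlift_lin c x y : tlift (c *: x + y) = si c *: tlift x + tlift y.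
Proof.
elim/tpi_ind: x => u; elim/tpi_ind: y => w.
by rewrite -tens_piD !tlift_pi slext_lin.
Qed.
End TensorUniversal.

(** * The action on morphisms, and the functoriality of H *)

Section KaroubiLaws.
Variables (R : nzRingType) (C : lincat R).
Hypothesis CA : forall (x y z t : C) (h : mor z t) (g : mor y z) (f : mor x y),
  compm h (compm g f) = compm (compm h g) f.

Lemma kraw_inj (X Y : kobj C) (f g : khom X Y) : kraw f = kraw g -> f = g.
Proof. exact: val_inj. Qed.

Lemma kcompA (X Y Z W : kobj C) (h : khom Z W) (g : khom Y Z) (f : khom X Y) :
  kcomp h (kcomp g f) = kcomp (kcomp h g) f.
Proof. by apply: kraw_inj; rewrite !kraw_kcomp // rcomp_assoc. Qed.

Lemma kcomp_linearr (X Y Z : kobj C) (g : khom Y Z) : linear (kcomp (X := X) g).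
Proof.
move=> c f f'; apply: kraw_inj.
by rewrite krawD !kraw_kcomp // krawD rcomp_linearr.
Qed.


Lemma kcomp_idl (X Y : kobj C) (f : khom X Y) : is_idem Y -> kcomp (kid Y) f = f.
Proof. by move=> YY; apply: kraw_inj; rewrite kraw_kcomp // kraw_kid // kraw_idl. Qed.

Lemma kcomp_idr (X Y : kobj C) (f : khom X Y) : is_idem X -> kcomp f (kid X) = f.
Proof. by move=> XX; apply: kraw_inj; rewrite kraw_kcomp // kraw_kid // kraw_idr. Qed.
End KaroubiLaws.

Section ActionOnMorphisms.
Variables (l : nat).
Local Notation C := (Clam l).

Lemma clam_assoc' (x y z t : C) (h : mor z t) (g : mor y z) (f : mor x y) :
  compm h (compm g f) = compm (compm h g) f.
Proof. exact: ccat_assoc'. Qed.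

Lemma cdel_assoc' (x y z t : Cdel l) (h : mor z t) (g : mor y z) (f : mor x y) :
  compm h (compm g f) = compm (compm h g) f.
Proof. exact: ccat_assoc'. Qed.

Definition ktens (X Y : karoubi (Cdel l)) (be be' : Tseq l)
    (g : khom X Y) (psi : hom l be be') : khom (act X be) (act Y be') :=
  tokhom (X := act X be) (Y := act Y be') (rtens (kraw g) psi).

Lemma rtens_compE (I J K : finType) (x : I -> Tseq 1) (y : J -> Tseq 1) (z : K -> Tseq 1)
    (be be' be'' : Tseq l) (f' : rawhom (C := Cdel l) y z) (f : rawhom (C := Cdel l) x y)
    (h' : hom l be' be'') (h : hom l be be') f2 h2 :
  rcomp f' f = f2 -> (compm (l := Clam l) h' h : hom l be be'') = h2 ->
  rcomp (C := Clam l) (rtens f' h') (rtens f h) = rtens f2 h2.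
Proof. by move=> <- <-; exact: rtens_comp. Qed.

Lemma kraw_ktens (X Y : karoubi (Cdel l)) (be be' : Tseq l) (g : khom X Y)
    (psi : hom l be be') : kraw (ktens g psi) = rtens (kraw g) psi.
Proof.
apply: tokhomK; apply/khom_predP; split.
  by apply: rtens_compE; [exact: kraw_idl|exact: clam_idl].
by apply: rtens_compE; [exact: kraw_idr|exact: clam_idr].
Qed.

Lemma ktens_comp (X Y Z : karoubi (Cdel l)) (be be' be'' : Tseq l) (g' : khom Y Z)
    (g : khom X Y) (psi' : hom l be' be'') (psi : hom l be be') :
  kcomp (ktens g' psi') (ktens g psi) =
  ktens (kcomp g' g) (compm (l := Clam l) psi' psi : hom l be be'').
Proof.
apply: kraw_inj.
apply: etrans (kraw_kcomp clam_assoc' _ _) _.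
apply: etrans _ (esym (kraw_ktens _ _)).
apply: etrans (congr2 _ (kraw_ktens _ _) (kraw_ktens _ _)) _.
apply: rtens_compE => //; exact: esym (kraw_kcomp cdel_assoc' _ _).
Qed.

Lemma ktens_id (X : karoubi (Cdel l)) be : ktens (kid X) (hid l be) = kid (act X be).
Proof.
apply: kraw_inj; apply: etrans (kraw_ktens _ _) _.
apply: etrans _ (esym (kraw_kid (act_idem X be))).
by rewrite kraw_kid; last exact: kar_idem.
Qed.

Variables (al be : Tseq l).


Definition single (psi : hom l al al) : khom (kincl (al : C)) (kincl (al : C)) :=
  tokhom (X := kincl (al : C)) (Y := kincl (al : C)) [ffun p => psi].

Lemma kraw_single psi : kraw (single psi) = [ffun p => psi].
Proof.
apply: tokhomK; apply/khom_predP.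
split; apply/ffunP => -[[] []]; rewrite ffunE (bigD1 tt) //= big1 ?addr0;
  try (by case); rewrite !ffunE; [exact: clam_idl|exact: clam_idr].
Qed.

Variable X : karoubi (Cdel l).
Implicit Type f : midhom al be X.

(** The actions on [Hom (M^al, X \otimes M^be)] are compositions in the Karoubi
    envelope, so that the compatibilities of the actions with each other and with
    morphisms of [X] reduce to associativity and the interchange law. *)
Lemma mid_lE psi f : mid_l psi f = kcomp (ktens (kid X) psi) f.
Proof.
apply: (congr1 (fun e => tokhom (X := kincl (al : C)) (Y := act X be) (rcomp e (kraw f)))).
apply: esym; apply: etrans (kraw_ktens _ _) _.
by rewrite kraw_kid; last exact: kar_idem.
Qed.

Lemma mid_rE psi f : mid_r f psi = kcomp f (single psi).
Proof.
apply: (congr1 (fun e => tokhom (X := kincl (al : C)) (Y := act X be) (rcomp (kraw f) e))).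
exact: esym (kraw_single psi).
Qed.

Lemma mid_mapE (Y : karoubi (Cdel l)) (g : khom X Y) f :
  mid_map g f = kcomp (ktens g (hid l be)) f.
Proof.
apply: (congr1 (fun e => tokhom (X := kincl (al : C)) (Y := act Y be) (rcomp e (kraw f)))).
exact: esym (kraw_ktens _ _).
Qed.
End ActionOnMorphisms.

Section MidMap.
Variables (l : nat) (al be : Tseq l).
Local Notation C := (Clam l).

Lemma mid_map_linear (X Y : karoubi (Cdel l)) (g : khom X Y) :
  linear (mid_map (al := al) (be := be) g).
Proof. by move=> c f f'; rewrite !mid_mapE; apply: kcomp_linearr; exact: clam_assoc'. Qed.

Lemma mid_map_l (X Y : karoubi (Cdel l)) (g : khom X Y) psi (f : midhom al be X) :
  mid_map g (mid_l psi f) = mid_l psi (mid_map g f).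
Proof.
have E : kcomp (ktens g (hid l be)) (ktens (kid X) psi) =
    kcomp (ktens (kid Y) psi) (ktens g (hid l be)).
  apply: etrans (ktens_comp _ _ _ _) _; apply: etrans _ (esym (ktens_comp _ _ _ _)).
  apply: congr2; last by apply: etrans (clam_idl _) (esym (clam_idr _)).
  by rewrite (kcomp_idl (@cdel_assoc' l)) ?(kcomp_idr (@cdel_assoc' l)) //; exact: kar_idem.
apply: etrans (mid_mapE _ _) _; apply: etrans (congr1 (kcomp _) (mid_lE _ _)) _.
apply: etrans (kcompA (@clam_assoc' l) _ _ _) _.
apply: etrans (congr1 (fun e => kcomp e f) E) _.
apply: etrans (esym (kcompA (@clam_assoc' l) _ _ _)) _.
apply: etrans _ (esym (mid_lE _ _)); rewrite mid_mapE.
by [].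
Qed.

Lemma mid_map_r (X Y : karoubi (Cdel l)) (g : khom X Y) psi (f : midhom al be X) :
  mid_map g (mid_r f psi) = mid_r (mid_map g f) psi.
Proof.
apply: etrans (mid_mapE _ _) _; apply: etrans (congr1 (kcomp _) (mid_rE _ _)) _.
apply: etrans (kcompA (@clam_assoc' l) _ _ _) _.
apply: etrans _ (esym (mid_rE _ _)).
by rewrite mid_mapE.
Qed.

Lemma mid_map_id (X : karoubi (Cdel l)) (f : midhom al be X) : mid_map (kid X) f = f.
Proof.
apply: etrans (mid_mapE _ _) _; apply: etrans (congr1 (fun e => kcomp e f) (ktens_id X be)) _.
exact: (kcomp_idl (@clam_assoc' l) f (act_idem X be)).
Qed.

Lemma mid_map_comp (X Y Z : karoubi (Cdel l)) (g' : khom Y Z) (g : khom X Y)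
    (f : midhom al be X) :
  mid_map (kcomp g' g) f = mid_map g' (mid_map g f).
Proof.
apply: etrans (mid_mapE _ _) _; apply: etrans _ (esym (mid_mapE _ _)).
rewrite (mid_mapE g f).
apply: etrans _ (esym (kcompA (@clam_assoc' l) _ _ _)).
apply: (congr1 (fun e => kcomp e f)); apply: etrans _ (esym (ktens_comp _ _ _ _)).
by apply: congr1; apply: esym (clam_idl _).
Qed.

Section Hmap.
Variables (X Y : karoubi (Cdel l)) (g : khom X Y).

Local Notation R := {mpoly rat[l]}.
Let si : {rmorphism R -> R} := idfun.
Definition hmap_fun (y : R^o) (f : midhom al be X) (x : R^o) : Hsp al be Y :=
  Hpure y (mid_map g f) x.

Definition hmap (h : Hsp al be X) : Hsp al be Y := tlift si hmap_fun h.

Let P1 k y y' m x : hmap_fun (k *: y + y') m x = si k *: hmap_fun y m x + hmap_fun y' m x.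
Proof. exact: pure_lin1. Qed.

Let P2 k y m m' x : hmap_fun y (k *: m + m') x = si k *: hmap_fun y m x + hmap_fun y m' x.
Proof. by rewrite /hmap_fun mid_map_linear; exact: pure_lin2. Qed.

Let P3 k y m x x' : hmap_fun y m (k *: x + x') = si k *: hmap_fun y m x + hmap_fun y m x'.
Proof. exact: pure_lin3. Qed.

Let P4 y psi m x : hmap_fun (HSr y psi) m x = hmap_fun y (mid_l psi m) x.
Proof. by rewrite /hmap_fun mid_map_l; exact: pure_ball. Qed.

Let P5 y m psi x : hmap_fun y (mid_r m psi) x = hmap_fun y m (HSl psi x).
Proof. by rewrite /hmap_fun mid_map_r; exact: pure_balr. Qed.

Fact hmap_linear : linear hmap.
Proof. exact: (tlift_lin P1 P2 P3 P4 P5). Qed.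
HB.instance Definition _ := GRing.isLinear.Build _ _ _ _ hmap hmap_linear.

Lemma hmap_pure y f x : hmap (Hpure y f x) = Hpure y (mid_map g f) x.
Proof. exact: (tlift_pure P1 P2 P3 P4 P5). Qed.
End Hmap.

Lemma hmap_id (X : karoubi (Cdel l)) h : hmap (kid X) h = h.
Proof.
pose si : {rmorphism {mpoly rat[l]} -> {mpoly rat[l]}} := idfun.
apply: (tensor3_ext (si := si) _ _ _ h) => [c x y|c x y|y f x].
- exact: hmap_linear.
- by [].
- by apply: etrans (hmap_pure _ _ _ _) _; rewrite mid_map_id.
Qed.

Lemma hmap_comp (X Y Z : karoubi (Cdel l)) (g' : khom Y Z) (g : khom X Y) h :
  hmap (kcomp g' g) h = hmap g' (hmap g h).
Proof.
pose si : {rmorphism {mpoly rat[l]} -> {mpoly rat[l]}} := idfun.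
apply: (tensor3_ext (si := si) (L' := fun h => hmap g' (hmap g h)) _ _ _ h) => [c x y|c x y|y f x].
- exact: hmap_linear.
- apply: etrans (congr1 (hmap g') (hmap_linear g c x y)) _; exact: hmap_linear.
- apply: etrans (hmap_pure _ _ _ _) _; rewrite mid_map_comp.
  apply: esym; apply: etrans (congr1 (hmap g') (hmap_pure _ _ _ _)) _; exact: hmap_pure.
Qed.
End MidMap.

(** * Leading terms of products *)

Section Dickson.
Variables (T : choiceType) (I : finType) (v : T -> I -> nat).

Lemma dickson_seq (r : seq I) (P : T -> Prop) :
  exists s : seq T, (forall y, y \in s -> P y) /\
    forall x, P x -> exists2 y, y \in s & forall i, i \in r -> (v y i <= v x i)%N.
Proof.
elim: r P => [|i r IH] P.
  have [[x0 Px0]|nP] := pselect (exists x, P x).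
    exists [:: x0]; split=> [y|x _]; first by rewrite inE => /eqP->.
    by exists x0; rewrite ?inE.
  by exists [::]; split=> // x Px; case: nP; exists x.
have [s0 [s0P s0d]] := IH P; pose B := (\max_(y <- s0) v y i)%N.
have /choice[sb sbP] : forall b, exists sb : seq T,
    (forall y, y \in sb -> P y /\ v y i = b) /\
    forall x, P x /\ v x i = b ->
      exists2 y, y \in sb & forall j, j \in r -> (v y j <= v x j)%N.
  by move=> b; exact: IH.
exists (s0 ++ flatten [seq sb b | b <- iota 0 B]); split.
  move=> y; rewrite mem_cat => /orP[/s0P//|/flattenP[_ /mapP[b _ ->]]].
  by case: (sbP b) => + _ => /[apply] -[].
move=> x Px; have [xB|Bx] := ltnP (v x i) B.
  have [_ /(_ x (conj Px erefl))[y ys yx]] := sbP (v x i).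
  exists y; first by rewrite mem_cat; apply/orP; right; apply/flattenP;
    exists (sb (v x i)) => //; apply/map_f; rewrite mem_iota.
  move=> j; rewrite inE => /orP[/eqP->|/yx//].
  by case: (sbP (v x i)) => /(_ y ys)[_ ->].
have [y ys yx] := s0d x Px; exists y; first by rewrite mem_cat ys.
move=> j; rewrite inE => /orP[/eqP->|/yx//]; apply: leq_trans Bx.
by rewrite /B (big_rem y) //= leq_maxl.
Qed.

Lemma dickson : exists s : seq T, forall x, exists2 y, y \in s & forall i, (v y i <= v x i)%N.
Proof.
have [s [_ H]] := dickson_seq (enum I) (fun=> True).
by exists s => x; have [y ys yx] := H x Logic.I; exists y => // i; apply: yx; rewrite mem_enum.
Qed.
End Dickson.

Section Spanned.
Variables (R : comNzRingType) (V : lmodType R).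

Definition spanned (gs : seq V) (x : V) : Prop :=
  exists c : 'I_(size gs) -> R, x = \sum_i c i *: gs`_i.

Lemma spanned0 gs : spanned gs 0.
Proof. by exists (fun=> 0); rewrite big1 // => i _; rewrite scale0r. Qed.

Lemma spanned_lin gs k x y : spanned gs x -> spanned gs y -> spanned gs (k *: x + y).
Proof.
move=> [c ->] [c' ->]; exists (fun i => k * c i + c' i).
by rewrite scaler_sumr -big_split; apply: eq_bigr => i _ /=; rewrite scalerDl scalerA.
Qed.

Lemma spannedZ gs k x : spanned gs x -> spanned gs (k *: x).
Proof. by move=> /(spanned_lin k)/(_ (spanned0 gs)); rewrite addr0. Qed.

Lemma spanned_sum gs I (s : seq I) (P : pred I) (f : I -> V) :
  (forall i, P i -> spanned gs (f i)) -> spanned gs (\sum_(i <- s | P i) f i).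
Proof.
move=> H; elim/big_rec: _ => [|i x Pi]; first exact: spanned0.
by move=> /(spanned_lin 1 (H i Pi)); rewrite scale1r.
Qed.

Lemma spanned_mem (gs : seq V) x : x \in gs -> spanned gs x.
Proof.
rewrite -index_mem => xg; exists (fun i => (i == Ordinal xg)%:R).
rewrite (bigD1 (Ordinal xg)) //= eqxx scale1r big1 ?addr0 => [|i /negbTE->]; last by rewrite scale0r.
by rewrite nth_index // -index_mem.
Qed.

Lemma spanned_fg (gs : seq V) : (forall x, spanned gs x) -> finitely_generated V.
Proof. by move=> H; exists (size gs), (fun i => gs`_i) => x; have [c ->] := H x; exists c. Qed.
End Spanned.

Section LeadingTerm.
Variables (l : nat) (al ga : Tseq l).
Implicit Types q Q : Tmat al ga.

Let ia (i : 'I_l) : 'I_(tsz al) := widen_ord (tsz_ge al) i.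
Let ig (i : 'I_l) : 'I_(tsz ga) := widen_ord (tsz_ge ga) i.

Let liftA (j : 'I_(tsz al)) : (j < l)%N -> exists j0 : 'I_l, j = ia j0.
Proof. by move=> jl; exists (Ordinal jl); apply: val_inj. Qed.

Let liftG (i : 'I_(tsz ga)) : (i < l)%N -> exists i0 : 'I_l, i = ig i0.
Proof. by move=> il; exists (Ordinal il); apply: val_inj. Qed.

Let liftGA (i : 'I_(tsz ga)) (k : 'I_(tsz al)) : (i == k :> nat) && (i < l)%N ->
  exists i0 : 'I_l, i = ig i0 /\ k = ia i0.
Proof.
by move=> /andP[/eqP ik il]; exists (Ordinal il); split; apply: val_inj.
Qed.

Definition same_type q q' : Prop :=
  forall (i : 'I_(tsz ga)) (k : 'I_(tsz al)), ~~ ((i < l) && (k < l))%N -> val q i k = val q' i k.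

Definition dominated q0 q : Prop := same_type q0 q /\
  forall (i : 'I_(tsz ga)) (k : 'I_(tsz al)), i != k :> nat -> val q0 i k <= val q i k.

(** The entries outside the block of the formal variables are bounded by the
    margins, so only finitely many types occur; the entries in the block and off
    the diagonal are natural numbers, to which Dickson's lemma applies. *)
Lemma dominated_finite : exists s : seq (Tmat al ga), forall q, exists2 q0, q0 \in s & dominated q0 q.
Proof.
pose B := (\sum_i absz (ga`_(i : 'I_(tsz ga)))%R + \sum_j absz (al`_(j : 'I_(tsz al)))%R)%N.
pose blk (i : 'I_(tsz ga)) (k : 'I_(tsz al)) := ((i < l) && (k < l))%N.
have qB q i k : ~~ blk i k -> 0 <= val q i k /\ (absz (val q i k) <= B)%N.
  move=> nb; have q0 : 0 <= val q i k.
    by apply: tmat_ge0; apply: contra nb => /andP[/eqP ik il]; rewrite /blk -ik il.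
  split=> //; move: nb; rewrite /blk negb_and -!leqNgt => /orP[li|lk].
    apply: leq_trans (leq_addr _ _); rewrite [leqRHS](bigD1 i) //=; apply: leq_trans (leq_addr _ _).
    rewrite -(tmat_row q); apply: (@absz_le_sum _ (fun k => val q i k)) => // k' _.
    by apply: tmat_ge0; rewrite ltnNge li andbF.
  apply: leq_trans (leq_addl _ _); rewrite [leqRHS](bigD1 k) //=; apply: leq_trans (leq_addr _ _).
  rewrite -(tmat_col q); apply: (@absz_le_sum _ (fun i => val q i k)) => // i' _.
  by apply: tmat_ge0; apply/negP => /andP[/eqP ->]; rewrite ltnNge lk.
(* Outside the block both [x] and [B - x] are recorded, so that a domination
   there is an equality; on the diagonal of the block nothing is compared. *)
pose v q (x : 'I_(tsz ga) * 'I_(tsz al) * bool) : nat :=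
  if blk x.1.1 x.1.2 then if x.1.1 == x.1.2 :> nat then 0%N else absz (val q x.1.1 x.1.2)
  else if x.2 then absz (val q x.1.1 x.1.2) else (B - absz (val q x.1.1 x.1.2))%N.
have [s H] := dickson v; exists s => q; have [q0 q0s q0q] := H q; exists q0 => //.
have st : same_type q0 q.
  move=> i k; rewrite -/(blk i k) => nb; have := q0q (i, k, true); have := q0q (i, k, false).
  rewrite /v /= (negbTE nb); have := qB q i k nb; have := qB q0 i k nb.
  by move: (val q i k) (val q0 i k) => x y; lia.
split=> // i k ik; have [nb|nb] := boolP (blk i k); last by rewrite (st i k nb).
have := q0q (i, k, true); rewrite /v /= nb (negbTE ik).
have p0 : 0 <= val q i k by apply: tmat_ge0; rewrite (negbTE ik).
have p1 : 0 <= val q0 i k by apply: tmat_ge0; rewrite (negbTE ik).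
by move: (val q i k) (val q0 i k) p0 p1 => x y; lia.
Qed.

(** This is a natural number by the row sums, as the off-diagonal entries are
    nonnegative; it measures the distance of [Q] from the diagonal. *)
Definition diag_defect Q : nat :=
  (\sum_(i < l) absz (ga`_i - val Q (ig i) (ia i))%R)%N.

Section Quotient.
Variables (q0 q : Tmat al ga).
Hypothesis q0q : dominated q0 q.

(** The excess of [q] over [q0], moved to an endomorphism of [M^al]: row [j] of
    the block of [M^al] corresponds to row [j] of the block of [M^ga]. *)
Definition mdiff (j k : 'I_(tsz al)) : int :=
  if (insub (j : nat) : option 'I_l) is Some j' then
    if (k < l)%N then val q (ig j') k - val q0 (ig j') k else 0
  else 0.

Lemma mdiffE (j : 'I_l) (k : 'I_(tsz al)) :
  mdiff (ia j) k = val q (ig j) k - val q0 (ig j) k.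
Proof.
rewrite /mdiff insubT //= => jl; have -> : Sub (j : nat) jl = j by apply: val_inj.
case: ltnP => // lk; case: q0q => st _; rewrite (st (ig j) k) ?subrr //.
by rewrite negb_and -!leqNgt lk orbT.
Qed.

Lemma mdiff_out (j k : 'I_(tsz al)) : ~~ ((j < l) && (k < l))%N -> mdiff j k = 0.
Proof.
rewrite /mdiff negb_and; case: insubP => [j' jl jj|] //=.
by rewrite jl /= => /negbTE ->.
Qed.

Fact quot_tmatP : is_Tmat (al := al) (be := al) (\matrix_(j, k) (al`_j *+ (j == k) + mdiff j k)).
Proof.
have /and3P[/forallP D0 /forallP Dr /forallP Dc] := tmat_diagP al.
have lt_ia (j : 'I_(tsz al)) : (j < l)%N -> {j' : 'I_l | j = ia j'}.
  by move=> jl; exists (Ordinal jl); apply: val_inj.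
apply/and3P; split.
- apply/forallP => j; apply/forallP => k; rewrite mxE.
  have /forallP/(_ k) := D0 j; rewrite !mxE => /orP[-> //|d0].
  have [//|/= njk] := boolP ((j == k :> nat) && (j < l)%N).
  have [/andP[jl kl]|nb] := boolP ((j < l) && (k < l))%N; last by rewrite mdiff_out ?addr0.
  have jk : j != k :> nat by move: njk; rewrite jl andbT.
  have [j' jE] := lt_ia j jl; rewrite addr_ge0 // jE mdiffE subr_ge0.
  by case: q0q => _; apply; move: jk; rewrite jE.
- apply/forallP => j; have := Dr j; under eq_bigr do rewrite mxE.
  under [X in _ -> X == _]eq_bigr do rewrite mxE.
  rewrite big_split /= => /eqP->; rewrite -subr_eq0 addrAC subrr add0r; apply/eqP.
  have [jl|nj] := ltnP j l; last by rewrite big1 // => k _; rewrite mdiff_out // ltnNge nj.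
  have [j' jE] := lt_ia j jl; rewrite jE; under eq_bigr do rewrite mdiffE.
  by rewrite sumrB !tmat_row subrr.
- apply/forallP => k; have := Dc k; under eq_bigr do rewrite mxE.
  under [X in _ -> X == _]eq_bigr do rewrite mxE.
  rewrite big_split /= => /eqP->; rewrite -subr_eq0 addrAC subrr add0r; apply/eqP.
  have [kl|nk] := ltnP k l; last by rewrite big1 // => j _; rewrite mdiff_out // (ltnNge k) nk andbF.
  have sumE (N : nat) (lN : (l <= N)%N) (F : 'I_N -> int) :
      (forall i : 'I_N, (l <= i)%N -> F i = 0) -> \sum_i F i = \sum_(i < l) F (widen_ord lN i).
    move=> F0; rewrite (bigID (fun i : 'I_N => (i < l)%N)) /= [X in _ + X]big1 ?addr0.
      by rewrite (big_ord_narrow lN).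
    by move=> i; rewrite -leqNgt => /F0.
  rewrite (sumE _ (tsz_ge al)) => [|j lj]; last by rewrite mdiff_out // ltnNge lj.
  under eq_bigr do rewrite mdiffE.
  rewrite -(sumE _ (tsz_ge ga) (fun i => val q i k - val q0 i k)).
    by rewrite sumrB !tmat_col subrr.
  by move=> i li; case: q0q => st _; rewrite (st i k) ?subrr // ltnNge li.
Qed.

(** If [q0] is dominated by [q], this is the matrix such that [xi_q] is the
    leading term of [xi_q0 xi_(quot_tmat)]. *)
Definition quot_tmat : Tmat al al := exist (fun m => is_Tmat m) _ quot_tmatP.

Lemma quot_tmatE j k : val quot_tmat j k = al`_j *+ (j == k) + mdiff j k.
Proof. by rewrite mxE. Qed.

(** The tensor that produces [q]: the whole excess passes through the entries
    [a_iik]. *)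
Definition lead_tens : tens3 al al ga :=
  [ffun x : 'I_(tsz ga) * 'I_(tsz al) * 'I_(tsz al) => if x.1.2 == x.2 then
      (if (x.1.1 == x.2 :> nat) && (x.1.1 < l)%N then val q x.1.1 x.2 else val q0 x.1.1 x.1.2)
    else if x.1.1 == x.1.2 :> nat then mdiff x.1.2 x.2 else 0].

Section AnyTensor.
Variables (Q : Tmat al ga) (A : tens3 al al ga).
Hypothesis AP : is_tens3 q0 quot_tmat Q A.

Let A0 (i : 'I_(tsz ga)) (j k : 'I_(tsz al)) :
  ~~ [&& i == j :> nat, j == k :> nat & (i < l)%N] -> 0 <= A (i, j, k).
Proof.
by case/and4P: AP => /forallP/(_ i)/forallP/(_ j)/forallP/(_ k)/orP[->|].
Qed.
Let Ar i j : \sum_k A (i, j, k) = val q0 i j.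
Proof. by case/and4P: AP => _ /forallP/(_ i)/forallP/(_ j)/eqP. Qed.
Let Aq i k : \sum_j A (i, j, k) = val Q i k.
Proof. by case/and4P: AP => _ _ /forallP/(_ i)/forallP/(_ k)/eqP. Qed.
Let As j k : \sum_i A (i, j, k) = val quot_tmat j k.
Proof. by case/and4P: AP => _ _ _ /forallP/(_ j)/forallP/(_ k)/eqP. Qed.

Let AjkA (i : 'I_(tsz ga)) (j k : 'I_(tsz al)) : j != k -> 0 <= A (i, j, k).
Proof. by move=> jk; apply: A0; apply: contra jk => /and3P[_ /eqP/val_inj->]. Qed.

Let AjkS (j k : 'I_(tsz al)) : j != k -> \sum_i A (i, j, k) = mdiff j k.
Proof. by move=> jk; rewrite As quot_tmatE (negbTE jk) add0r. Qed.

Let AiiS (i : 'I_l) : A (ig i, ia i, ia i) =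
  val q (ig i) (ia i) + \sum_(k | k != ia i) (mdiff (ia i) k - A (ig i, ia i, k)).
Proof.
have rq : \sum_k mdiff (ia i) k = 0.
  by under eq_bigr do rewrite mdiffE; rewrite sumrB !tmat_row subrr.
have := Ar (ig i) (ia i); move: rq; rewrite (bigD1 (ia i)) //= mdiffE [in X in _ -> X -> _](bigD1 (ia i)) //=.
rewrite sumrB; move: (\sum_(_ | _) _) (\sum_(_ | _) _) => s t.
by move: (val q _ _) (val q0 _ _) (A _) => x y z; lia.
Qed.

(** The term [a_iii] is the remainder of a row sum, and the other terms of the
    row are at most the excess: so no matrix in the product has a larger distance
    from the diagonal than [q], and by [lead_diag_eq] equality forces all excess
    to pass through the entries [a_iik], which determines the tensor. *)
Lemma lead_diag_le (i : 'I_l) : val q (ig i) (ia i) <= val Q (ig i) (ia i).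
Proof.
rewrite -Aq (bigD1 (ia i)) //= AiiS -addrA lerDl addr_ge0 //.
  apply: sumr_ge0 => k ki; rewrite subr_ge0 -AjkS 1?eq_sym // (bigD1 (ig i)) //= lerDl.
  by apply: sumr_ge0 => i' _; apply: AjkA; rewrite eq_sym.
by apply: sumr_ge0 => j ji; exact: AjkA.
Qed.

Lemma lead_diag_eq :
  (forall i : 'I_l, val Q (ig i) (ia i) = val q (ig i) (ia i)) -> A = lead_tens.
Proof.
move=> Qq.
have d0 (i : 'I_l) k : k != ia i -> A (ig i, ia i, k) = mdiff (ia i) k.
  move=> ki; have := Qq i; rewrite -Aq (bigD1 (ia i)) //= AiiS -addrA.
  move/(canRL (addKr _)); rewrite addNr => /eqP.
  rewrite paddr_eq0; first last.
  - by apply: sumr_ge0 => j ji; exact: AjkA.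
  - apply: sumr_ge0 => k' ki'; rewrite subr_ge0 -AjkS 1?eq_sym // (bigD1 (ig i)) //= lerDl.
    by apply: sumr_ge0 => i' _; apply: AjkA; rewrite eq_sym.
  case/andP => + _; rewrite psumr_eq0 => [/allP/(_ k)|k' ki'].
    by rewrite mem_index_enum ki subr_eq0 => /(_ isT)/eqP->.
  rewrite subr_ge0 -AjkS 1?eq_sym // (bigD1 (ig i)) //= lerDl.
  by apply: sumr_ge0 => i' _; apply: AjkA; rewrite eq_sym.
have offd (i : 'I_(tsz ga)) (j k : 'I_(tsz al)) : j != k ->
    A (i, j, k) = if i == j :> nat then mdiff j k else 0.
  move=> jk; have [jl|lj] := ltnP j l; last first.
    have S0 : \sum_i A (i, j, k) = 0 by rewrite AjkS // mdiff_out // ltnNge lj.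
    rewrite mdiff_out ?ltnNge ?lj // if_same; apply/eqP.
    have := S0 => /eqP; rewrite psumr_eq0 => [/allP/(_ i)|i' _]; last exact: AjkA.
    by rewrite mem_index_enum => /(_ isT).
  have [j0 jE] := liftA jl.
  have dj : A (ig j0, j, k) = mdiff j k by rewrite jE d0 // -jE eq_sym.
  case: eqVneq => [ij|ij].
    by rewrite -dj; congr (A (_, _, _)); apply: val_inj; rewrite /= ij jE.
  have := AjkS jk; rewrite (bigD1 (ig j0)) //= dj.
  move/(canRL (addKr _)); rewrite addNr => /eqP.
  rewrite psumr_eq0 => [/allP/(_ i)|i' _]; last exact: AjkA.
  have -> : i != ig j0 by apply: contra ij => /eqP->; rewrite jE.
  by rewrite mem_index_enum => /(_ isT)/eqP->.
apply/ffunP => -[[i j] k]; rewrite ffunE /=; case: (eqVneq j k) => [->{j}|jk]; last exact: offd.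
have [/liftGA[i0 [iE kE]]|nik] := boolP ((i == k :> nat) && (i < l)%N).
  rewrite iE kE AiiS big1 ?addr0 // => k' kk'; by rewrite d0 // subrr.
rewrite -Ar (bigD1 k) //= big1 ?addr0 // => k' kk'; rewrite offd 1?eq_sym //.
case: eqP => // ik; rewrite mdiff_out //.
by move: nik; rewrite ik eqxx /= => /negbTE->.
Qed.
End AnyTensor.

Lemma lead_tensP : is_tens3 q0 quot_tmat q lead_tens.
Proof.
apply/and4P; split.
- apply/forallP => i; apply/forallP => j; apply/forallP => k; rewrite ffunE /=.
  case: (eqVneq j k) => [->|jk].
    by rewrite eqxx /=; case: ifPn => //= nik; apply: tmat_ge0.
  case: eqP => [ij|_]; last by rewrite lexx orbT.
  have [/andP[jl kl]|nb] := boolP ((j < l) && (k < l))%N; last by rewrite mdiff_out ?lexx ?orbT.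
  have [j0 jE] := liftA jl; apply/orP; right.
  rewrite jE mdiffE subr_ge0; case: q0q => _; apply.
  by move: jk; rewrite jE.
- apply/forallP => i; apply/forallP => j; apply/eqP.
  rewrite (bigD1 j) //= ffunE /= eqxx.
  rewrite (eq_bigr (fun k => if i == j :> nat then mdiff j k else 0)); last first.
    by move=> k kj; rewrite ffunE /= eq_sym (negbTE kj).
  have [/liftGA[i0 [iE jE]]|nij] := boolP ((i == j :> nat) && (i < l)%N); last first.
    rewrite big1 ?addr0 // => k _; case: eqP => // ij; rewrite mdiff_out //.
    by move: nij; rewrite ij eqxx /= => /negbTE->.
  have -> : (i == j :> nat) by rewrite iE jE.
  have rq : \sum_k mdiff j k = 0.
    by rewrite jE; under eq_bigr do rewrite mdiffE; rewrite sumrB !tmat_row subrr.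
  move: rq; rewrite (bigD1 j) //= jE mdiffE -iE.
  by move: (\sum_(_ | _) _) (val q _ _) (val q0 _ _) => x y z; lia.
- apply/forallP => i; apply/forallP => k; apply/eqP.
  rewrite (bigD1 k) //= ffunE /= eqxx.
  rewrite (eq_bigr (fun j : 'I_(tsz al) => if i == j :> nat then mdiff j k else 0)); last first.
    by move=> j jk; rewrite ffunE /= (negbTE jk).
  have [/liftGA[i0 [iE kE]]|nik] := boolP ((i == k :> nat) && (i < l)%N).
    rewrite big1 ?addr0 // => j jk; case: eqP => // ij.
    by case/eqP: jk; apply: val_inj; rewrite /= -ij iE kE.
  have [il|li] := ltnP i l; last first.
    rewrite big1 ?addr0 => [|j jk]; last first.
      by case: eqP => // ij; rewrite mdiff_out // -ij ltnNge li.
    by case: q0q => st _; rewrite (st i k) // ltnNge li.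
  have [i0 iE] := liftG il.
  have ki : ia i0 != k.
    by apply: contra nik => /eqP<-; rewrite il iE eqxx.
  rewrite (bigD1 (ia i0)) //= big1 ?addr0 => [|j /andP[jk ji]]; last first.
    by case: eqP => // ij; case/eqP: ji; apply: val_inj; rewrite /= -ij iE.
  have -> : (i == ia i0 :> nat) by rewrite iE.
  by rewrite mdiffE -iE addrCA subrr addr0.
- apply/forallP => j; apply/forallP => k; apply/eqP; rewrite quot_tmatE.
  have [->{j}|jk] := eqVneq j k; last first.
    rewrite add0r; rewrite (eq_bigr (fun i : 'I_(tsz ga) => if i == j :> nat then mdiff j k else 0)); last first.
      by move=> i _; rewrite ffunE /= (negbTE jk).
    have [/andP[jl kl]|nb] := boolP ((j < l) && (k < l))%N; last first.
      by rewrite mdiff_out // big1 // => i _; rewrite if_same.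
    have [j0 jE] := liftA jl.
    rewrite (bigD1 (ig j0)) //= big1 ?addr0 => [|i ij]; first by rewrite jE eqxx.
    case: eqP => // ij'.
    by case/eqP: ij; apply: val_inj; rewrite /= ij' jE.
  under eq_bigr do rewrite ffunE /= eqxx.
  have [kl|lk] := ltnP k l; last first.
    rewrite mdiff_out ?addr0 ?ltnNge ?lk // -(tmat_col q0); apply: eq_bigr => i _.
    by case: eqP => //= ->; rewrite ltnNge lk.
  have [k0 kE] := liftA kl.
  rewrite mulr1n -(tmat_col q0) [in RHS](bigD1 (ig k0)) //= (bigD1 (ig k0)) //=.
  have -> : (k0 == k :> nat) && (k0 < l)%N by rewrite kE eqxx ltn_ord.
  rewrite (eq_bigr (fun i => val q0 i k)) => [|i ik]; last first.
    case: eqP => //= ik'.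
    by case/eqP: ik; apply: val_inj; rewrite /= ik' kE.
  have -> : mdiff k k = val q (ig k0) k - val q0 (ig k0) k by rewrite {1}kE mdiffE.
  by move: (\sum_(_ | _) _) (val q _ _) (val q0 _ _) => x y z; lia.
Qed.

(** Only [lead_tens] contributes. Its multinomial coefficients are positive
    integers; where a formal variable occurs the falling factorial is empty. *)
Lemma struct_const_lead n (v : l.-tuple {mpoly rat[n]}) :
  exists2 c : nat, (0 < c)%N & struct_const v q0 quot_tmat q = c%:R.
Proof.
pose f (i : 'I_(tsz ga)) (k : 'I_(tsz al)) : nat :=
  if (i == k :> nat) && (i < l)%N then 1%N else
  ((\sum_j absz (lead_tens (i, j, k)))`! %/ \prod_j (absz (lead_tens (i, j, k)))`!)%N.
exists (\prod_i \prod_k f i k)%N.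
  apply: prodn_gt0 => i; apply: prodn_gt0 => k; rewrite /f; case: ifP => // _.
  rewrite divn_gt0; last by apply: prodn_gt0 => j; exact: fact_gt0.
  by apply: dvdn_leq; [exact: fact_gt0|exact: prod_fact_dvd].
have -> : struct_const v q0 quot_tmat q = \prod_i \prod_k multinom3 v lead_tens i k.
  rewrite /struct_const (_ : fset_set _ = [fset lead_tens]%fset) ?big_seq_fset1 //.
  rewrite -fset_set1; congr fset_set; apply/seteqP; split=> A /=.
    by move=> AP; apply: (lead_diag_eq AP).
  by move->; exact: lead_tensP.
rewrite natr_prod; apply: eq_bigr => i _; rewrite natr_prod; apply: eq_bigr => k _.
rewrite /multinom3 /f; case: ifP => // /andP[/eqP ik il].
have z (j : 'I_(tsz al)) : j != i :> nat -> lead_tens (i, j, k) = 0.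
  move=> ji; have jk : (j == k) = false.
    by apply: contraNF ji => /eqP->; rewrite ik.
  by rewrite ffunE /= jk eq_sym (negbTE ji).
rewrite [X in fallp _ X]big1 => [|j ji]; last by rewrite z.
rewrite [X in X%:R^-1]big1 => [|j ji]; last by rewrite z.
by rewrite invr1 scale1r /fallp big_ord0.
Qed.

(** Together with [struct_const_lead]: [xi_q0 xi_(quot_tmat)] is a positive
    multiple of [xi_q], up to terms that are closer to the diagonal. *)
Lemma struct_const_lower n (v : l.-tuple {mpoly rat[n]}) Q : struct_const v q0 quot_tmat Q != 0 -> Q != q ->
  (diag_defect Q < diag_defect q)%N.
Proof.
move=> nz Qq; have [A AP] : exists A, is_tens3 q0 quot_tmat Q A.
  apply: contrapT => /forallNP nA; case/eqP: nz; rewrite /struct_const big_seq_cond big1 // => A.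
  rewrite andbT in_fset_set; last exact: finite_tens3.
  by rewrite inE /= => AQ; case: (nA A).
have Q_le (P : Tmat al ga) (i : 'I_l) : val P (ig i) (ia i) <= ga`_i :> int.
  rewrite -(tmat_row P (ig i)) (bigD1 (ia i)) //= lerDl; apply: sumr_ge0 => k ki.
  by apply: tmat_ge0; apply: contra ki => /andP[/eqP ik _]; apply/eqP/val_inj; rewrite /= -ik.
have le (i : 'I_l) : (absz (ga`_i - val Q (ig i) (ia i))%R <= absz (ga`_i - val q (ig i) (ia i))%R)%N.
  have := lead_diag_le AP i; have := Q_le Q i; have := Q_le q i.
  by move: (val Q _ _) (val q _ _) => x y; lia.
rewrite ltn_neqAle; apply/andP; split; last by apply: leq_sum => i _; exact: le.
apply: contraNneq Qq => E.
have Ei : forall i : 'I_l, val Q (ig i) (ia i) = val q (ig i) (ia i).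
  move=> i; have := leqif_sum (fun i (_ : true) => leqif_eq (le i)).
  case=> _; rewrite -/(diag_defect Q) -/(diag_defect q) E eqxx => /esym/forallP/(_ i) /= /eqP.
  have /= := Q_le Q i; have /= := Q_le q i; by move: (sval Q _ _) (sval q _ _) => x y; lia.
have AE := lead_diag_eq AP Ei; apply/eqP/val_inj/matrixP => i k.
case/and4P: AP => _ _ /forallP/(_ i)/forallP/(_ k)/eqP <- _.
by case/and4P: lead_tensP => _ _ /forallP/(_ i)/forallP/(_ k)/eqP <- _; rewrite AE.
Qed.
End Quotient.
End LeadingTerm.

(** * H is finitely generated *)

Section FiniteGenerationCore.
Variables (l : nat) (al ga : Tseq l).
Local Notation R := {mpoly rat[l]}.
Variables (V : lmodType R) (E : hom l al ga -> V) (chi : hom l al al -> R).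
Hypothesis El : linear E.
Hypothesis Echi : forall (u : hom l al ga) psi,
  E (compm (l := Clam l) u psi : hom l al ga) = chi psi *: E u.

Lemma xi_mulE (be : Tseq l) (r : Tmat be ga) (s : Tmat al be) :
  (compm (l := Clam l) (<< r >> : hom l be ga) (<< s >> : hom l al be) : hom l al ga) =
  xi_mul (lam_vars l) r s.
Proof. by rewrite /= /bilin !lext_basis. Qed.

(** Here [E u] stands for the class of [u] in the tensor product, where
    endomorphisms of [M^al] act by scalars. By induction on the distance from the
    diagonal, [E xi_q] lies in the span of the [E xi_q0] with [q0] minimal: up to
    an invertible factor and lower terms [xi_q] is [xi_q0 xi_p], and
    [E (xi_q0 xi_p)] is a multiple of [E xi_q0]. *)
Lemma hom_generators : exists s : seq (Tmat al ga),
  forall u, spanned [seq E << q >> | q <- s] (E u).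
Proof.
have [s sd] := dominated_finite al ga; exists s; set gs := map _ _.
suff H q : spanned gs (E << q >>).
  move=> u; rewrite (malg_sum u) linear_lincomb //; apply: spanned_sum => q _.
  exact: spannedZ.
have [n] := ubnP (diag_defect q); elim: n q => // n IH q; rewrite ltnS => qn.
have [q0 q0s q0q] := sd q.
have [c c0 cE] := struct_const_lead q0q (lam_vars l).
have := Echi << q0 >> << quot_tmat q0q >>; rewrite xi_mulE.
set X := xi_mul _ _ _ => EX.
have XE : X = c%:R *: << q >> + (X - (c%:R *: << q >> : hom l al ga)) by rewrite addrC subrK.
have rest : spanned gs (E (X - (c%:R *: << q >> : hom l al ga))).
  rewrite (malg_sum (X - _)) linear_lincomb // big_seq_cond.
  apply: spanned_sum => Q; rewrite andbT => QX; apply: spannedZ; apply: IH.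
  apply: leq_trans qn; move: QX; rewrite -monalg.mcoeff_neq0 monalg.mcoeffB monalg.mcoeffZ.
  rewrite mcoeff_xi_mul monalg.mcoeffU; have [<-|qQ] := eqVneq q Q.
    by rewrite cE mulr1 subrr eqxx.
  by rewrite mulr0 subr0 => /struct_const_lower; apply; rewrite eq_sym.
have cq : c%:R *: E << q >> = chi << quot_tmat q0q >> *: E << q0 >> -
    E (X - (c%:R *: << q >> : hom l al ga)).
  have EXE : E X = c%:R *: E << q >> + E (X - (c%:R *: << q >> : hom l al ga)).
    by rewrite {1}XE; exact: El.
  by apply/eqP; rewrite eq_sym subr_eq; apply/eqP; exact: etrans (esym EX) EXE.
have cu : (c%:R : R) * (c%:R^-1 : rat)%:MP = 1.
  by rewrite -[c%:R]mpolyC_nat -mpolyCM mulfV // pnatr_eq0 -lt0n.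
have -> : E << q >> = (c%:R^-1 : rat)%:MP *: (c%:R *: E << q >>).
  by rewrite scalerA mulrC cu scale1r.
rewrite cq; apply: spannedZ; rewrite addrC -scaleN1r; apply: spanned_lin => //; apply: spannedZ.
by apply: spanned_mem; apply: map_f.
Qed.
End FiniteGenerationCore.

Section KaroubiColumns.
Variables (R : nzRingType) (C : lincat R).
Hypothesis CA : forall (x y z t : C) (h : mor z t) (g : mor y z) (f : mor x y),
  compm h (compm g f) = compm (compm h g) f.
Hypothesis C1 : forall (x y : C) (f : mor x y), compm f (idm x) = f.
Variables (x : C) (P : kobj C).
Hypothesis PP : is_idem P.

(** The morphisms [x -> P] are the columns of the idempotent of [P], composed
    with morphisms from [x] to the summands; this reduces the finite generation
    for an object of the Karoubi envelope to that for the objects [M^ga]. *)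
Definition raw_col (t : kidx P) (u : mor x (kob P t)) : rawhom (kob (kincl x)) (kob P) :=
  [ffun p => compm (kidem P (p.1, t)) u].

Lemma raw_col_pred t u : raw_col (t := t) u \in @khom_pred _ C (kincl x) P.
Proof.
apply/khom_predP; split; apply/ffunP => -[i []]; rewrite !ffunE /=.
  under eq_bigr do rewrite ffunE CA.
  rewrite -(@linear_sum0 _ _ _ (fun v => compm v u)); last exact: compm_linearl.
  by congr compm; rewrite -[in RHS]PP ffunE.
by rewrite (bigD1 tt) //= big1 ?addr0; [rewrite !ffunE C1|case].
Qed.

Definition col t (u : mor x (kob P t)) : khom (kincl x) P := tokhom (raw_col u).

Lemma kraw_col t u : kraw (col (t := t) u) = raw_col u.
Proof. by apply: tokhomK; exact: raw_col_pred. Qed.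

Lemma col_linear t : linear (col (t := t)).
Proof.
move=> c u v; apply: kraw_inj; rewrite krawD !kraw_col.
by apply/ffunP => p; rewrite dprod_linE !ffunE compm_linearr.
Qed.

Lemma col_comp t u (psi : khom (kincl x) (kincl x)) :
  kcomp (col (t := t) u) psi = col (compm u (kraw psi (tt, tt))).
Proof.
apply: kraw_inj; rewrite kraw_kcomp // !kraw_col; apply/ffunP => -[i []].
rewrite !ffunE (bigD1 tt) //= big1 ?addr0; last by case.
by rewrite ffunE CA.
Qed.

Lemma khom_sum_col (f : khom (kincl x) P) : f = \sum_t col (kraw f (t, tt)).
Proof.
apply: kraw_inj; have kl : linear (@kraw R C (kincl x) P) by exact: krawD.
rewrite (linear_sum0 _ _ _ kl).
transitivity (\sum_t raw_col (kraw f (t, tt))); last by apply: eq_bigr => t _; rewrite kraw_col.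
rewrite -[LHS]kraw_idl; apply/ffunP => -[i []]; rewrite ffunE /=.
have E (F : kidx P -> rawhom (kob (kincl x)) (kob P)) p : (\sum_t F t) p = \sum_t F t p.
  apply: (@big_ind2 _ _ (fun (a : rawhom (kob (kincl x)) (kob P)) b => a p = b)).
  - by rewrite ffunE.
  - by move=> a b a' b' <- <-; rewrite ffunE.
  - by [].
by rewrite E; apply: eq_bigr => t _; rewrite ffunE.
Qed.
End KaroubiColumns.

Section HspFinitelyGenerated.
Variables (l : nat) (al be : Tseq l) (X : karoubi (Cdel l)).
Local Notation R := {mpoly rat[l]}.
Local Notation C := (Clam l).

Lemma clam_id (x y : C) (f : mor x y) : compm f (idm x) = f.
Proof. exact: clam_idr. Qed.

Let P := act X be.
Let PP : is_idem P := act_idem X be.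
Let ccol (t : kidx P) (u : hom l al (kob P t)) : midhom al be X :=
  col (u : mor (al : C) (kob P t)).
Let E (t : kidx P) (u : hom l al (kob P t)) : Hsp al be X :=
  Hpure 1 (ccol u) 1.

Let El t : linear (E (t := t)).
Proof.
move=> c u v; rewrite /E /ccol (col_linear (@clam_assoc' l) clam_id PP c u v).
exact: pure_lin2.
Qed.

Let Echi t (u : hom l al (kob P t)) psi :
  E (compm (l := C) u psi : hom l al (kob P t)) = hs_char psi *: E u.
Proof.
rewrite /E /ccol.
have -> : col (compm (l := C) u psi) = mid_r (col (u : mor (al : C) (kob P t))) psi.
  rewrite mid_rE (col_comp (@clam_assoc' l) clam_id PP) kraw_single.
  by congr (col (compm _ _)); rewrite ffunE.
apply: etrans (pure_balr _ _ _ _ _ _ _ _) _; rewrite /HSl.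
exact: pure_scale3.
Qed.

Lemma Hsp_fg : finitely_generated (Hsp al be X).
Proof.
have /choice[s sP] : forall t, exists s : seq (Hsp al be X), forall u, spanned s (E (t := t) u).
  by move=> t; have [s sP] := hom_generators (@El t) (@Echi t); exists [seq E << q >> | q <- s].
pose gs := flatten [seq s t | t : kidx P].
apply: (@spanned_fg _ _ gs).
have EG t u : spanned gs (E (t := t) u).
  have [c ->] := sP t u; apply: spanned_sum => i _; apply: spannedZ; apply: spanned_mem.
  apply/flattenP; exists (s t); last exact: mem_nth.
  by apply/mapP; exists t => //; rewrite mem_enum.
elim/tensor3_ind => [|c y f x h IH]; first exact: spanned0.
apply: spanned_lin => //.
have HE : Hpure y f x =
    Hpure (y *: (1 : R^o)) (\sum_t ccol (kraw f (t, tt))) (x *: (1 : R^o)) :> Hsp al be X.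
  have H3 (y' x' : R^o) f' : y = y' -> f = f' -> x = x' ->
    Hpure y f x = Hpure y' f' x' :> Hsp al be X by move=> <- <- <-.
  apply: H3 (esym (mulr1 y)) _ (esym (mulr1 x)).
  exact: (khom_sum_col (@clam_assoc' l) clam_id PP f).
have HS : Hpure y f x = (y * x) *: (\sum_t E (kraw f (t, tt)) : Hsp al be X).
  by apply: etrans HE _; exact: pure_scale_sum.
change (spanned gs (Hpure y f x)); rewrite HS.
by apply: spannedZ; apply: spanned_sum.
Qed.
End HspFinitelyGenerated.

(** * Permutation modules and tableaux *)

Section Spans.
Variables (K : fieldType) (vT : vectType K).

Lemma span_ind (P : vT -> Prop) (X : seq vT) :
  P 0 -> (forall c u v, P u -> P v -> P (c *: u + v)) -> (forall x, x \in X -> P x) ->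
  forall v, v \in <<X>>%VS -> P v.
Proof.
move=> P0 PL PX v; rewrite -[X]/(val (in_tuple X)) => /coord_span ->.
elim/big_rec: _ => [//|i u _ Pu]; apply: PL => //; apply: PX.
by rewrite mem_nth ?size_tuple.
Qed.
End Spans.

Section Pact.
Variables (d : nat) (l : nat) (m : l.-tuple nat) (al : Tseq l).
Local Notation W := (words m d al).
Local Notation Q := {ffun W -> rat^o}.

Lemma sact_val (s : 'S_d) (w : W) k : val (sact s w : word m d al) k = val (w : word m d al) (s^-1%g k).
Proof. by rewrite /= ffunE. Qed.

Lemma word_eqP (w w' : word m d al) : (forall k, val w k = val w' k) -> w = w'.
Proof. by move=> E; apply: val_inj; apply/ffunP. Qed.

Lemma sactM (s s' : 'S_d) (w : W) : sact s (sact s' w) = sact (s' * s)%g w.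
Proof. by apply: word_eqP => k; rewrite !sact_val invMg permM. Qed.

Lemma sact1 (w : W) : sact 1%g w = w.
Proof. by apply: word_eqP => k; rewrite sact_val invg1 perm1. Qed.

Lemma sactK (s : 'S_d) (w : W) : sact s^-1%g (sact s w) = w.
Proof. by rewrite sactM mulgV sact1. Qed.

Lemma sactKV (s : 'S_d) (w : W) : sact s (sact s^-1%g w) = w.
Proof. by rewrite sactM mulVg sact1. Qed.

Lemma sact_inj (s : 'S_d) : injective (sact (s := W) s).
Proof. exact: can_inj (sactK s). Qed.

(** The invariant scalar product for which words are orthonormal; it separates
    the elements of the Specht module by their products with polytabloids. *)
Definition ip (u v : Q) : rat := \sum_a (u a : rat) * v a.

Lemma ipDl c u v x : ip (c *: u + v) x = c * ip u x + ip v x.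
Proof.
rewrite /ip mulr_sumr -big_split; apply: eq_bigr => a _ /=.
by rewrite !ffunE mulrDl mulrA.
Qed.

Lemma ipDr c u v x : ip x (c *: u + v) = c * ip x u + ip x v.
Proof.
rewrite /ip mulr_sumr -big_split; apply: eq_bigr => a _ /=.
by rewrite !ffunE mulrDr mulrCA.
Qed.

Lemma ip0r x : ip x 0 = 0.
Proof. by rewrite /ip big1 // => a _; rewrite ffunE mulr0. Qed.

Lemma ip_eq0 u : ip u u = 0 -> u = 0.
Proof.
move/eqP; rewrite psumr_eq0 => [/allP H|a _]; last exact: sqr_ge0.
apply/ffunP => a; rewrite ffunE; apply/eqP.
by have := H a (mem_index_enum _); rewrite /= mulf_eq0 orbb.
Qed.

Lemma ip_pact s (u v : Q) : ip (pact s u) (pact s v) = ip u v.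
Proof.
rewrite /ip (reindex_inj (@sact_inj s)) /=.
by apply: eq_bigr => a _; rewrite !ffunE sactK.
Qed.

Lemma pact_lin s c (u v : Q) : pact s (c *: u + v) = c *: pact s u + pact s v.
Proof. by apply/ffunP => a; rewrite !ffunE. Qed.

End Pact.

Section Specht.
Variables (l : nat) (m : l.-tuple nat) (d : nat) (al : Tseq l).
Hypothesis part : is_partition (phi m al).
Local Notation W := (words m d al).
Local Notation word := (word m d al).
Local Notation Q := {ffun W -> rat^o}.
Local Notation sa := (@sact d W).
Local Notation tab := (word * {ffun 'I_d -> 'I_d})%type.
Implicit Types (t : tab) (s : 'S_d) (v x : word).
Local Notation e := (polytabloid (m := m) (al := al)).
Local Notation Sp := (sspace (specht m d al)).

Definition colgrp t (s : 'S_d) : bool := [forall k, t.2 (s k) == t.2 k].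

Lemma colgrpP t s : reflect (forall k, t.2 (s k) = t.2 k) (colgrp t s).
Proof. by apply: (iffP forallP) => H k; apply/eqP; rewrite H. Qed.

Lemma colgrpM t s s' : colgrp t s -> colgrp t s' -> colgrp t (s * s')%g.
Proof.
by move=> /colgrpP H /colgrpP H'; apply/colgrpP => k; rewrite permM H' H.
Qed.

Lemma colgrpV t s : colgrp t s -> colgrp t s^-1%g.
Proof. by move=> /colgrpP H; apply/colgrpP => k; rewrite -H permKV. Qed.

Definition antisym t (v x : W) : rat :=
  \sum_(s : 'S_d | colgrp t s) (-1) ^+ s * (x == sa s v)%:R.

Lemma polytabloidE t x : e t x = antisym t t.1 x.
Proof. by rewrite ffunE. Qed.

Lemma antisym_act t s v x : colgrp t s -> antisym t (sa s v) x = (-1) ^+ s * antisym t v x.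
Proof.
move=> ts; rewrite /antisym mulr_sumr.
rewrite (reindex_inj (mulgI s^-1%g)).
rewrite (eq_bigl (colgrp t)) => [|s']; last first.
  apply/idP/idP => [H|H]; last by apply: colgrpM => //; exact: colgrpV.
  by rewrite -(mulKVg s s'); apply: colgrpM => //.
apply: eq_bigr => s' _. rewrite sactM mulKVg odd_permM odd_permV signr_addb.
by rewrite mulrA.
Qed.

Lemma antisym_repeat t v x k k' : k != k' -> t.2 k = t.2 k' -> val v k = val v k' ->
  antisym t v x = 0.
Proof.
move=> kk tk vk; pose s := tperm k k'.
have ts : colgrp t s.
  by apply/colgrpP => j; rewrite /s; case: tpermP => // ->.
have sv : sa s v = v.
  apply: word_eqP => j; rewrite sact_val tpermV /s; case: tpermP => // ->//.
have := antisym_act v x ts; rewrite sv odd_tperm kk expr1 mulN1r => /eqP.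
by rewrite -subr_eq0 opprK -mulr2n mulrn_eq0 /= => /eqP.
Qed.

(** A row of length [phi_i] occupies exactly the columns [j < phi_i], once each:
    its [phi_i] numbers are in distinct columns of that range. *)
Lemma tableau_card t (i : 'I_(tsz al)) (j : 'I_d) : is_tableau t ->
  #|[pred k | (val t.1 k == i) && (t.2 k == j)]| = ((j%:Z < phi m al i)%R : nat).
Proof.
case/andP => /injectiveP tinj /forallP tlt.
have le1 : (#|[pred k | (val t.1 k == i) && (t.2 k == j)]| <= 1)%N.
  apply/card_le1_eqP => k k'; rewrite !unfold_in /= => /andP[/eqP a /eqP b] /andP[/eqP a' /eqP b'].
  by apply: tinj; rewrite a b a' b'.
case: ltP => [ji|ij]; last first.
  apply: eq_card0 => k; rewrite !unfold_in /=; apply/negP => /andP[/eqP a /eqP b].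
  by have := tlt k; rewrite a b ltNge ij.
apply/eqP; rewrite eqn_leq le1 /=; apply/card_gt0P.
pose row := [set k | val t.1 k == i]; pose cols := [set j' : 'I_d | j'%:Z < phi m al i].
have rc : #|row|%:Z = phi m al i.
  by rewrite -(word_card t.1 i); congr Posz; apply: eq_card => k; rewrite !inE.
have sub : [set t.2 k | k in row] \subset cols.
  apply/fintype.subsetP => _ /imsetP[k kr ->]; rewrite inE.
  by move: kr; rewrite inE => /eqP <-; exact: tlt.
have ci : #|[set t.2 k | k in row]| = #|row|.
  apply: card_in_imset => k k'; rewrite !inE => /eqP a /eqP a' b.
  by apply: tinj; rewrite a a' b.
have : [set t.2 k | k in row] == cols.
  rewrite eqEcard sub ci -lez_nat rc /cols.
  have [N NE] : {N : nat | phi m al i = N%:Z} by exists #|row|; rewrite rc.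
  rewrite NE lez_nat cardE -(size_map val) -[leqRHS](size_iota 0 N).
  apply: uniq_leq_size; first by rewrite map_inj_uniq ?enum_uniq //; exact: val_inj.
  move=> _ /mapP[j' + ->]; rewrite mem_enum inE mem_iota ltz_nat => ->.
  by rewrite leq0n.
move/eqP => E; have : j \in cols by rewrite inE.
rewrite -E => /imsetP[k kr ->]; exists k; move: kr; rewrite inE => kr.
by rewrite !unfold_in /= kr eqxx.
Qed.
End Specht.

(** * Column antisymmetrisers *)

Section SpechtKey.
Variables (l : nat) (m : l.-tuple nat) (d : nat) (al : Tseq l).
Hypothesis part : is_partition (phi m al).
Local Notation W := (words m d al).
Local Notation word := (word m d al).
Local Notation Q := {ffun W -> rat^o}.
Local Notation sa := (@sact d W).
Local Notation tab := (word * {ffun 'I_d -> 'I_d})%type.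
Implicit Types (t : tab) (s : 'S_d) (v x : word).
Local Notation e := (polytabloid (m := m) (al := al)).

(** If no two letters of [v] in the same column agree, then each column meets
    an initial segment of the letters of [v] in at most as many boxes as it meets
    the corresponding rows of the tableau. Summed over the columns both numbers
    are equal, hence they are equal for each column; so the columns of [v] are
    permutations of the columns of the tableau. *)
Lemma word_in_colgrp_orbit t v : is_tableau t ->
  (forall k k', k != k' -> t.2 k = t.2 k' -> val v k <> val v k') ->
  exists2 s, colgrp t s & v = sa s t.1.
Proof.
move=> tt vinj; have [_ mono] := part.
pose cnt (u : word) (P : pred 'I_(tsz al)) (c : 'I_d) := #|[pred k | P (val u k) && (t.2 k == c)]|.
pose below i0 : pred 'I_(tsz al) := fun i => (i < i0)%N.
have cntE u (P : pred 'I_(tsz al)) c :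
    cnt u P c = (\sum_(i | P i) #|[pred k | (val u k == i) && (t.2 k == c)]|)%N.
  rewrite /cnt -sum1_card (partition_big (val u) P) /=; last by move=> k /andP[].
  apply: eq_bigr => i Pi; rewrite -sum1_card; apply: eq_bigl => k.
  rewrite !unfold_in /=; case: (eqVneq (val u k) i) => [->|]; last by rewrite andbF.
  by rewrite Pi andbT.
have le i0 c : (cnt v (below i0) c <= cnt t.1 (below i0) c)%N.
  have [all_lt|] := boolP [forall i : 'I_(tsz al), (i < i0)%N ==> (c%:Z < phi m al i)].
    have -> : cnt t.1 (below i0) c = #|[set i : 'I_(tsz al) | (i < i0)%N]|.
      rewrite cntE -sum1dep_card; apply: eq_bigr => i ii0.
      by rewrite tableau_card // (implyP (forallP all_lt i) ii0).
    rewrite /cnt -(card_in_imset (f := val v)).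
      apply/subset_leq_card/fintype.subsetP => _ /imsetP[k + ->]; rewrite !inE.
      by move=> /andP[].
    move=> k k' /andP[_ /eqP a] /andP[_ /eqP b] /eqP vk; apply/eqP; move: vk; apply: contraTT => kk.
    by apply/eqP; apply: vinj => //; rewrite a b.
  rewrite negb_forall => /existsP[i1]; rewrite negb_imply -leNgt => /andP[i10 ci1].
  apply: subset_leq_card; apply/fintype.subsetP => k; rewrite !unfold_in /= => /andP[_ /eqP tc].
  rewrite tc eqxx andbT; apply: leq_ltn_trans i10; rewrite leqNgt; apply/negP => lt.
  have /andP[_ /forallP/(_ k)] := tt; rewrite tc ltNge => /negP; apply.
  by apply: le_trans ci1; apply: mono; exact: ltnW.
have tot u i0 : (\sum_c cnt u (below i0) c)%N%:Z = \sum_(i : 'I_(tsz al) | (i < i0)%N) phi m al i.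
  have -> : (\sum_c cnt u (below i0) c = #|[pred k | below i0 (val u k)]|)%N.
    rewrite -(card_fibre_sum t.2); apply: eq_bigr => c _; apply: eq_card => k.
    by rewrite !unfold_in /= andbC.
  rewrite -sum1_card (partition_big (val u) (below i0)) //= -sum_Posz; apply: eq_bigr => i ii0.
  rewrite -(word_card u i) -sum1_card; congr Posz; apply: eq_bigl => k.
  rewrite -[LHS]/((val u k < i0)%N && (val u k == i)) -[RHS]/(val u k == i).
  by case: eqP => [->|_]; [rewrite andbT; exact: ii0|rewrite andbF].
have eq_below i0 c : cnt v (below i0) c = cnt t.1 (below i0) c.
  have := leqif_sum (fun c (_ : true) => leqif_eq (le i0 c)).
  case=> _; have /eqP := tot v i0; rewrite -(tot t.1 i0) eqz_nat => ->.
  by move=> /esym/forallP/(_ c) /= /eqP.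
have fib (i : 'I_(tsz al)) (c : 'I_d) :
    #|[pred k | (val v k == i) && (t.2 k == c)]| = #|[pred k | (val t.1 k == i) && (t.2 k == c)]|.
  have split u : cnt u (below i.+1) c =
      (cnt u (below i) c + #|[pred k | (val u k == i) && (t.2 k == c)]|)%N.
    rewrite !cntE (bigD1 i) //=; last exact: ltnSn.
    rewrite addnC; congr addn; apply: eq_bigl => j.
    by rewrite /below ltnS ltn_neqAle -(inj_eq val_inj) andbC.
  by have := eq_below i.+1 c; rewrite !split eq_below => /addnI.
have [s sE] : exists s : 'S_d, forall k, (val t.1 k, t.2 k) = (val v (s k), t.2 (s k)).
  apply: (@perm_of_fibres _ _ (fun k => (val t.1 k, t.2 k)) (fun k => (val v k, t.2 k))).
  by case=> i c; have := fib i c => /esym; apply: etrans.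
exists s; first by apply/colgrpP => k; case: (sE k) => _ ->.
apply: word_eqP => k; rewrite (sact_val s (t.1 : W)).
by case: (sE (s^-1%g k)) => -> _; rewrite permKV.
Qed.

Lemma antisym_orbit t s : is_tableau t -> colgrp t s -> antisym t t.1 (sa s t.1) = (-1) ^+ s.
Proof.
move=> /andP[/injectiveP tinj _] ts.
rewrite /antisym (bigD1 s) //= eqxx mulr1 big1 ?addr0 // => s' /andP[ts' ss'].
case: eqP => [E|]; last by rewrite mulr0.
case/eqP: ss'; apply: invg_inj; apply/permP => k; apply: tinj; congr pair.
  have := congr1 (fun w : word => val w k) E.
  by rewrite (sact_val s (t.1 : W)) (sact_val s' (t.1 : W)).
have /colgrpP -> := colgrpV ts; by have /colgrpP -> := colgrpV ts'.
Qed.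

(** Antisymmetrising a word along the columns of [t] gives zero or, up to sign,
    the polytabloid of [t]; the factor is the coefficient of the word in it. *)
Lemma antisym_key t v x : is_tableau t ->
  antisym t v x = antisym t t.1 v * antisym t t.1 x.
Proof.
move=> tt.
have [[s ts ->]|nt] := pselect (exists2 s, colgrp t s & v = sa s t.1).
  by rewrite antisym_act // antisym_orbit.
have [k [k' [kk tk vk]]] : exists k k', [/\ k != k', t.2 k = t.2 k' & val v k = val v k'].
  apply: contrapT => H; apply: nt; apply: word_in_colgrp_orbit => // k k' kk tk vk.
  by apply: H; exists k, k'.
rewrite (antisym_repeat _ kk tk vk) [X in _ = X * _]big1 ?mul0r // => s ts.
by case: eqP => [E|]; [case: nt; exists s|rewrite mulr0].
Qed.

Definition colsum t (u : Q) : Q := \sum_(s | colgrp t s) ((-1) ^+ s : rat) *: pact s u.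

(** The column antisymmetriser of [t] has rank one, with image the line of
    [e_t], and the linear form is the scalar product with [e_t]. *)
Lemma colsum_polytabloid t u : is_tableau t -> colsum t u = ip u (e t) *: e t.
Proof.
move=> tt; apply/ffunP => x; rewrite sum_ffunE ffunE polytabloidE.
transitivity (\sum_v (u v : rat) * antisym t v x).
  rewrite /antisym; under [RHS]eq_bigr do rewrite mulr_sumr.
  rewrite exchange_big; apply: eq_bigr => s ts; rewrite !ffunE.
  rewrite (bigD1 (sa s^-1%g x)) // (sactKV s (x : W)) eqxx mulr1 mulrC big1 => [|v vx]; first exact: esym (addr0 _).
  case: eqP => [xE|]; last by rewrite !mulr0.
  by case/eqP: vx; rewrite xE (sactK s (v : W)).
rewrite /ip -[RHS]/(_ * _) mulr_suml; apply: eq_bigr => v _.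
by rewrite antisym_key // polytabloidE mulrA.
Qed.
End SpechtKey.

(** * Endomorphisms of Specht modules *)

Section SpechtModule.
Variables (l : nat) (m : l.-tuple nat) (d : nat) (al : Tseq l).
Hypothesis part : is_partition (phi m al).
Local Notation W := (words m d al).
Local Notation word := (word m d al).
Local Notation Q := {ffun W -> rat^o}.
Local Notation sa := (@sact d W).
Local Notation tab := (word * {ffun 'I_d -> 'I_d})%type.
Implicit Types (t : tab) (s : 'S_d).
Local Notation e := (polytabloid (m := m) (al := al)).
Local Notation Sp := (sspace (specht m d al)).

Definition tableau_act s t : tab := (sa s t.1, [ffun k => t.2 (s^-1%g k)]).

Lemma tableau_act_tableau s t : is_tableau t -> is_tableau (tableau_act s t).
Proof.
move=> /andP[/injectiveP tinj /forallP tlt]; apply/andP; split.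
  apply/injectiveP => k k' /=; rewrite !ffunE => -[a b]; apply: (@perm_inj _ s^-1%g).
  by apply: tinj; rewrite a b.
by apply/forallP => k; rewrite /= !ffunE; exact: tlt.
Qed.

Lemma tableau_actM s s' t : tableau_act s (tableau_act s' t) = tableau_act (s' * s)%g t.
Proof.
congr pair; first exact: (sactM s s' (t.1 : W)).
by apply/ffunP => k; rewrite !ffunE invMg permM.
Qed.

Lemma tableau_act1 t : tableau_act 1%g t = t.
Proof.
case: t => w c; rewrite /tableau_act (sact1 (w : W)); congr pair.
by apply/ffunP => k; rewrite ffunE invg1 perm1.
Qed.

Lemma tableau_actK s : cancel (tableau_act s) (tableau_act s^-1%g).
Proof. by move=> t; rewrite tableau_actM mulgV tableau_act1. Qed.

Lemma colgrp_tableau_act s t (r : 'S_d) : colgrp (tableau_act s t) (r ^ s)%g = colgrp t r.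
Proof.
apply/colgrpP/colgrpP => H k.
  by have := H (s k); rewrite /= !ffunE conjgE !permM !permK.
by rewrite /= !ffunE conjgE !permM permK H.
Qed.

Lemma polytabloid_tableau_act s t : e (tableau_act s t) = pact s (e t).
Proof.
apply/ffunP => x; rewrite polytabloidE [RHS]ffunE polytabloidE /antisym.
rewrite (reindex_inj (conjg_inj s)); apply: eq_big => r; first exact: colgrp_tableau_act.
move=> _; rewrite conjgE !odd_permM odd_permV addbCA addbb addbF.
congr (_ * (nat_of_bool _)%:R); rewrite (sactM (s^-1 * (r * s))%g s (t.1 : W)) mulKVg.
rewrite -(sactM s r (t.1 : W)).
by apply/eqP/eqP => [->|<-]; rewrite ?(sactK s) ?(sactKV s).
Qed.

Lemma tableau_transitive t t' : is_tableau t -> is_tableau t' -> exists s, t' = tableau_act s t.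
Proof.
move=> tt tt'.
have [s sE] : exists s : 'S_d, forall k, (val t.1 k, t.2 k) = (val t'.1 (s k), t'.2 (s k)).
  apply: (@perm_of_fibres _ _ (fun k => (val t.1 k, t.2 k)) (fun k => (val t'.1 k, t'.2 k))).
  by case=> i c; apply: etrans (tableau_card i c tt) (esym (tableau_card i c tt')).
exists s; case: t t' sE {tt tt'} => w c [w' c'] /= sE; congr pair.
  apply: word_eqP => k; rewrite (sact_val s (w : W)).
  by case: (sE (s^-1%g k)) => -> _; rewrite permKV.
by apply/ffunP => k; rewrite ffunE; case: (sE (s^-1%g k)) => _ ->; rewrite permKV.
Qed.

Lemma polytabloid_colgrp s t : colgrp t s -> pact s (e t) = ((-1) ^+ s : rat) *: e t.
Proof.
move=> ts; apply/ffunP => x; rewrite ffunE polytabloidE [RHS]ffunE polytabloidE.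
rewrite -[RHS]/(_ * _) /antisym mulr_sumr (reindex_inj (mulIg s^-1%g)).
rewrite (eq_bigl (colgrp t)) => [|r]; last first.
  apply/idP/idP => [H|H]; last by apply: colgrpM => //; exact: colgrpV.
  by rewrite -(mulgKV s r); apply: colgrpM.
apply: eq_bigr => r _; rewrite odd_permM odd_permV signr_addb [_ * (-1) ^+ s]mulrC mulrA.
congr (_ * (nat_of_bool _)%:R); rewrite -(sactM s^-1%g r (t.1 : W)).
by apply/eqP/eqP => [E|->//]; rewrite -(sactKV s (x : W)) E (sactKV s).
Qed.

Lemma polytabloid_id t : is_tableau t -> e t t.1 = 1.
Proof.
move=> tt; rewrite polytabloidE -[X in antisym _ _ X](sact1 (t.1 : W)).
rewrite antisym_orbit ?odd_perm1 //; apply/colgrpP => k; by rewrite perm1.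
Qed.

Lemma polytabloid_scale t (a b : rat) : is_tableau t -> a *: e t = b *: e t -> a = b.
Proof.
move=> tt /ffunP/(_ t.1); rewrite !ffunE; have := polytabloid_id tt; rewrite ffunE => ->.
by rewrite -[LHS]/(_ * 1) -[RHS]/(_ * 1) !mulr1.
Qed.

Lemma polytabloid_in t : is_tableau t -> e t \in Sp.
Proof. by move=> tt; apply: memv_span; apply: map_f; rewrite mem_enum. Qed.

Lemma specht_ind (P : Q -> Prop) :
  P 0 -> (forall c u v, P u -> P v -> P (c *: u + v)) ->
  (forall t, is_tableau t -> P (e t)) -> forall u, u \in Sp -> P u.
Proof.
move=> P0 PL Pe; apply: span_ind => // _ /mapP[t + ->]; rewrite mem_enum; exact: Pe.
Qed.

Lemma specht_perp (x : Q) : x \in Sp -> (forall t, is_tableau t -> ip x (e t) = 0) -> x = 0.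
Proof.
move=> xS H; apply: ip_eq0; apply: (specht_ind (P := fun v => ip x v = 0)) xS => //.
  exact: ip0r.
by move=> c u v uE vE; rewrite ipDr uE vE mulr0 addr0.
Qed.

(** The column antisymmetriser of [t] multiplies [e_t] by a nonzero number and
    maps everything to multiples of [e_t], so an equivariant map sends [e_t] to
    a multiple of itself; as tableaux are conjugate, the factor is the same for
    all of them. *)
Lemma specht_equivariant_scalar (f : subvs_of Sp -> Q) : linear f ->
  (forall s x y, vsval y = pact s (vsval x) -> f y = pact s (f x)) ->
  exists a : rat, forall x, f x = a *: vsval x.
Proof.
move=> fl fe.
have f0 : f 0 = 0 := linear_at0 fl.
have scal t : is_tableau t -> exists a : rat, f (vsproj Sp (e t)) = a *: e t.
  move=> tt; set x := vsproj Sp (e t).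
  have xE : vsval x = e t by rewrite vsprojK ?polytabloid_in.
  have fs s : colgrp t s -> f x = ((-1) ^+ s : rat) *: pact s (f x).
    move=> ts; rewrite -(fe s x (((-1) ^+ s : rat) *: x)); last first.
      by rewrite linearZ /= xE polytabloid_colgrp.
    have := fl ((-1) ^+ s : rat) x 0; rewrite f0 !addr0 => ->.
    by rewrite scalerA -expr2 sqrr_sign scale1r.
  have := colsum_polytabloid part (f x) tt.
  rewrite /colsum (eq_bigr (fun=> f x)) => [|s ts]; last by rewrite -fs.
  rewrite sumr_const => E; set n := #|_| in E.
  have n0 : (n%:R : rat) != 0.
    rewrite pnatr_eq0 -lt0n; apply/card_gt0P; exists 1%g.
    by apply/colgrpP => k; rewrite perm1.
  exists (n%:R^-1 * ip (f x) (e t)); rewrite -scalerA -E -scaler_nat scalerA mulVf // scale1r //.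
have [[t0 tt0]|nt] := pselect (exists t, is_tableau t); last first.
  exists 0 => x; rewrite scale0r.
  suff -> : x = 0 by rewrite f0.
  apply: val_inj; rewrite linear0 /=; apply: (specht_ind (P := fun v => v = 0)) (subvsP x) => //.
    by move=> c u v -> ->; rewrite scaler0 addr0.
  by move=> t tt; case: nt; exists t.
have [a aE] := scal _ tt0; exists a.
have at_ t : is_tableau t -> f (vsproj Sp (e t)) = a *: e t.
  move=> tt; have [s sE] := tableau_transitive tt0 tt.
  rewrite (fe s (vsproj Sp (e t0))) ?aE ?sE ?polytabloid_tableau_act.
    by rewrite -[a *: e t0]addr0 pact_lin; apply/ffunP => x; rewrite !ffunE addr0.
  by rewrite !vsprojK -?polytabloid_tableau_act -?sE ?polytabloid_in.
suff H (u : Q) : u \in Sp -> u \in Sp /\ f (vsproj Sp u) = a *: u.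
  by move=> x; rewrite -[in LHS](vsvalK x); have [] := H _ (subvsP x).
apply: (specht_ind (P := fun u => u \in Sp /\ f (vsproj Sp u) = a *: u))
  => [|c u' v [uS uE] [vS vE]|t tt].
- by rewrite mem0v linear0 f0 scaler0.
- split; first by rewrite memvD // memvZ.
  by rewrite linearP fl uE vE scalerDr !scalerA mulrC.
- by split; [exact: polytabloid_in|exact: at_].
Qed.

Section Endomorphism.
Variable th : Q -> Q.
Hypothesis thl : linear th.
Hypothesis the : forall s u, th (pact s u) = pact s (th u).

Lemma colsum_th t u : colsum t (th u) = th (colsum t u).
Proof.
rewrite /colsum (linear_sum0 _ _ _ thl); apply: eq_bigr => s _.
by rewrite -the; have := thl ((-1) ^+ s : rat) (pact s u) 0; rewrite (linear_at0 thl) !addr0.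
Qed.

(** By adjunction through the column antisymmetriser, the scalar by which an
    equivariant map acts on the Specht module is also that by which it acts on
    the quotient of the permutation module by the complement of the Specht
    module. *)
Lemma endo_scalar : exists a : rat, (forall x, x \in Sp -> th x = a *: x) /\
  forall t, is_tableau t -> forall u, ip (th u) (e t) = a * ip u (e t).
Proof.
have [|s x y ->|a aE] := @specht_equivariant_scalar (fun x => th (vsval x)).
- by move=> c x y; rewrite linearP /= thl.
- exact: the.
have aS x : x \in Sp -> th x = a *: x.
  by move=> xS; have := aE (vsproj Sp x); rewrite vsprojK.
exists a; split=> // t tt u; apply: (@polytabloid_scale t) => //.
rewrite -colsum_polytabloid // colsum_th colsum_polytabloid //.
have := thl (ip u (e t)) (e t) 0; rewrite (linear_at0 thl) !addr0 => ->.
by rewrite aS ?polytabloid_in // scalerA mulrC.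
Qed.
End Endomorphism.

Section IotaPi.
Variables (iota : slin (specht m d al) (Mmod m d al)) (pi : slin (Mmod m d al) (specht m d al)).

Lemma iota_scalar : equivariant iota -> iota != 0 ->
  exists2 a : rat, a != 0 & forall x, vsval (iota x) = a *: vsval x.
Proof.
move=> ie i0.
have [|s x y E|a aE] := @specht_equivariant_scalar (fun x => vsval (iota x)).
- by move=> c x y; rewrite !linearP.
- exact: ie.
exists a => //; apply: contraNneq i0 => a0; apply/eqP/lfunP => x.
by apply: subvs_inj; rewrite zero_lfunE linear0 aE a0 scale0r.
Qed.

Definition pi_fun (u : Q) : Q := vsval (pi (vsproj fullv u)).

Lemma pi_fun_linear : linear pi_fun.
Proof. by move=> c u v; rewrite /pi_fun !linearP. Qed.

Lemma pi_fun_in u : pi_fun u \in Sp. Proof. exact: subvsP. Qed.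

Lemma pi_scalar : equivariant pi -> pi != 0 ->
  exists2 c : rat, c != 0 & (forall x, x \in Sp -> pi_fun x = c *: x) /\
    forall t, is_tableau t -> forall u, ip (pi_fun u) (e t) = c * ip u (e t).
Proof.
move=> pe p0.
have pfe s u : pi_fun (pact s u) = pact s (pi_fun u).
  by apply: pe; rewrite !vsprojK ?memvf.
have [c [cS cE]] := endo_scalar pi_fun_linear pfe; exists c => //.
apply: contraNneq p0 => c0; apply/eqP/lfunP => u.
apply: subvs_inj; rewrite zero_lfunE linear0 -(vsvalK u).
apply: specht_perp; first exact: subvsP.
by move=> t tt; have := cE t tt (vsval u); rewrite c0 mul0r.
Qed.

(** The kernel of [pi] is the complement of the Specht module, so only the
    action on the quotient matters. *)
Lemma pi_endo (th : Q -> Q) a : equivariant pi -> pi != 0 ->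
  (forall t, is_tableau t -> forall u, ip (th u) (e t) = a * ip u (e t)) ->
  forall u, pi_fun (th u) = a *: pi_fun u.
Proof.
move=> pe p0 tha u; have [c c0 [_ cE]] := pi_scalar pe p0.
apply/eqP; rewrite -subr_eq0 addrC -scaleNr; apply/eqP/specht_perp.
  by rewrite memvD ?memvZ ?pi_fun_in.
by move=> t tt; rewrite ipDl !cE // tha // mulNr mulrCA addNr.
Qed.
End IotaPi.

(** This equivariant map has image in the Specht module and is positive on it,
    so up to a scalar it is the orthogonal projection. *)
Definition spproj_raw (u : Q) : Q := \sum_(t : tab | is_tableau t) (ip u (e t) : rat) *: e t.

Lemma specht_projection : exists P : Q -> Q, [/\ linear P,
  forall s u, P (pact s u) = pact s (P u), forall u, P u \in Sp & forall x, x \in Sp -> P x = x].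
Proof.
have Pl : linear spproj_raw.
  move=> c u v; rewrite /spproj_raw scaler_sumr -big_split /=; apply: eq_bigr => t _.
  by rewrite ipDl scalerDl scalerA.
have Pe s u : spproj_raw (pact s u) = pact s (spproj_raw u).
  rewrite /spproj_raw (linear_sum0 _ _ _ (pact_lin s)).
  rewrite (reindex_inj (can_inj (tableau_actK s))) /=.
  rewrite (eq_bigl (fun t => is_tableau t)) => [|t]; last first.
    by apply/idP/idP => [/(tableau_act_tableau s^-1%g)|/(tableau_act_tableau s)//]; rewrite tableau_actK.
  apply: eq_bigr => t _; rewrite polytabloid_tableau_act ip_pact.
  by rewrite -[in RHS](addr0 (_ *: e t)) pact_lin; apply/ffunP => x; rewrite !ffunE addr0.
have PS u : spproj_raw u \in Sp.
  by apply: memv_suml => t tt; rewrite memvZ ?polytabloid_in.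
have [a [aS _]] := endo_scalar Pl Pe.
exists (fun u => a^-1 *: spproj_raw u); split.
- by move=> c u v; rewrite Pl scalerDr !scalerA mulrC.
- move=> s u; rewrite Pe; apply/ffunP => x; by rewrite !ffunE.
- by move=> u; rewrite memvZ ?PS.
move=> x xS; rewrite aS // scalerA; have [a0|a0] := eqVneq a 0; last by rewrite mulVf // scale1r.
rewrite a0 mulr0 scale0r; apply/esym/specht_perp => // t tt.
have : ip (spproj_raw x) x = 0 by rewrite aS // a0 scale0r /ip big1 // => w _; rewrite ffunE mul0r.
rewrite /spproj_raw.
have ips (F : tab -> Q) (c : tab -> rat) :
    ip (\sum_(t | is_tableau t) c t *: F t) x = \sum_(t | is_tableau t) c t * ip (F t) x.
  have L : linear (fun u : Q => ip u x : rat^o) by move=> k u v; rewrite ipDl.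
  rewrite (linear_sum0 _ _ _ L); apply: eq_bigr => t' _.
  by have := L (c t') (F t') 0; rewrite (linear_at0 L) !addr0.
have ipC (u v : Q) : ip u v = ip v u by rewrite /ip; apply: eq_bigr => w _; rewrite mulrC.
rewrite ips => /eqP; rewrite psumr_eq0 => [/allP/(_ t)|t' _]; last by rewrite [ip (e t') x]ipC sqr_ge0.
by rewrite mem_index_enum tt [ip (e t) x]ipC mulf_eq0 orbb => /(_ isT)/eqP.
Qed.
End SpechtModule.

(** * Signed sums over column groups as products of minors *)

Section Determinants.
Variable R : comNzRingType.

Lemma det_mxsub_perm n (s : 'S_n) (M : 'M[R]_n) : \det (\matrix_(i, j) M (s i) (s j)) = \det M.
Proof.
have -> : \matrix_(i, j) M (s i) (s j) = row_perm s (col_perm s M).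
  by apply/matrixP => i j; rewrite !mxE.
rewrite row_permE col_permE !det_mulmx !det_perm odd_permV mulrCA.
by rewrite -expr2 sqrr_sign mulr1.
Qed.

(** Expand along the rows outside the range of [f], which are rows of the
    identity, until [f] becomes a permutation. *)
Lemma det_restrict n r (f : 'I_r -> 'I_n) (M : 'M[R]_n) : injective f ->
  (forall k k', (forall i, f i != k) -> M k k' = (k == k')%:R) ->
  \det M = \det (\matrix_(i, j) M (f i) (f j)).
Proof.
elim: n f M => [|n IH] f M finj H.
  case: r f finj H => [|r] f _ _; last by case: (f ord0).
  by rewrite !det_mx00.
have [[k0 k0f]|all] := pselect (exists k0, forall i, f i != k0).
  have fL i : exists j, f i = lift k0 j.
    by case: (unliftP k0 (f i)) (k0f i) => [j ->|->]; [exists j|rewrite eqxx].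
  have /choice[f' fE] := fL.
  rewrite (expand_det_row M k0) (bigD1 k0) //= big1 => [|k kk]; last first.
    by rewrite H // eq_sym (negbTE kk) mul0r.
  rewrite H // eqxx mul1r addr0 /cofactor -signr_odd addnn odd_double mul1r.
  rewrite (IH f') => [|i j ij|k k' kf].
  - by congr (\det _); apply/matrixP => i j; rewrite !mxE !fE.
  - by apply: finj; rewrite !fE ij.
  - by rewrite !mxE H ?(inj_eq lift_inj) // => i; rewrite fE (inj_eq lift_inj).
have surj k : exists i, f i = k.
  apply: contrapT => nk; apply: all; exists k => i; apply/eqP => fik; apply: nk; by exists i.
have rn : r = n.+1.
  apply/eqP; rewrite eqn_leq; apply/andP; split.
    by have := leq_card f finj; rewrite !card_ord.
  have /choice[g gK] := surj.
  have := leq_card g (can_inj gK); by rewrite !card_ord.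
move: f finj H all surj; rewrite rn => f finj _ _ _.
by rewrite -(det_mxsub_perm (perm finj)); congr (\det _); apply/matrixP => i j; rewrite !mxE !permE.
Qed.

Variables (T : finType) (n : nat) (c : 'I_n -> T) (M : 'M[R]_n).
Hypothesis blockM : forall k k', c k != c k' -> M k k' = 0.

(** [M] with the blocks outside [S] replaced by identity matrices: [M] is the
    product of the matrices in which only one block is kept. *)
Definition masked (S : pred T) : 'M[R]_n :=
  \matrix_(k, k') if S (c k) then M k k' else (k == k')%:R.

Lemma masked_cons x (S : seq T) : x \notin S ->
  masked (mem (x :: S)) = masked (pred1 x) *m masked (mem S).
Proof.
move=> xS; apply/matrixP => k k'; rewrite !mxE.
under eq_bigr do rewrite !mxE /=.
have [ckx|ckx] := eqVneq (c k) x; last first.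
  rewrite (bigD1 k) //= eqxx mul1r big1 ?addr0 => [|j jk]; last first.
    by rewrite eq_sym (negbTE jk) mul0r.
  by rewrite !inE (negbTE ckx).
rewrite ckx (_ : mem (x :: S) x = true); last exact: mem_head.
rewrite /= (bigD1 k') //= big1 ?addr0 => [|j jk].
  have [ck'|ck'] := eqVneq (c k') x; first by rewrite ck' (negbTE xS) eqxx mulr1.
  by rewrite blockM ?mul0r // ckx eq_sym.
have [cj|cj] := eqVneq (c j) x; last by rewrite blockM ?mul0r // ckx eq_sym.
by rewrite cj (negbTE xS) (negbTE jk) mulr0.
Qed.

Lemma det_blocks : \det M = \prod_x \det (masked (pred1 x)).
Proof.
have -> : M = masked (mem (enum T)).
  by apply/matrixP => k k'; rewrite mxE /= mem_enum.
rewrite -[RHS]big_enum /=; elim: (enum T) (enum_uniq T) => [|x S IH] /=.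
  rewrite big_nil => _; rewrite (_ : masked _ = 1%:M) ?det1 //.
  by apply/matrixP => k k'; rewrite !mxE.
by move=> /andP[xS uS]; rewrite big_cons -IH // -det_mulmx masked_cons.
Qed.
End Determinants.

Section ColumnDeterminants.
Variables (l : nat) (m : l.-tuple nat) (d : nat) (al : Tseq l).
Hypothesis part : is_partition (phi m al).
Local Notation word := (word m d al).
Local Notation tab := (word * {ffun 'I_d -> 'I_d})%type.
Variables (R : comNzRingType) (y : nat -> nat -> R).

Definition minor r : R := \det (\matrix_(i < r, j < r) y i j).

Let ph i : nat := absz (phi m al i).

Let phE i : (ph i)%:Z = phi m al i.
Proof. by rewrite gez0_abs //; case: part => + _; apply. Qed.

Let ph_mono i j : (i <= j)%N -> (ph j <= ph i)%N.
Proof. by move=> ij; rewrite -lez_nat !phE; case: part => _; apply. Qed.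

Let ph_out i : (tsz al <= i)%N -> ph i = 0%N.
Proof.
move=> ai; rewrite /ph /phi shift_ge; last exact: leq_trans (tsz_ge al) ai.
by rewrite nth_default ?size_tuple.
Qed.

Variables (t : tab) (tt : is_tableau t).

Let colmx : 'M[R]_d := \matrix_(k, k') if t.2 k == t.2 k' then y (val t.1 k) (val t.1 k') else 0.

Lemma det_colmx : \det colmx =
  \sum_(s : 'S_d | colgrp t s) (-1) ^+ s * \prod_k y (val t.1 k) (val t.1 (s k)).
Proof.
rewrite /determinant (bigID (colgrp t)) /= [X in _ + X]big1 ?addr0 => [|s].
  apply: eq_bigr => s /colgrpP ts; congr (_ * _); apply: eq_bigr => k _.
  by rewrite mxE ts eqxx.
rewrite /colgrp negb_forall => /existsP[k tk].
by rewrite (bigD1 k) //= mxE eq_sym (negbTE tk) mul0r mulr0.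
Qed.

Let height (c : nat) : nat := #|[set i : 'I_(tsz al) | (c < ph i)%N]|.

(** As [phi] is nonincreasing, the rows that meet a column are an initial
    segment. *)
Let heightP c i : (i < height c)%N = (c < ph i)%N.
Proof.
have initial (n : nat) (P : nat -> bool) : (forall i j, (i <= j)%N -> P j -> P i) ->
    (forall j, (n <= j)%N -> P j = false) ->
    forall i, (i < #|[set i : 'I_n | P i]|)%N = P i.
  elim: n P => [|n IH] P mono out j.
    rewrite out // (_ : #|_| = 0%N) //; apply: eq_card0 => -[] //.
  have E : #|[set i : 'I_n.+1 | P i]| = (P 0%N + #|[set i : 'I_n | P i.+1]|)%N.
    rewrite -!sum1dep_card !big_mkcond /= big_ord_recl /=; congr (_ + _)%N.
    by rewrite [RHS]big_mkcond.
  case: j => [|j]; rewrite E.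
    case P0 : (P 0%N) => //=; rewrite add0n; apply/negbTE; rewrite -eqn0Ngt; apply/eqP/eq_card0.
    by move=> a; rewrite inE; apply: contraFF P0; apply: mono.
  rewrite -(IH (fun i => P i.+1)) => [|a k ik|k nk]; first last.
  - by rewrite out.
  - exact: mono.
  case P0 : (P 0%N); first by rewrite add1n ltnS.
  rewrite add0n (_ : #|_| = 0%N) //; apply/eq_card0 => a.
  by rewrite inE; apply: contraFF P0; apply: mono.
apply: (initial _ (fun i => (c < ph i)%N)) => [a b ab|b nb]; last by rewrite ph_out.
by move=> cb; apply: leq_trans (ph_mono ab).
Qed.

Lemma det_column (c : 'I_d) : \det (masked t.2 colmx (pred1 c)) = minor (height c).
Proof.
have hN (i : 'I_(height c)) : (i < tsz al)%N.
  rewrite ltnNge; apply/negP => /ph_out p0.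
  by have := ltn_ord i; rewrite heightP p0.
have fex (i : 'I_(height c)) : exists k, val t.1 k = i :> nat /\ t.2 k = c.
  have := tableau_card (Ordinal (hN i)) c tt; rewrite -phE /= ltz_nat -heightP ltn_ord /=.
  move=> E; have /card_gt0P[k] : (0 < #|[pred k | (val t.1 k == Ordinal (hN i)) && (t.2 k == c)]|)%N.
    by rewrite E.
  by rewrite unfold_in /= => /andP[/eqP a /eqP b]; exists k; rewrite a b.
have /choice[f fE] := fex.
have finj : injective f.
  by move=> i j ij; apply: val_inj; rewrite /= -(fE i).1 -(fE j).1 ij.
rewrite (det_restrict finj) => [|k k' kf].
  congr (\det _); apply/matrixP => i j; rewrite !mxE.
  by rewrite (fE i).2 (fE j).2 /= !eqxx (fE i).1 (fE j).1.
rewrite mxE /=; case: eqP => // ckc.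
have := tt => /andP[/injectiveP tinj /forallP/(_ k)]; rewrite ckc -phE ltz_nat -heightP => ik.
have [a b] := fE (Ordinal ik); have := kf (Ordinal ik).
have -> : f (Ordinal ik) = k by apply: tinj; rewrite b ckc; congr pair; apply: val_inj.
by rewrite eqxx.
Qed.

Let card_segment a b : (a <= b <= d)%N -> #|[pred c : 'I_d | (a <= c < b)%N]| = (b - a)%N.
Proof.
move=> /andP[ab bd]; rewrite -sum1_card.
rewrite (eq_bigl (fun c : 'I_d => (a <= c < b)%N)) //.
rewrite -(big_mkord (fun c => (a <= c < b)%N) (fun=> 1%N)).
rewrite (big_cat_nat (n := b)) //= [X in (_ + X)%N]big_nat_cond [X in (_ + X)%N]big1 ?addn0; last first.
  by move=> i /andP[/andP[bi _] /andP[_ ib]]; rewrite ltnNge bi in ib.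
rewrite (big_cat_nat (n := a)) //= [X in (X + _)%N]big_nat_cond [X in (X + _)%N]big1 ?add0n; last first.
  by move=> i /andP[/andP[_ ia] /andP[ai _]]; rewrite ltnNge ai in ia.
rewrite big_nat_cond (eq_bigl (fun i => (a <= i < b)%N && true)) => [|i]; last first.
  by case: (a <= i < b)%N.
by rewrite -big_nat_cond sum_nat_const_nat muln1.
Qed.

Let ph_le_d (i : 'I_(tsz al)) : (ph i <= d)%N.
Proof.
rewrite -lez_nat phE -(word_card t.1 i) lez_nat.
by apply: leq_trans (max_card _) _; rewrite card_ord.
Qed.

(** The sum is the determinant of the matrix [colmx], which has one block for
    each column. As the rows of the tableau that meet a column are an initial
    segment, the block of a column of height [h] is a leading [h x h] minor; and
    the columns of height [r + 1] are those between the ends of the rows of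
    index [r + 1] and [r]. *)
Theorem column_sum_minors :
  \sum_(s : 'S_d | colgrp t s) (-1) ^+ s * \prod_k y (val t.1 k) (val t.1 (s k)) =
  \prod_(r < tsz al) minor r.+1 ^+ (ph r - ph r.+1).
Proof.
rewrite -det_colmx (det_blocks (c := t.2)) => [|k k' kk]; last by rewrite mxE (negbTE kk).
under eq_bigr do rewrite det_column.
transitivity (\prod_(c < d) \prod_(r < tsz al)
    (if (ph r.+1 <= c < ph r)%N then minor r.+1 else 1)); last first.
  rewrite exchange_big /=; apply: eq_bigr => r _.
  rewrite -big_mkcond /= prodr_const card_segment //.
  by rewrite ph_mono //= ph_le_d.
apply: eq_bigr => c _; case hc : (height c) => [|h].
  rewrite big1 => [|r _]; first by rewrite /minor det_mx00.
  by rewrite -heightP hc andbF.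
have hN : (h < tsz al)%N.
  rewrite ltnNge; apply/negP => /ph_out p0.
  by have := heightP c h; rewrite hc ltnSn p0.
rewrite (bigD1 (Ordinal hN)) //= leqNgt -!heightP hc ltnn ltnSn /=.
rewrite big1 ?mulr1 // => r rh; rewrite leqNgt -!heightP hc -leqNgt !ltnS.
by rewrite -eqn_leq eq_sym; case: eqP => // hr; case/eqP: rh; apply: val_inj.
Qed.
End ColumnDeterminants.

(** * The values of the character HS *)

Section WeightFiltration.
Variables (N : nat) (R : comNzRingType).
Local Notation P := (mpoly (N * N) R).

(** The terms of the expansion about the diagonal tend to zero for the
    filtration by this degree, which is why the truncation of the binomial series
    in [hs_expansion] does not change the coefficients. *)
Definition offdeg (m : 'X_{1..N * N}) : nat :=
  (\sum_(x | cell_row x != cell_col x) m x)%N.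

Definition off_ge (a : nat) (p : P) : Prop := forall m, (offdeg m < a)%N -> p@_m = 0.

Lemma offdegD m m' : offdeg (m + m')%MM = (offdeg m + offdeg m')%N.
Proof. by rewrite /offdeg -big_split; apply: eq_bigr => x _; rewrite mnmDE. Qed.

Lemma off_ge0 p : off_ge 0 p. Proof. by []. Qed.

Lemma off_ge_le a b p : (a <= b)%N -> off_ge b p -> off_ge a p.
Proof. by move=> ab pb m ma; apply: pb; apply: leq_trans ab. Qed.

Lemma off_ge_zero a : off_ge a 0. Proof. by move=> m _; rewrite mcoeff0. Qed.

Lemma off_geD a p q : off_ge a p -> off_ge a q -> off_ge a (p + q).
Proof. by move=> pa qa m ma; rewrite mcoeffD pa // qa // addr0. Qed.

Lemma off_geZ a c p : off_ge a p -> off_ge a (c *: p).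
Proof. by move=> pa m ma; rewrite mcoeffZ pa // mulr0. Qed.

Lemma off_geM a b p q : off_ge a p -> off_ge b q -> off_ge (a + b) (p * q).
Proof.
move=> pa qb m; rewrite mcoeffM => mab; apply: big1 => -[k1 k2] /= /eqP mE.
have := congr1 offdeg mE; rewrite offdegD => oE; rewrite oE in mab.
have [k1a|ak1] := ltnP (offdeg k1) a; first by rewrite pa // mul0r.
by rewrite qb ?mulr0 // -(ltn_add2l a); apply: leq_ltn_trans mab; rewrite leq_add2r.
Qed.

Lemma off_geX a p n : off_ge a p -> off_ge (a * n) (p ^+ n).
Proof.
move=> pa; elim: n => [|n IH]; first by rewrite muln0; exact: off_ge0.
by rewrite exprS mulnS; apply: off_geM.
Qed.

Lemma off_ge_sum a I (s : seq I) (Pr : pred I) (f : I -> P) :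
  (forall i, Pr i -> off_ge a (f i)) -> off_ge a (\sum_(i <- s | Pr i) f i).
Proof. by move=> H; elim/big_ind: _ => //; [exact: off_ge_zero|exact: off_geD]. Qed.

Lemma off_ge_prod_congr a I (s : seq I) (f g : I -> P) :
  (forall i, off_ge a (f i - g i)) ->
  off_ge a (\prod_(i <- s) f i - \prod_(i <- s) g i).
Proof.
move=> H; elim: s => [|i s IH]; first by rewrite !big_nil subrr; exact: off_ge_zero.
rewrite !big_cons; set p := \prod_(_ <- _) _; set q := \prod_(_ <- _) _.
have -> : f i * p - g i * q = (f i - g i) * p + g i * (p - q) by ring.
apply: off_geD; first by rewrite -[a]addn0; apply: off_geM; [exact: H|exact: off_ge0].
by rewrite -[a]add0n; apply: off_geM; [exact: off_ge0|exact: IH].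
Qed.

(** For a natural exponent the binomial series of [(1 + z) ^ c] is a finite sum,
    and its terms of index greater than [K] have off-diagonal degree greater than
    [K]. *)
Lemma binomial_truncation (z : P) K c : off_ge 1 z ->
  off_ge K.+1 (\sum_(k < K.+1) ('C(c, k))%:R *: z ^+ k - (z + 1) ^+ c).
Proof.
move=> z1; pose f k : P := ('C(c, k))%:R *: z ^+ k.
have -> : (z + 1) ^+ c = \sum_(k < K.+1 + c.+1) f k.
  rewrite exprD1n addnC big_split_ord /= [X in _ = _ + X]big1 ?addr0 => [|k _].
    by apply: eq_bigr => k _; rewrite /f scaler_nat.
  by rewrite /f bin_small ?scale0r // addSn ltnS leq_addr.
rewrite big_split_ord /= opprD addrA subrr add0r -sumrN.
apply: off_ge_sum => k _; rewrite -scaleNr; apply: off_geZ.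
apply: (@off_ge_le _ (1 * (K.+1 + k))%N); last exact: off_geX.
by rewrite mul1n leq_addr.
Qed.

(** The variables [x_ij / x_ii] of the expansion about the diagonal, with
    [x_ii^-1] as a variable of its own, and zero outside the range. *)
Definition redvar (i j : nat) : P :=
  if i == j then 1 else
    if (insub i : option 'I_N) is Some i' then
      if (insub j : option 'I_N) is Some j' then 'X_(cell i' j') * 'X_(cell i' i') else 0
    else 0.

Lemma redvarE (i j : 'I_N) : redvar i j = if i == j then 1 else 'X_(cell i j) * 'X_(cell i i).
Proof.
rewrite /redvar -(inj_eq val_inj) /=; case: eqP => // _.
rewrite !insubT //= => *; by congr ('X_(cell _ _) * 'X_(cell _ _)); apply: val_inj.
Qed.

Lemma redvar_off i j : i != j -> off_ge 1 (redvar i j).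
Proof.
rewrite /redvar => /negbTE ij; rewrite ij; case: insubP => [i' _ iE|_]; last exact: off_ge_zero.
case: insubP => [j' _ jE|_]; last exact: off_ge_zero.
rewrite -[1%N]addn0; apply: off_geM; last exact: off_ge0.
move=> m; rewrite ltnS leqn0 => /eqP m0; rewrite mcoeffX; case: eqP => // mE.
move: m0; rewrite -mE /offdeg (bigD1 (cell i' j')) /=; first by rewrite mnm1E eqxx.
by rewrite cell_rowK cell_colK -(inj_eq val_inj) iE jE ij.
Qed.

Lemma minor_redvar r : off_ge 1 (minor redvar r - 1).
Proof.
rewrite /minor /determinant (bigD1 1%g) //= odd_perm1 expr0 mul1r.
rewrite [X in X + _ - 1]big1 => [|i _]; last by rewrite mxE perm1 /redvar eqxx.
rewrite addrAC subrr add0r; apply: off_ge_sum => s s1.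
have [i si] : exists i, s i != i.
  apply: contrapT => H; case/eqP: s1; apply/permP => i; rewrite perm1.
  by apply/eqP; apply: contrapT => /negP si; apply: H; exists i.
rewrite (bigD1 i) //= mulrCA -[1%N]addn0; apply: off_geM; last exact: off_ge0.
by rewrite mxE; apply: redvar_off; rewrite (inj_eq val_inj) eq_sym.
Qed.
End WeightFiltration.

Section CharacterValue.
Variables (l : nat) (mu : l.-tuple nat) (d : nat) (al : Tseq l).
Hypothesis part : is_partition (phi mu al).
Local Notation N := (tsz al).
Local Notation ev := (eval_mu mu).
Local Notation word := (word mu d al).
Local Notation tab := (word * {ffun 'I_d -> 'I_d})%type.
Local Notation P := (mpoly (N * N) rat).

Lemma map_Delta_red r (rN : (r <= N)%N) :
  map_mpoly ev (Delta_red rN) = minor (@redvar N rat) r.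
Proof.
rewrite /Delta_red -det_map_mx /minor; congr (\det _); apply/matrixP => i j; rewrite !mxE.
have := redvarE rat (widen_ord rN i) (widen_ord rN j); rewrite -(inj_eq val_inj) /= => ->.
rewrite -(inj_eq val_inj) /=; case: eqP => _; first exact: rmorph1.
by rewrite rmorphM /= !map_mpolyX.
Qed.

Let ph i : nat := absz (phi mu al i).
Let phE i : (ph i)%:Z = phi mu al i.
Proof. by rewrite gez0_abs //; case: part => + _; apply. Qed.

Lemma eval_alpha i : ev (alpha al i) = (ph i)%:R.
Proof.
rewrite /alpha rmorphD /= rmorph_int.
have -> : ev (lam_vars l)`_i = (nth 0%N mu i)%:R.
  have [il|li] := ltnP i l; first exact: eval_lam_vars.
  by rewrite !nth_default ?size_tuple ?rmorph0.
transitivity ((phi mu al i)%:~R : rat); last by rewrite -phE.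
by rewrite /phi rmorphD.
Qed.

Lemma eval_binp r k : (ph r.+1 <= ph r)%N ->
  ev (binp (alpha al r - alpha al r.+1) k) = ('C(ph r - ph r.+1, k))%:R.
Proof.
move=> le; rewrite /binp eval_muZ.
rewrite (@eval_fallp_nat _ _ _ _ (ph r - ph r.+1)); last first.
  by rewrite rmorphB /= !eval_alpha natrB.
by rewrite -bin_ffact natrM mulrCA mulVf ?mulr1 // pnatr_eq0 -lt0n fact_gt0.
Qed.

Lemma hs_diag_ge0 (q : Tmat al al) (i : 'I_N) : 0 <= al`_i - val q i i.
Proof.
rewrite -(tmat_row q i) (bigD1 i) //= addrAC subrr add0r; apply: sumr_ge0 => j ji.
by apply: tmat_ge0; apply: contra ji => /andP[/eqP/val_inj->].
Qed.

Lemma hs_monomE (q : Tmat al al) (i j : 'I_N) : hs_monom q (cell i j) =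
  if i == j then absz (al`_i - val q i i)%R else absz (val q i j).
Proof. by rewrite mnmE cell_rowK cell_colK. Qed.

Lemma offdeg_hs_monom (q : Tmat al al) : offdeg (hs_monom q) = hs_deg q.
Proof.
rewrite /offdeg /hs_deg.
transitivity (\sum_(p : 'I_N * 'I_N | p.1 != p.2) absz (val q p.1 p.2))%N; last first.
  by rewrite pair_big_dep /=; apply: eq_bigl => p; rewrite eq_sym.
rewrite (reindex (fun p : 'I_N * 'I_N => cell p.1 p.2)) /=; last first.
  exists (fun x => (cell_row x, cell_col x)) => [[i j]|x] _ /=.
    by rewrite cell_rowK cell_colK.
  exact: cellK.
apply: eq_big => [[i j]|[i j]] /=; first by rewrite cell_rowK cell_colK.
by rewrite cell_rowK cell_colK => /negbTE ij; rewrite hs_monomE ij.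
Qed.

Lemma eval_hs_coef (q : Tmat al al) :
  ev (hs_coef q) =
  (\prod_(r < N) minor (@redvar N rat) r.+1 ^+ (ph r - ph r.+1))@_(hs_monom q).
Proof.
have ph_mono r : (ph r.+1 <= ph r)%N.
  by rewrite -lez_nat !phE; case: part => _; apply.
rewrite /hs_coef -mcoeff_map_mpoly /hs_expansion rmorph_prod /=.
under eq_bigr => r _.
  rewrite rmorph_sum /=.
  under eq_bigr => k _.
    rewrite map_mpolyZ /= rmorphXn rmorphB /= map_Delta_red rmorph1.
    rewrite eval_binp; last exact: ph_mono.
    over.
  over.
apply/eqP; rewrite -subr_eq0 -mcoeffB; apply/eqP.
apply: (@off_ge_prod_congr _ _ (hs_deg q).+1 _ (index_enum _)) => [r|]; last first.
  by rewrite offdeg_hs_monom.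
rewrite -{2}[minor _ _](subrK 1).
by apply: binomial_truncation; exact: minor_redvar.
Qed.

Section Tableau.
Variables (t : tab) (tt : is_tableau t).

(** The exponent of the contribution of the position [k] to the signed sum over
    the column group, for the matrix of variables [redvar]. *)
Let stepm (s : 'S_d) k : 'X_{1..N * N} :=
  if val t.1 k == val t.1 (s k) then 0%MM
  else (U_(cell (val t.1 k) (val t.1 (s k))) + U_(cell (val t.1 k) (val t.1 k)))%MM.

Lemma prod_redvar (s : 'S_d) :
  \prod_k redvar N rat (val t.1 k) (val t.1 (s k)) = 'X_[(\sum_k stepm s k)%MM].
Proof.
rewrite -mprodXE; apply: eq_bigr => k _; rewrite redvarE /stepm.
by case: ifP; rewrite ?mpolyX0 ?mpolyXD.
Qed.

(** The monomial of [s] records the pairs of letters of the words [t.1] and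
    [s t.1], so that the coefficient of the monomial of [q] picks out the [s] for
    which [xi_q] relates these words. *)
Lemma step_monom (q : Tmat al al) (s : 'S_d) :
  ((\sum_k stepm s k)%MM == hs_monom q) =
  (q == joint_mx (sact s (t.1 : words mu d al)) t.1).
Proof.
set w' := sact s _; pose w := val t.1.
have w'E k : val (w' : word) k = w (s^-1%g k) by exact: sact_val.
have stepE k i j : stepm s k (cell i j) =
    if i == j then ((w k == i) && (w (s k) != i) : nat) else ((w k == i) && (w (s k) == j) : nat).
  rewrite /stepm -/w; have [ww|ww] := eqVneq (w k) (w (s k)).
    rewrite mnm0E -ww; have [_|ij] := eqVneq i j; first by case: eqP.
    by case: eqP => // ->; rewrite (negbTE ij).
  rewrite mnmDE !mnm1E !cell_eqE.
  have [<-|ij] := eqVneq i j.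
    case: (eqVneq (w k) i) ww => [->|_] //; rewrite eq_sym => /negbTE ->.
    by rewrite /= addn1.
  case: (eqVneq (w k) i) => [->|_] //=; by rewrite (negbTE ij) addn0.
have offE i j : i != j -> ((\sum_k stepm s k)%MM (cell i j))%:Z = val (joint_mx (w' : word) t.1) i j.
  move=> ij; rewrite mnm_sumE joint_mxE (inj_eq val_inj) (negbTE ij) subr0; congr Posz.
  rewrite -sum1_card [RHS]big_mkcond [RHS](reindex_inj (@perm_inj _ s)).
  apply: eq_bigr => k _; rewrite stepE (negbTE ij).
  have -> : (s k \in [pred p | (w p == j) && (val (w' : word) p == i)]) =
      (w (s k) == j) && (val (w' : word) (s k) == i) by [].
  by rewrite w'E permK andbC; case: (_ && _).
have diagE i : ((\sum_k stepm s k)%MM (cell i i))%:Z = al`_i - val (joint_mx (w' : word) t.1) i i.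
  rewrite mnm_sumE joint_mxE eqxx mulr1n opprD opprK addrCA.
  rewrite [al`_i + _]addrC -/(phi mu al i) -(word_card t.1 i) addrC.
  apply: (canRL (addrK _)); rewrite -PoszD; congr Posz.
  rewrite -!sum1_card ![in RHS]big_mkcond [X in (_ + X)%N]big_mkcond.
  rewrite [X in (_ + X)%N](reindex_inj (@perm_inj _ s)) -big_split.
  apply: eq_bigr => k _; rewrite stepE eqxx.
  have -> : (s k \in [pred p | (w p == i) && (val (w' : word) p == i)]) =
      (w (s k) == i) && (val (w' : word) (s k) == i) by [].
  have -> : (k \in [pred p | w p == i]) = (w k == i) by [].
  by rewrite w'E permK; case: (w k == i); case: (w (s k) == i).
apply/eqP/eqP => [E|->].
  apply: val_inj; apply/matrixP => i j; have [<-|ij] := eqVneq i j.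
    have := diagE i; rewrite E hs_monomE eqxx gez0_abs ?hs_diag_ge0 //.
    by move=> /addrI/oppr_inj.
  have := offE i j ij; rewrite E hs_monomE (negbTE ij) gez0_abs //.
  by apply: tmat_ge0; rewrite (inj_eq val_inj) (negbTE ij).
apply/mnmP => x; rewrite -(cellK x); set i := cell_row x; set j := cell_col x.
apply/eqP; rewrite -eqz_nat hs_monomE; apply/eqP.
have [<-|ij] := eqVneq i j; first by rewrite diagE gez0_abs ?hs_diag_ge0.
rewrite offE // gez0_abs //.
by apply: tmat_ge0; rewrite (inj_eq val_inj) (negbTE ij).
Qed.

(** For a partition [phi mu al] the product of the powers of the [Delta_r] is
    a product of minors, one for each column of the diagram, hence the signed sum
    of the monomials of the column group. Its coefficients are therefore those of
    the polytabloid, and they are computed by the expansion about the diagonal. *)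
Theorem hs_coef_eval (q : Tmat al al) :
  \sum_(s : 'S_d | colgrp t s) (-1) ^+ s * F_xi q (sact s (t.1 : words mu d al)) t.1 =
  ev (hs_coef q).
Proof.
rewrite eval_hs_coef -(column_sum_minors part _ tt) raddf_sum /=.
apply: eq_bigr => s _; rewrite prod_redvar F_xiE.
have -> : (-1) ^+ s = ((-1) ^+ s : rat)%:MP :> P by rewrite rmorphXn rmorphN1.
by rewrite mcoeffCM mcoeffX step_monom.
Qed.
End Tableau.
End CharacterValue.

(** * Equivariant maps lift *)

Section Equivariance.
Variables (l : nat) (m : l.-tuple nat) (d : nat) (al be : Tseq l).

Lemma joint_mx_sact (s : 'S_d) (w' : word m d be) (w : word m d al) :
  joint_mx (sact s (w' : words m d be) : word m d be) (sact s (w : words m d al)) = joint_mx w' w.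
Proof.
apply: val_inj; apply/matrixP => i j; rewrite !joint_mxE; congr (Posz _ - _).
rewrite -!sum1_card ![LHS]big_mkcond [RHS]big_mkcond [LHS](reindex_inj (@perm_inj _ s)).
apply: eq_bigr => k _.
have -> : (s k \in [pred p | (val (sact s (w : words m d al) : word m d al) p == j) &&
    (val (sact s (w' : words m d be) : word m d be) p == i)]) =
    (val (sact s (w : words m d al) : word m d al) (s k) == j) &&
    (val (sact s (w' : words m d be) : word m d be) (s k) == i) by [].
by rewrite !sact_val permK.
Qed.

Lemma joint_mx_orbit (w1' w2' : word m d be) (w1 w2 : word m d al) : joint_mx w1' w1 = joint_mx w2' w2 ->
  exists s : 'S_d, w2' = sact s (w1' : words m d be) /\ w2 = sact s (w1 : words m d al).
Proof.
move=> E; have [s sE] : exists s : 'S_d, forall k, (val w1 k, val w1' k) = (val w2 (s k), val w2' (s k)).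
  apply: (@perm_of_fibres _ _ (fun k => (val w1 k, val w1' k)) (fun k => (val w2 k, val w2' k))).
  case=> j i; have := congr1 (fun q : Tmat al be => val q i j) E; rewrite !joint_mxE.
  by move=> /addIr[] H; exact: H.
exists s; split; apply: word_eqP => k; rewrite sact_val.
  by case: (sE (s^-1%g k)) => _ ->; rewrite permKV.
by case: (sE (s^-1%g k)) => -> _; rewrite permKV.
Qed.

Variables (n : nat) (mu : n.-tuple nat).

Lemma F_hom_sact (h : hom n al be) (s : 'S_d) (w' : word m d be) (w : word m d al) :
  F_hom mu h (sact s (w' : words m d be) : word m d be) (sact s (w : words m d al)) =
  F_hom mu h w' w.
Proof. by rewrite !F_homE joint_mx_sact. Qed.

(** The orbits of pairs of words are classified by their matrices, so every
    invariant kernel is a combination of the specialised [xi_q]. *)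
Lemma lift_kernel (K : word m d be -> word m d al -> rat) :
  (forall (s : 'S_d) w' w, K (sact s (w' : words m d be) : word m d be)
     (sact s (w : words m d al)) = K w' w) ->
  exists h : hom n al be, forall w' w, F_hom mu h w' w = K w' w.
Proof.
move=> Ks; pose cls q := [set p : word m d be * word m d al | joint_mx p.1 p.2 == q].
pose h : hom n al be := \sum_(p : word m d be * word m d al)
  ((K p.1 p.2 / #|cls (joint_mx p.1 p.2)|%:R)%:MP : {mpoly rat[n]}) *: << joint_mx p.1 p.2 >>.
exists h => w' w; rewrite F_homE raddf_sum /= raddf_sum /=.
have pc : (w', w) \in cls (joint_mx w' w) by rewrite inE.
have c0 : (#|cls (joint_mx w' w)|%:R : rat) != 0.
  by rewrite pnatr_eq0 -lt0n; apply/card_gt0P; exists (w', w).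
rewrite (bigID (mem (cls (joint_mx w' w)))) /= [X in _ + X]big1 ?addr0 => [|p]; last first.
  by rewrite inE => /negbTE pq; rewrite monalg.mcoeffZ monalg.mcoeffU pq mulr0 rmorph0.
rewrite (eq_bigr (fun=> K w' w / #|cls (joint_mx w' w)|%:R)) => [|p].
  rewrite sumr_const -[LHS]mulr_natr divfK //.
rewrite inE => /eqP pq; rewrite monalg.mcoeffZ monalg.mcoeffU pq eqxx mulr1.
rewrite /eval_mu mevalC; have [s [-> ->]] := joint_mx_orbit pq.
by rewrite Ks.
Qed.
End Equivariance.

(** * The action of endomorphisms on Specht modules *)

Section SpechtCharacter.
Variables (l : nat) (mu : l.-tuple nat) (d : nat) (al : Tseq l).
Hypothesis part : is_partition (phi mu al).
Local Notation W := (words mu d al).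
Local Notation Q := {ffun W -> rat^o}.
Local Notation e := (polytabloid (m := mu) (al := al)).
Local Notation Sp := (sspace (specht mu d al)).

Definition hom_act (h : hom l al al) (u : Q) : Q := kap (F_hom mu h : W -> W -> rat) u.

Lemma hom_act_linear h : linear (hom_act h).
Proof. exact: kap_linear. Qed.

Lemma hom_act_pact h (s : 'S_d) u : hom_act h (pact s u) = pact s (hom_act h u).
Proof.
apply/ffunP => w; rewrite !ffunE (reindex_inj (@sact_inj _ _ _ _ s)).
apply: eq_bigr => a _; rewrite ffunE sactK; congr (_ * _).
by rewrite -[in LHS](sactKV s (w : W)) F_hom_sact.
Qed.

(** An endomorphism acts on the Specht module by a scalar; the scalar is found
    by applying the endomorphism to the word of a tableau and pairing with the
    polytabloid, which gives the signed sum of [hs_coef_eval]. *)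
Lemma hs_char_act (h : hom l al al) :
  (forall x, x \in Sp -> hom_act h x = eval_mu mu (hs_char h) *: x) /\
  forall t, is_tableau t -> forall u, ip (hom_act h u) (e t) = eval_mu mu (hs_char h) * ip u (e t).
Proof.
have [a [aS aE]] := endo_scalar part (hom_act_linear h) (hom_act_pact h).
have [[t tt]|nt] := pselect (exists t : word mu d al * {ffun 'I_d -> 'I_d}, is_tableau t); last first.
  split=> [x xS|t tt]; last by case: nt; exists t.
  have -> : x = 0.
    by apply: (specht_perp (l := l) (m := mu) (d := d) (al := al)) xS _ => t tt; case: nt; exists t.
  by rewrite scaler0 (linear_at0 (hom_act_linear h)).
suff <- : a = eval_mu mu (hs_char h) by split.
pose de : Q := [ffun v => (v == t.1)%:R].
have de1 : ip de (e t) = 1.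
  rewrite /ip (bigD1 (t.1 : W)) //= ffunE eqxx mul1r big1 ?addr0 ?polytabloid_id // => v vt.
  by rewrite ffunE (negbTE vt) mul0r.
rewrite -[a]mulr1 -de1 -(aE t tt).
have deh v : hom_act h de v = F_hom mu h v t.1.
  rewrite ffunE (bigD1 (t.1 : W)) //= ffunE eqxx mulr1 big1 ?addr0 // => w wt.
  by rewrite ffunE (negbTE wt) mulr0.
transitivity (\sum_(s : 'S_d | colgrp t s) (-1) ^+ s * F_hom mu h (sact s (t.1 : W)) t.1).
  rewrite /ip; under eq_bigr do rewrite deh polytabloidE /antisym mulr_sumr.
  rewrite exchange_big; apply: eq_bigr => s _.
  rewrite (bigD1 (sact s (t.1 : W))) // eqxx mulr1 mulrC big1 => [|v vs]; first exact: addr0.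
  by rewrite (negbTE vs) !mulr0.
rewrite /hs_char /lext [RHS]rmorph_sum.
transitivity (\sum_(s : 'S_d | colgrp t s) \sum_(q <- monalg.msupp h)
    eval_mu mu (monalg.mcoeff q h) * ((-1) ^+ s * F_xi q (sact s (t.1 : W) : word mu d al) t.1)).
  by apply: eq_bigr => s _; rewrite /F_hom mulr_sumr; apply: eq_bigr => q _; exact: mulrCA.
rewrite exchange_big; apply: eq_bigr => q _.
rewrite -mulr_sumr [RHS]rmorphM; congr (_ * _); exact: hs_coef_eval.
Qed.
End SpechtCharacter.

(** * Tensor products of subspaces of function spaces *)

Section FunTens.
Variables (A B : finType) (U : {vspace Qfun A}) (V : {vspace Qfun B}).
Local Notation T := <<[seq fun_tens u w | u <- vbasis U, w <- vbasis V]>>%VS.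

Lemma fun_tensDl c u u' w : fun_tens (c *: u + u' : Qfun A) (w : Qfun B) =
  c *: (fun_tens u w : Qfun (A * B)%type) + fun_tens u' w.
Proof. by apply/ffunP => p; rewrite !ffunE mulrDl -mulrA. Qed.

Lemma fun_tensDr c u w w' : fun_tens (u : Qfun A) (c *: w + w' : Qfun B) =
  c *: (fun_tens u w : Qfun (A * B)%type) + fun_tens u w'.
Proof. by apply/ffunP => p; rewrite !ffunE mulrDr mulrCA. Qed.

Lemma fun_tens_in u w : u \in U -> w \in V -> fun_tens u w \in T.
Proof.
have H0 w' : fun_tens (0 : Qfun A) w' = 0 by apply/ffunP => p; rewrite !ffunE mul0r.
have H0' u' : fun_tens u' (0 : Qfun B) = 0 by apply/ffunP => p; rewrite !ffunE mulr0.
rewrite -{1}(span_basis (vbasisP U)) -{1}(span_basis (vbasisP V)) => uU wV.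
move: u uU; apply: span_ind => [|c u' v uT vT|u uB].
- by rewrite H0 mem0v.
- by rewrite fun_tensDl memvD ?memvZ.
move: w wV; apply: span_ind => [|c u' v uT vT|w wB].
- by rewrite H0' mem0v.
- by rewrite fun_tensDr memvD ?memvZ.
by apply: memv_span; apply: allpairs_f.
Qed.

Definition row_of (v : Qfun (A * B)%type) (a : A) : Qfun B := [ffun b => v (a, b)].
Definition col_of (v : Qfun (A * B)%type) (b : B) : Qfun A := [ffun a => v (a, b)].

Lemma row_in v a : v \in T -> row_of v a \in V.
Proof.
apply: (span_ind (P := fun v => row_of v a \in V)) => [|c u w uV wV|_ /allpairsP[[u w] [/= uU wV ->]]].
- by rewrite (_ : row_of 0 a = 0) ?mem0v //; apply/ffunP => b; rewrite !ffunE.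
- rewrite (_ : row_of _ a = c *: row_of u a + row_of w a) ?memvD ?memvZ //.
  by apply/ffunP => b; rewrite !ffunE.
rewrite (_ : row_of _ a = (u a : rat) *: w) ?memvZ ?vbasis_mem //.
by apply/ffunP => b; rewrite !ffunE.
Qed.

Lemma col_in v b : v \in T -> col_of v b \in U.
Proof.
apply: (span_ind (P := fun v => col_of v b \in U)) => [|c u w uV wV|_ /allpairsP[[u w] [/= uU wV ->]]].
- by rewrite (_ : col_of 0 b = 0) ?mem0v //; apply/ffunP => a; rewrite !ffunE.
- rewrite (_ : col_of _ b = c *: col_of u b + col_of w b) ?memvD ?memvZ //.
  by apply/ffunP => a; rewrite !ffunE.
rewrite (_ : col_of _ b = (w b : rat) *: u) ?memvZ ?vbasis_mem //.
by apply/ffunP => a; rewrite !ffunE /= mulrC.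
Qed.
End FunTens.

Section ImageTens.
Variables (A B : finType) (E : A -> A -> rat) (V : {vspace Qfun B}).
Hypothesis EE : forall a a', \sum_b E a b * E b a' = E a a'.
Local Notation U := (limg (linfun (kap E))).
Local Notation T := <<[seq fun_tens u w | u <- vbasis U, w <- vbasis V]>>%VS.

Lemma image_fixed u : (u \in U) = (kap E u == u).
Proof.
apply/memv_imgP/eqP => [[z _ ->]|uE].
  rewrite lfunE /=; apply/ffunP => a; rewrite !ffunE.
  under eq_bigr do rewrite ffunE mulr_sumr.
  rewrite exchange_big /=; apply: eq_bigr => b _.
  by rewrite -EE mulr_suml; apply: eq_bigr => c _; rewrite mulrA.
by exists u; rewrite ?memvf // lfunE /= uE.
Qed.

(** An element of [E(A) \otimes B] all of whose rows lie in [V] belongs to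
    [E(A) \otimes V]: expand the rows in a basis of [V]; the coordinates are
    again fixed by the idempotent [E]. *)
Lemma image_tens_in (v : Qfun (A * B)%type) : kapl E v = v ->
  (forall a, row_of v a \in V) -> v \in T.
Proof.
move=> Ev vV; pose C j : Qfun A := [ffun a => coord (vbasis V) j (row_of v a)].
have -> : v = \sum_j fun_tens (C j) (vbasis V)`_j.
  apply/ffunP => -[a b]; have := coord_vbasis (vV a) => /ffunP/(_ b); rewrite ffunE => ->.
  by rewrite !sum_ffunE; apply: eq_bigr => j _; rewrite !ffunE.
apply: memv_suml => j _; apply: fun_tens_in; last by rewrite vbasis_mem // mem_nth ?size_tuple.
rewrite image_fixed; apply/eqP/ffunP => a; rewrite !ffunE.
have -> : row_of v a = \sum_a' (E a a') *: row_of v a'.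
  apply/ffunP => b; rewrite sum_ffunE ffunE -{1}Ev ffunE.
  by apply: eq_bigr => a' _; rewrite !ffunE.
by rewrite linear_sum /=; apply: eq_bigr => a' _; rewrite linearZ ffunE.
Qed.
End ImageTens.

(** * The kernels of specialised morphisms *)

Section SpecialisedKernels.
Variables (l : nat) (mu : l.-tuple nat) (d : nat) (al be : Tseq l).
Hypothesis mud : (\sum_(i < l) tnth mu i)%N = d.
Local Notation dm := (one_var d).
Local Notation kx X := (tagged_words dm d (kob X)).

(** A pair of words determines its [gamma] and its word over cells, so the
    double sum in [split_words] has one term. *)
Lemma split_wordsE (X : kobj (Cdel l)) (u : Qfun (Fmu_tens mu d be X)) p :
  split_words u p = u (join_pair mud (p : kx X * word mu d be)).
Proof.
case: p => -[a wr] wb; rewrite ffunE.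
pose g0 := gams (join_gam mud wr wb).
rewrite (bigD1 g0) //= [X in _ + X]big1 ?addr0 => [|g gg]; last first.
  rewrite big1 // => w /forallP H; case/eqP: gg; apply: val_inj => /=.
  rewrite -(join_gam_split mud w); congr join_gam; apply: val_inj; apply/ffunP => k;
    by rewrite ffunE; case/andP: (H k) => /eqP ? /eqP ?.
rewrite (bigD1 (join_word mud wr wb)) /=; last first.
  by apply/forallP => k; rewrite !ffunE cell_rowK cell_colK !eqxx.
rewrite [X in _ + X]big1 ?addr0 // => w /andP[/forallP H /eqP ww]; case: ww.
apply: val_inj; apply/ffunP => k; rewrite ffunE.
case/andP: (H k) => /eqP <- /eqP <-.
by rewrite cellK.
Qed.

Definition tagged_sact (I : finType) (x : I -> Tseq l) (s : 'S_d) (t : tagged_words mu d x) : tagged_words mu d x :=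
  @Tagged _ (tag t) (fun a => word mu d (x a)) (sact s (tagged t : words mu d (x (tag t)))).

Lemma join_gam_sact (rho : Tseq 1) (s : 'S_d) (wr : word dm d rho) (wb : word mu d be) :
  join_gam mud (sact s (wr : words dm d rho) : word dm d rho)
    (sact s (wb : words mu d be)) = join_gam mud wr wb.
Proof.
apply: val_inj; apply/matrixP => i j; rewrite !mxE; congr (Posz _ - _).
rewrite -!sum1_card ![LHS]big_mkcond [RHS]big_mkcond [LHS](reindex_inj (@perm_inj _ s)).
apply: eq_bigr => k _.
have -> : (s k \in [pred p | (val (sact s (wb : words mu d be) : word mu d be) p == j) &&
    (val (sact s (wr : words dm d rho) : word dm d rho) p == i)]) =
    (val (sact s (wb : words mu d be) : word mu d be) (s k) == j) &&
    (val (sact s (wr : words dm d rho) : word dm d rho) (s k) == i) by [].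
by rewrite !sact_val permK.
Qed.

Lemma join_pairE (X : kobj (Cdel l)) (a : kidx X) (wr : word dm d (kob X a)) (wb : word mu d be)
    (g : Gam (kob X a) be) (W : word mu d (gob g)) :
  join_gam mud wr wb = g -> (forall k, val W k = cell (val wr k) (val wb k)) ->
  join_pair mud (Tagged (fun a => word dm d (kob X a)) wr, wb) = @tag_word l mu d _ (kob X) be a (gams g) W.
Proof.
move=> E H; apply: (@tag_word_eq l mu d _ (kob X) be a (gams (join_gam mud wr wb)) (gams g)).
  by rewrite E.
by apply/ffunP => k; rewrite ffunE H.
Qed.

Lemma join_pair_sact (X : kobj (Cdel l)) (s : 'S_d) (t : Fd_sset d X) (wb : words mu d be) :
  join_pair mud (sact s t : kx X, sact s wb : word mu d be) = tagged_sact s (join_pair mud (t : kx X, wb : word mu d be)).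
Proof.
case: t => a wr.
have := @join_pairE X a (sact s (wr : words dm d (kob X a)) : word dm d (kob X a))
  (sact s wb : word mu d be) (join_gam mud wr wb)
  (sact s (join_word mud wr wb : words mu d (gob (join_gam mud wr wb)))).
apply; first exact: join_gam_sact.
move=> k.
apply: etrans (sact_val s (join_word mud wr wb : words mu d (gob (join_gam mud wr wb))) k) _.
apply: etrans (ffunE _ _) _.
apply: congr2; exact: esym (sact_val _ _ _).
Qed.

Section mid_kernel.
Variable X : kobj (Cdel l).

(** The matrix of the specialisation of a morphism from [M^al] to
    [X \otimes M^be], with its rows indexed by pairs of words. *)
Definition raw_kernel (f : rawhom (C := Clam l) (fun _ : unit => al) (tens_ob (x := kob X) (be := be)))
    (p : kx X * word mu d be) (w : word mu d al) : rat :=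
  F_hom mu (f (tag (join_pair mud p), tt)) (tagged (join_pair mud p)) w.

Lemma raw_kernel_linear c f g p w : raw_kernel (c *: f + g) p w = eval_mu mu c * raw_kernel f p w + raw_kernel g p w.
Proof. by rewrite /raw_kernel dprod_linE F_hom_linear. Qed.

Lemma raw_kernel_sact f s (t : Fd_sset d X) (wb : words mu d be) (w : words mu d al) :
  raw_kernel f (sact s t : kx X, sact s wb : word mu d be) (sact s w) = raw_kernel f (t : kx X, wb : word mu d be) w.
Proof. by rewrite /raw_kernel join_pair_sact; exact: F_hom_sact. Qed.

Lemma raw_kernel_mulr f (psi : hom l al al) p w :
  raw_kernel (rcomp f ([ffun p => psi] : rawhom (C := Clam l) (fun _ : unit => al) (fun _ : unit => al))) p w =
  \sum_w' raw_kernel f p w' * F_hom mu psi w' w.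
Proof.
rewrite /raw_kernel ffunE (bigD1 tt) //= big1 ?addr0; last by case.
rewrite ffunE; exact: (F_hom_comp (@eval_lam_vars l mu)).
Qed.
End mid_kernel.

Lemma raw_kernel_mull (X Y : kobj (Cdel l)) (g : rawhom (kob X) (kob Y)) (psi : hom l be be) f p w :
  raw_kernel (rcomp (C := Clam l) (rtens g psi) f) p w =
  \sum_(p' : kx X) \sum_(wb : word mu d be)
     Fd_mor mu g p.1 p' * F_hom mu psi p.2 wb * raw_kernel f (p', wb) w.
Proof.
transitivity (F_raw (m := mu) (d := d) (v := lam_vars l) mu (rcomp (C := Clam l) (rtens g psi) f)
  (join_pair mud p) (@Tagged _ tt (fun _ => word mu d al) w)) => //.
rewrite (F_raw_comp (@eval_lam_vars l mu)).
rewrite (reindex _ (onW_bij _ (join_pair_bij mud (kob X) be))) /=.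
rewrite pair_bigA; apply: eq_bigr => -[p' wb] _.
by rewrite F_raw_rtens.
Qed.
End SpecialisedKernels.

Section SpecialisedComposites.
Variables (l : nat) (mu : l.-tuple nat) (d : nat) (al be : Tseq l).
Hypothesis mud : (\sum_(i < l) tnth mu i)%N = d.
Local Notation dm := (one_var d).
Local Notation A X := (scar (Fd_sset d X)).
Local Notation ev := (eval_mu mu).

Definition mid_kernel (X : kobj (Cdel l)) (f : midhom al be X) : A X * word mu d be -> word mu d al -> rat :=
  raw_kernel mud (kraw f).

Lemma mid_kernel_linear (X : kobj (Cdel l)) c (f g : midhom al be X) p w :
  mid_kernel (c *: f + g) p w = ev c * mid_kernel f p w + mid_kernel g p w.
Proof. by rewrite /mid_kernel krawD raw_kernel_linear. Qed.

Lemma mid_kernel_sact (X : kobj (Cdel l)) (f : midhom al be X) s (t : Fd_sset d X) (wb : words mu d be)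
    (w : words mu d al) :
  mid_kernel f (sact s t, sact s wb : word mu d be) (sact s w) = mid_kernel f (t, wb : word mu d be) w.
Proof. exact: raw_kernel_sact. Qed.

Lemma Fd_mor_idem (X : karoubi (Cdel l)) a a' :
  \sum_(b : A X) Fd_mor mu (kidem X) a b * Fd_mor mu (kidem X) b a' = Fd_mor mu (kidem X) a a'.
Proof.
have := F_raw_comp (fun i => @eval_del_vars l mu d i mud) (kidem X) (kidem X) a a'.
by rewrite (kar_idem X) => E; apply: esym; exact: E.
Qed.

Lemma raw_kernel_hid (X Y : kobj (Cdel l)) (g : rawhom (kob X) (kob Y)) f p w :
  raw_kernel (al := al) mud (rcomp (C := Clam l) (rtens g (hid l be)) f) p w =
  \sum_(a : A X) Fd_mor mu g p.1 a * raw_kernel mud f (a, p.2) w.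
Proof.
rewrite raw_kernel_mull; apply: eq_bigr => a _.
rewrite (bigD1 p.2) //= F_hom_id eqxx mulr1 big1 ?addr0 // => wb /negbTE wp.
by rewrite F_hom_id eq_sym wp mulr0 mul0r.
Qed.

Lemma mid_kernel_idem (X : kobj (Cdel l)) (f : midhom al be X) p w :
  \sum_(a : A X) Fd_mor mu (kidem X) p.1 a * mid_kernel f (a, p.2) w = mid_kernel f p w.
Proof.
apply: etrans (esym (raw_kernel_hid _ _ _ _)) _.
exact: (congr1 (fun f => raw_kernel mud f p w) (kraw_idl f)).
Qed.

Lemma mid_kernel_map (X Y : karoubi (Cdel l)) (g : khom X Y) (f : midhom al be X) p w :
  mid_kernel (mid_map g f) p w = \sum_(a : A X) Fd_mor mu (kraw g) p.1 a * mid_kernel f (a, p.2) w.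
Proof.
apply: etrans _ (raw_kernel_hid _ _ _ _); apply: (congr1 (fun f => raw_kernel mud f p w)).
apply: etrans (congr1 kraw (mid_mapE _ _)) _; apply: etrans (kraw_kcomp (@clam_assoc' l) _ _) _.
exact: (congr1 (fun e => rcomp e (kraw f)) (kraw_ktens _ _)).
Qed.

Lemma mid_kernel_midl (X : karoubi (Cdel l)) psi (f : midhom al be X) p w :
  mid_kernel (mid_l psi f) p w = \sum_wb F_hom mu psi p.2 wb * mid_kernel f (p.1, wb) w.
Proof.
transitivity (raw_kernel mud (rcomp (C := Clam l) (rtens (kidem X) psi) (kraw f)) p w).
  apply: (congr1 (fun f => raw_kernel mud f p w)).
  apply: etrans (congr1 kraw (mid_lE _ _)) _; apply: etrans (kraw_kcomp (@clam_assoc' l) _ _) _.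
  apply: (congr1 (fun e => rcomp e (kraw f))); apply: etrans (kraw_ktens _ _) _.
  by rewrite kraw_kid; last exact: kar_idem.
rewrite raw_kernel_mull exchange_big; apply: eq_bigr => wb _ /=.
rewrite -(mid_kernel_idem f (p.1, wb)) mulr_sumr; apply: eq_bigr => a _.
by rewrite /= [_ * F_hom _ _ _ _]mulrC mulrA.
Qed.

Lemma mid_kernel_midr (X : karoubi (Cdel l)) psi (f : midhom al be X) p w :
  mid_kernel (mid_r f psi) p w = \sum_w' mid_kernel f p w' * F_hom mu psi w' w.
Proof.
apply: etrans _ (raw_kernel_mulr _ _ _ _ _); apply: (congr1 (fun f => raw_kernel mud f p w)).
apply: etrans (congr1 kraw (mid_rE _ _)) _; apply: etrans (kraw_kcomp (@clam_assoc' l) _ _) _.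
exact: (congr1 (fun e => rcomp (kraw f) e) (kraw_single psi)).
Qed.

(** The component at the basis element [a] of [F_d X] of the image of [x]. *)
Definition mid_row (X : kobj (Cdel l)) (f : midhom al be X) (a : A X) (x : Qfun (words mu d al)) :
    Qfun (words mu d be) := [ffun c => \sum_w mid_kernel f (a, c) w * (x w : rat)].

Lemma mid_row_linear (X : kobj (Cdel l)) c (f g : midhom al be X) a x :
  mid_row (c *: f + g) a x = ev c *: mid_row f a x + mid_row g a x.
Proof.
apply/ffunP => b; rewrite !ffunE -[X in _ = X + _]/(_ * _) mulr_sumr -big_split.
by apply: eq_bigr => w _; rewrite mid_kernel_linear mulrDl mulrA.
Qed.

Lemma mid_row_linearr (X : kobj (Cdel l)) (f : midhom al be X) a : linear (mid_row f a).
Proof.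
move=> c x y; apply/ffunP => b; rewrite !ffunE -[X in _ = X + _]/(_ * _) mulr_sumr -big_split.
by apply: eq_bigr => w _; rewrite !ffunE mulrDr mulrCA.
Qed.

Lemma mid_row_sum (X Y : kobj (Cdel l)) (f : midhom al be X) (f' : midhom al be Y)
    (E : A Y -> A X -> rat) a x :
  (forall b w, mid_kernel f' (a, b) w = \sum_a' E a a' * mid_kernel f (a', b) w) ->
  mid_row f' a x = \sum_a' E a a' *: mid_row f a' x.
Proof.
move=> H; apply/ffunP => b; rewrite sum_ffunE ffunE.
under eq_bigr do rewrite H mulr_suml.
rewrite exchange_big; apply: eq_bigr => a' _; rewrite !ffunE -[RHS]/(_ * _) mulr_sumr.
by apply: eq_bigr => w _; rewrite mulrA.
Qed.

Lemma mid_row_midl (X : karoubi (Cdel l)) psi (f : midhom al be X) a x :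
  mid_row (mid_l psi f) a x = hom_act psi (mid_row f a x).
Proof.
apply/ffunP => b; rewrite !ffunE.
under eq_bigr do rewrite mid_kernel_midl mulr_suml.
rewrite exchange_big; apply: eq_bigr => wb _; rewrite !ffunE mulr_sumr.
by apply: eq_bigr => w _; rewrite mulrA.
Qed.

Lemma mid_row_midr (X : karoubi (Cdel l)) psi (f : midhom al be X) a x :
  mid_row (mid_r f psi) a x = mid_row f a (hom_act psi x).
Proof.
apply/ffunP => b; rewrite !ffunE.
under eq_bigr do rewrite mid_kernel_midr mulr_suml.
rewrite exchange_big; apply: eq_bigr => w _; rewrite !ffunE mulr_sumr.
by apply: eq_bigr => w' _; rewrite mulrA.
Qed.

Lemma mid_row_sact (X : kobj (Cdel l)) (f : midhom al be X) s (a : Fd_sset d X) x :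
  mid_row f (sact s a) (pact s x) = pact s (mid_row f a x).
Proof.
apply/ffunP => b; rewrite !ffunE (reindex_inj (@sact_inj _ _ _ _ s)); apply: eq_bigr => w _.
rewrite ffunE sactK; apply: (congr1 (fun c : rat => c * (x w : rat))).
by rewrite -[in LHS](sactKV s (b : words mu d be)) mid_kernel_sact.
Qed.

Lemma Fd_sactK (X : kobj (Cdel l)) (s : 'S_d) (a : Fd_sset d X) : sact s^-1%g (sact s a) = a.
Proof. by case: a => a w; congr (Tagged _ _); exact: sactK. Qed.

Lemma Fd_sactKV (X : kobj (Cdel l)) (s : 'S_d) (a : Fd_sset d X) : sact s (sact s^-1%g a) = a.
Proof. by case: a => a w; congr (Tagged _ _); exact: sactKV. Qed.

Section Lift.
Variables (X : karoubi (Cdel l)) (K : A X * word mu d be -> word mu d al -> rat).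
Hypothesis Ks : forall (s : 'S_d) (a : Fd_sset d X) (b : words mu d be) (w : words mu d al),
  K (sact s a, sact s b : word mu d be) (sact s w) = K (a, b : word mu d be) w.
Hypothesis KE : forall p w, \sum_(a : A X) Fd_mor mu (kidem X) p.1 a * K (a, p.2) w = K p w.

Lemma kincl_idr (I : finType) (y : I -> Tseq l) (f : rawhom (C := Clam l) (fun _ : unit => al) y) :
  rcomp f (kidem (kincl (al : Clam l))) = f.
Proof.
apply/ffunP => -[i []]; rewrite ffunE (bigD1 tt) //= big1 ?addr0; last by case.
by rewrite !ffunE; exact: clam_idr.
Qed.

(** Lift each summand of [X \otimes M^be] separately; the lifts are then
    composed with the idempotent of [X], which does not change the matrix, its
    columns being fixed. *)
Lemma lift_mid_kernel : exists f : midhom al be X, forall p w, mid_kernel f p w = K p w.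
Proof.
have split_pairS s (t : tagged_words mu d (tens_ob (x := kob X) (be := be))) :
    split_pair mud (tagged_sact s t) = (sact s ((split_pair mud t).1 : Fd_sset d X), sact s ((split_pair mud t).2 : words mu d be)).
  have := congr1 (split_pair mud (x := kob X) (be := be)) (join_pair_sact mud s ((split_pair mud t).1 : Fd_sset d X) ((split_pair mud t).2 : words mu d be)).
  rewrite -surjective_pairing split_pairK => E; exact: etrans (esym E) (join_pairK mud _).
have hom_of : forall t : kidx (act X be), exists h : hom l al (kob (act X be) t),
    forall W w, F_hom mu h W w = K (split_pair mud (@Tagged _ t (fun t => word mu d (kob (act X be) t)) W)) w.
  move=> t; apply: lift_kernel => s W w.
  pose W0 : tagged_words mu d (tens_ob (x := kob X) (be := be)) :=
    @Tagged _ t (fun t => word mu d (kob (act X be) t)) W.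
  apply: etrans (congr1 (fun p => K p (sact s (w : words mu d al))) (split_pairS s W0)) _.
  by apply: etrans (Ks _ _ _ _) _; rewrite -surjective_pairing.
pose f0 : rawhom (C := Clam l) (fun _ : unit => al) (tens_ob (x := kob X) (be := be)) :=
  [ffun p => sval (cid (hom_of p.1))].
have f0E p w : raw_kernel mud f0 p w = K p w.
  rewrite /raw_kernel ffunE (svalP (cid (hom_of _))); apply: (congr1 (fun p => K p w)).
  by apply: etrans _ (join_pairK mud p); case: (join_pair mud p).
pose f1 := rcomp (kidem (act X be)) f0.
have f1P : f1 \in khom_pred (X := kincl (al : Clam l)) (Y := act X be).
  apply/khom_predP; split; last exact: kincl_idr.
  by rewrite /f1 clam_rassoc; apply: (congr1 (fun e => rcomp e f0)); exact: act_idem.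
exists (tokhom (X := kincl (al : Clam l)) (Y := act X be) f1) => p w.
rewrite /mid_kernel tokhomK // raw_kernel_hid -[RHS]KE; apply: eq_bigr => a _.
by rewrite f0E.
Qed.
End Lift.
End SpecialisedComposites.

(** * The specialisation of H *)

Section Specialisation.
Variables (l : nat) (mu : l.-tuple nat) (d : nat) (al be : Tseq l).
Hypothesis mud : (\sum_(i < l) tnth mu i)%N = d.
Hypothesis pal : is_partition (phi mu al).
Hypothesis pbe : is_partition (phi mu be).
Variables (iota : slin (specht mu d al) (Mmod mu d al)) (pi : slin (Mmod mu d be) (specht mu d be)).
Hypothesis ie : equivariant iota.
Hypothesis i0 : iota != 0.
Hypothesis pe : equivariant pi.
Hypothesis p0 : pi != 0.
Local Notation A X := (scar (Fd_sset d X)).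
Local Notation ev := (eval_mu mu).
Local Notation S := (sspace (specht mu d al)).
Local Notation S' := (sspace (specht mu d be)).
Local Notation T X := (smod_tens (Fd mu d X) (specht mu d be)).

Lemma spec_compE (X : kobj (Cdel l)) (f : midhom al be X) u p :
  spec_comp iota pi f u p = pi_fun pi (mid_row mud f p.1 (vsval (iota u))) p.2.
Proof.
rewrite /spec_comp ffunE /pi_fun; congr (vsval (pi (vsproj _ _)) _).
apply/ffunP => c; apply: etrans (ffunE _ _) _; apply: etrans (split_wordsE mud _ _) _.
by apply: etrans (ffunE _ _) _; rewrite [RHS]ffunE.
Qed.

Lemma row_spec_comp (X : kobj (Cdel l)) (f : midhom al be X) u a :
  row_of (spec_comp iota pi f u : Qfun (A X * word mu d be)%type) a =
  pi_fun pi (mid_row mud f a (vsval (iota u))).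
Proof. by apply/ffunP => b; rewrite ffunE spec_compE. Qed.

Lemma pi_fun_sum I (r : seq I) (c : I -> rat) (F : I -> Qfun (words mu d be)) :
  pi_fun pi (\sum_(i <- r) c i *: F i) = \sum_(i <- r) c i *: pi_fun pi (F i).
Proof.
rewrite (linear_sum0 _ _ _ (pi_fun_linear pi)); apply: eq_bigr => i _.
by have := pi_fun_linear pi (c i) (F i) 0; rewrite (linear_at0 (pi_fun_linear pi)) !addr0.
Qed.

Lemma spec_comp_kapl (X Y : kobj (Cdel l)) (f : midhom al be X) (f' : midhom al be Y)
    (E : A Y -> A X -> rat) u :
  (forall a b w, mid_kernel mud f' (a, b) w = \sum_a' E a a' * mid_kernel mud f (a', b) w) ->
  spec_comp iota pi f' u = kapl E (spec_comp iota pi f u).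
Proof.
move=> H; apply/ffunP => -[a b]; rewrite spec_compE (mid_row_sum _ (H a)) pi_fun_sum.
rewrite sum_ffunE ffunE; apply: eq_bigr => a' _.
by rewrite ffunE spec_compE.
Qed.

(** The columns are fixed by the idempotent of [F_d X], because a morphism
    absorbs the idempotent of its target; the rows are values of [pi]. *)
Lemma spec_comp_in (X : karoubi (Cdel l)) (f : midhom al be X) u :
  spec_comp iota pi f u \in sspace (T X).
Proof.
apply: (image_tens_in (E := Fd_mor mu (kidem X)) (Fd_mor_idem mud (X := X))) => [|a].
  by apply: esym; apply: spec_comp_kapl => a b w; rewrite -mid_kernel_idem.
by rewrite row_spec_comp; exact: pi_fun_in.
Qed.

Section Fixed.
Variables (X : karoubi (Cdel l)) (f : midhom al be X).

Definition spec_map (u : subvs_of S) : subvs_of (sspace (T X)) :=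
  vsproj (sspace (T X)) (spec_comp iota pi f u).

Fact spec_map_linear : linear spec_map.
Proof.
move=> c u v; rewrite -linearP; congr vsproj; apply/ffunP => p.
rewrite [RHS]ffunE [X in _ = X + _]ffunE !spec_compE !linearP /= mid_row_linearr pi_fun_linear.
by rewrite [LHS]ffunE [X in X + _]ffunE.
Qed.
HB.instance Definition _ := GRing.isLinear.Build _ _ _ _ spec_map spec_map_linear.

Definition spec_lin : slin (specht mu d al) (T X) := linfun spec_map.

Lemma spec_linE u : vsval (spec_lin u) = spec_comp iota pi f u.
Proof. by rewrite lfunE vsprojK // spec_comp_in. Qed.

Lemma spec_lin_equivariant : equivariant spec_lin.
Proof.
move=> s x y xy; rewrite !spec_linE; apply/ffunP => -[a b].
rewrite [RHS]ffunE !spec_compE /= (ie xy).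
rewrite -[a in LHS](Fd_sactKV s) mid_row_sact.
have pfe u : pi_fun pi (pact s u) = pact s (pi_fun pi u) by apply: pe; rewrite !vsprojK ?memvf.
by rewrite pfe ffunE.
Qed.

(** The actions of both endomorphism algebras are absorbed by [pi] and [iota] as
    the specialised characters [HS]: this is what makes the specialisation
    descend to the tensor product. *)
Lemma spec_lin_midl th (g : midhom al be X) : g = mid_l th f ->
  forall u, spec_comp iota pi g u = ev (hs_char th) *: spec_comp iota pi f u.
Proof.
move=> -> u; apply/ffunP => p; rewrite spec_compE mid_row_midl [RHS]ffunE spec_compE.
by rewrite (pi_endo pbe pe p0 (hs_char_act d pbe th).2) ffunE.
Qed.

Lemma spec_lin_midr th (g : midhom al be X) : g = mid_r f th ->
  forall u, spec_comp iota pi g u = ev (hs_char th) *: spec_comp iota pi f u.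
Proof.
move=> -> u; apply/ffunP => p; rewrite spec_compE mid_row_midr [RHS]ffunE spec_compE.
have [a _ aE] := iota_scalar pal ie i0.
rewrite (hs_char_act d pal th).1 ?aE ?memvZ ?subvsP //.
have Ll := mid_row_linearr mud f p.1; have Pl := pi_fun_linear pi.
have := Ll (ev (hs_char th)) (a *: vsval u) 0; rewrite (linear_at0 Ll) !addr0 => ->.
have := Pl (ev (hs_char th)) (mid_row mud f p.1 (a *: vsval u)) 0; rewrite (linear_at0 Pl) !addr0 => ->.
by rewrite ffunE.
Qed.
End Fixed.

Lemma spec_comp_linear (X : kobj (Cdel l)) c (f g : midhom al be X) u :
  spec_comp iota pi (c *: f + g) u = ev c *: spec_comp iota pi f u + spec_comp iota pi g u.
Proof.
apply/ffunP => p; rewrite [RHS]ffunE [X in _ = X + _]ffunE !spec_compE mid_row_linear pi_fun_linear.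
by rewrite [LHS]ffunE [X in X + _]ffunE.
Qed.

Section Psi.
Variable X : karoubi (Cdel l).
Local Notation R := {mpoly rat[l]}.
Let si : {rmorphism R -> rat} := ev.

Definition hspec_pure_fun (y : R^o) (f : midhom al be X) (x : R^o) : slin (specht mu d al) (T X) :=
  (ev y * ev x) *: spec_lin f.

Definition hspec (h : Hsp al be X) : slin (specht mu d al) (T X) := tlift si hspec_pure_fun h.

Let evP (k : R) (y y' : R^o) : ev (k *: y + y') = ev k * ev y + ev y'.
Proof. by rewrite -[k *: y]/(k * y) rmorphD rmorphM. Qed.

Let P1 k y y' m x : hspec_pure_fun (k *: y + y') m x = si k *: hspec_pure_fun y m x + hspec_pure_fun y' m x.
Proof. by rewrite /hspec_pure_fun evP scalerA -scalerDl mulrDl mulrA. Qed.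

Let P3 k y m x x' : hspec_pure_fun y m (k *: x + x') = si k *: hspec_pure_fun y m x + hspec_pure_fun y m x'.
Proof. by rewrite /hspec_pure_fun evP scalerA -scalerDl mulrDr mulrCA. Qed.

Let P2 k y m m' x : hspec_pure_fun y (k *: m + m') x = si k *: hspec_pure_fun y m x + hspec_pure_fun y m' x.
Proof.
rewrite /hspec_pure_fun scalerA [si k * _]mulrC -[X in _ = X + _]scalerA -scalerDr; congr (_ *: _).
apply/lfunP => u; apply: subvs_inj; rewrite spec_linE spec_comp_linear.
by rewrite add_lfunE scale_lfunE linearD linearZ /= !spec_linE.
Qed.

Let lin_scale (f g : midhom al be X) c :
  (forall u, spec_comp iota pi g u = c *: spec_comp iota pi f u) -> spec_lin g = c *: spec_lin f.
Proof.
move=> H; apply/lfunP => u; apply: subvs_inj.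
by rewrite scale_lfunE linearZ /= !spec_linE.
Qed.

Let P4 y t m x : hspec_pure_fun (HSr y t) m x = hspec_pure_fun y (mid_l t m) x.
Proof.
rewrite /hspec_pure_fun (lin_scale (spec_lin_midl erefl)) scalerA [ev (HSr _ _)]rmorphM.
by congr (_ *: _); rewrite -mulrA mulrC.
Qed.

Let P5 y m t x : hspec_pure_fun y (mid_r m t) x = hspec_pure_fun y m (HSl t x).
Proof.
rewrite /hspec_pure_fun (lin_scale (spec_lin_midr erefl)) scalerA [ev (HSl _ _)]rmorphM.
by congr (_ *: _); rewrite -mulrA; congr (_ * _); rewrite mulrC.
Qed.

Lemma hspec_linear c h h' : hspec (c *: h + h') = ev c *: hspec h + hspec h'.
Proof. exact: (tlift_lin P1 P2 P3 P4 P5). Qed.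

Lemma hspec_pure y f x : hspec (Hpure y f x) = (ev y * ev x) *: spec_lin f.
Proof. exact: (tlift_pure P1 P2 P3 P4 P5). Qed.

Lemma hspec_pureE y f x u : vsval (hspec (Hpure y f x) u) = (ev y * ev x) *: spec_comp iota pi f u.
Proof. by rewrite hspec_pure scale_lfunE linearZ /= spec_linE. Qed.

Lemma hspec0 : hspec 0 = 0.
Proof. by have := hspec_linear (-1) 0 0; rewrite scaler0 add0r rmorphN rmorph1 scaleN1r addNr. Qed.

Lemma hspec_linearE c h h' u : vsval (hspec (c *: h + h') u) = ev c *: vsval (hspec h u) + vsval (hspec h' u).
Proof. by rewrite hspec_linear add_lfunE scale_lfunE linearP. Qed.

Lemma hspec_equivariant h : equivariant (hspec h).
Proof.
elim/tensor3_ind: h => [|c y f x h IH] s u v uv.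
  by rewrite hspec0 !zero_lfunE linear0; apply/ffunP => p; rewrite !ffunE.
rewrite !hspec_linearE !hspec_pureE (IH _ _ _ uv) -!spec_linE (spec_lin_equivariant f uv).
move: (vsval (spec_lin f u)) (vsval (hspec h u)) => a b.
by apply/ffunP => p; rewrite !ffunE.
Qed.
End Psi.

Lemma kapl_linear (B B' C : finType) (K : B' -> B -> rat) c (u v : Qfun (B * C)%type) :
  kapl K (c *: u + v) = c *: kapl K u + kapl K v.
Proof.
apply/ffunP => p; rewrite !ffunE -[X in _ = X + _]/(_ * _) mulr_sumr -big_split.
by apply: eq_bigr => b _; rewrite !ffunE mulrDr mulrCA.
Qed.

Lemma kaplZ (B B' C : finType) (K : B' -> B -> rat) c (u : Qfun (B * C)%type) :
  kapl K (c *: u) = c *: kapl K u.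
Proof.
apply/ffunP => p; rewrite !ffunE -[RHS]/(_ * _) mulr_sumr.
by apply: eq_bigr => b _; rewrite !ffunE mulrCA.
Qed.

Lemma hspec_natural (X Y : karoubi (Cdel l)) (g : khom X Y) h u :
  vsval (hspec (hmap g h) u) = kapl (Fd_mor mu (kraw g)) (vsval (hspec h u)).
Proof.
elim/tensor3_ind: h => [|c y f x h IH].
  rewrite (linear_at0 (hmap_linear g)) !hspec0 !zero_lfunE !linear0.
  by apply/ffunP => p; rewrite !ffunE big1 // => a _; rewrite ffunE mulr0.
rewrite hspec_linearE kapl_linear -IH.
apply: etrans (congr1 (fun h => vsval (hspec h u)) (hmap_linear g c _ h)) _.
rewrite hspec_linearE; congr (_ *: _ + _).
apply: etrans (congr1 (fun h => vsval (hspec h u)) (hmap_pure g y f x)) _.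
rewrite !hspec_pureE kaplZ; congr (_ *: _).
by apply: spec_comp_kapl => a b w; exact: mid_kernel_map.
Qed.

Section Surjective.
Variables (X : karoubi (Cdel l)) (k : slin (specht mu d al) (T X)).
Hypothesis ke : equivariant k.

(** Extend [k] to the permutation module by the projection [P] onto the Specht
    module; this is an equivariant map, and its matrix lifts. Composing with [iota]
    and [pi] multiplies by the scalars [a] and [c]. *)
Lemma hspec_surj : exists h : Hsp al be X, hspec h = k.
Proof.
have [P [Pl Pe PS Pid]] := specht_projection d pal.
have [a a0 aE] := iota_scalar pal ie i0.
have [c c0 [cE _]] := pi_scalar pbe pe p0.
pose L (x : Qfun (words mu d al)) : Qfun (A X * words mu d be)%type := vsval (k (vsproj S (P x))).
have Ll : linear L by move=> b x y; rewrite /L Pl !linearP.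
have Ls s x : L (pact s x) = pact (A := prod_sset (Fd_sset d X) (words mu d be)) s (L x).
  by apply: ke; rewrite Pe !vsprojK // -?Pe PS.
pose de (w : word mu d al) : Qfun (words mu d al) := [ffun v => (v == w)%:R].
have des s (w : words mu d al) : de (sact s w) = pact s (de w).
  apply/ffunP => v; rewrite !ffunE; congr (nat_of_bool _)%:R.
  by apply/eqP/eqP => [->|<-]; rewrite ?sactK ?sactKV.
have LE x : L x = \sum_w (x w : rat) *: L (de w).
  have {1}-> : x = \sum_w (x w : rat) *: de w.
    apply/ffunP => v; rewrite sum_ffunE (bigD1 v) //= big1 ?addr0 => [|w wv]; rewrite !ffunE.
      by rewrite eqxx -[RHS]/(_ * _) mulr1.
    by rewrite eq_sym (negbTE wv) -[LHS]/(_ * _) mulr0.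
  rewrite (linear_sum0 _ _ _ Ll); apply: eq_bigr => w _.
  by have := Ll (x w) (de w) 0; rewrite (linear_at0 Ll) !addr0.
have LT x : L x \in sspace (T X) by exact: subvsP.
pose K (p : A X * word mu d be) (w : word mu d al) : rat := (a * c)^-1 * L (de w) p.
have [f fE] : exists f : midhom al be X, forall p w, mid_kernel mud f p w = K p w.
  apply: lift_mid_kernel => [s t b w|[t b] w].
    rewrite /K des Ls; congr (_ * _); apply: etrans (ffunE _ _) _.
    exact: (congr1 (L (de w)) (congr2 pair (Fd_sactK s t) (sactK s b))).
  have := col_in (b : words mu d be) (LT (de w)); rewrite (image_fixed (Fd_mor_idem mud (X := X))).
  move=> /eqP/ffunP/(_ t); rewrite !ffunE => E; rewrite /K -E mulr_sumr.
  by apply: eq_bigr => t' _; rewrite mulrCA ffunE.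
exists (Hpure 1 f 1); apply/lfunP => u; apply: subvs_inj.
rewrite hspec_pureE !rmorph1 mulr1 scale1r; apply/ffunP => p; rewrite spec_compE.
have Lu : L (vsval u) = vsval (k u) by rewrite /L Pid ?subvsP // vsvalK.
have -> : mid_row mud f p.1 (vsval (iota u)) = c^-1 *: row_of (vsval (k u)) p.1.
  apply/ffunP => b; rewrite !ffunE aE -Lu LE sum_ffunE -[RHS]/(_ * _) mulr_sumr.
  apply: eq_bigr => w _; rewrite fE /K !ffunE.
  rewrite -[a *: _]/(a * _) -[_ *: L _ _]/(_ * _).
  by move: (L (de w) _) (vsval u w) => y z; field; apply/andP.
have rS : row_of (vsval (k u)) p.1 \in S' by apply: row_in; exact: subvsP.
have Pil := pi_fun_linear pi.
have := Pil c^-1 (row_of (vsval (k u)) p.1) 0; rewrite (linear_at0 Pil) !addr0 => ->.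
by rewrite cE // scalerA mulVf // scale1r ffunE -surjective_pairing.
Qed.
End Surjective.
End Specialisation.

Theorem theorem5p4 (l : nat) (al be : Tseq l)
    (hal : partition_tail al) (hbe : partition_tail be) :
  (forall X : karoubi (Cdel l), finitely_generated (Hsp al be X)) /\
  exists Hmap : forall X Y : karoubi (Cdel l), khom X Y ->
      {linear Hsp al be X -> Hsp al be Y},
    [/\ forall (X Y : karoubi (Cdel l)) (g : khom X Y) y f x,
          Hmap X Y g (Hpure y f x) = Hpure y (mid_map g f) x,
        forall (X : karoubi (Cdel l)) h, Hmap X X (kid X) h = h,
        forall (X Y Z : karoubi (Cdel l)) (g' : khom Y Z) (g : khom X Y) h,
          Hmap X Z (kcomp g' g) h = Hmap Y Z g' (Hmap X Y g h) &
        forall (d : nat) (mu : l.-tuple nat),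
          (\sum_(i < l) tnth mu i)%N = d ->
          is_partition (phi mu al) -> is_partition (phi mu be) ->
          forall (iota : slin (specht mu d al) (Mmod mu d al))
                 (pi : slin (Mmod mu d be) (specht mu d be)),
            equivariant iota -> iota != 0 -> equivariant pi -> pi != 0 ->
          exists Psi : forall X : karoubi (Cdel l), Hsp al be X ->
              slin (specht mu d al) (smod_tens (Fd mu d X) (specht mu d be)),
            [/\ forall (X : karoubi (Cdel l)) c h h',
                  Psi X (c *: h + h') = eval_mu mu c *: Psi X h + Psi X h',
                forall (X : karoubi (Cdel l)) y f x u,
                  vsval (Psi X (Hpure y f x) u) =
                    (eval_mu mu y * eval_mu mu x) *: spec_comp iota pi f u,
                forall (X : karoubi (Cdel l)) h, equivariant (Psi X h),
                forall (X : karoubi (Cdel l))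
                    (k : slin (specht mu d al)
                              (smod_tens (Fd mu d X) (specht mu d be))),
                  equivariant k -> exists h, Psi X h = k &
                forall (X Y : karoubi (Cdel l)) (g : khom X Y) h u,
                  vsval (Psi Y (Hmap X Y g h) u) =
                    kapl (Fd_mor mu (kraw g)) (vsval (Psi X h u))]].
Proof.
split=> [X|]; first exact: Hsp_fg.
exists (fun X Y g => hmap (al := al) (be := be) g); split.
- by move=> X Y g y f x; exact: hmap_pure.
- by move=> X h; exact: hmap_id.
- by move=> X Y Z g' g h; exact: hmap_comp.
move=> d mu mud pal pbe iota pi ie i0 pe p0.
exists (fun X => hspec iota pi (X := X)); split.
- by move=> X c h h'; exact: (hspec_linear mud pal pbe ie i0 pe p0).
- by move=> X y f x u; exact: (hspec_pureE mud pal pbe ie i0 pe p0).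
- by move=> X h; exact: (hspec_equivariant mud pal pbe ie i0 pe p0).
- by move=> X k; exact: (hspec_surj mud pal pbe ie i0 pe p0).
by move=> X Y g h u; exact: (hspec_natural mud pal pbe ie i0 pe p0).
Qed.
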